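(* Let $\rho$ be the pseudo-max distance: for columns of $\mathbf X^\dagger$ (and likewise of $\mathbf H^\dagger$), $\rho(\mathbf X^\dagger_{\cdot i},\mathbf X^\dagger_{\cdot j})=\max_{\ell\ne i,j}\big|\frac1{p^\dagger}(\mathbf X^\dagger_{\cdot i}-\mathbf X^\dagger_{\cdot j})'\mathbf X^\dagger_{\cdot\ell}\big|$. Assume the setup and Assumption 1 below, and: (i) for every $\varepsilon>0$, $\lim_{\Delta\to0}\limsup_{n,p^\dagger\to\infty}\mathbb P\big\{\max_{i\in[n]}\max_{j:\rho(\mathbf H^\dagger_{\cdot i},\mathbf H^\dagger_{\cdot j})<\Delta}\|\boldsymbol\alpha_i-\boldsymbol\alpha_j\|>\varepsilon\big\}=0$; (ii) for some $\underline c>0$, $\lim_{n,p^\dagger\to\infty}\mathbb P\big\{\min_{i\in[n]}s_{\min}\big(\frac1{p^\dagger}\nabla\boldsymbol\eta^\dagger(\boldsymbol\alpha_i)'\nabla\boldsymbol\eta^\dagger(\boldsymbol\alpha_i)\big)\ge\underline c\big\}=1$; (iii) for some $\underline c'>0$, $\lim_{n,p^\dagger\to\infty}\mathbb P\big\{\min_{\ell\in[r]}\min_{i\in[n]}\sup_{\boldsymbol\alpha\in\mathcal A}\frac1{p^\dagger}\|\mathscr P_{\boldsymbol\alpha_i,\ell}[\boldsymbol\eta^\dagger(\boldsymbol\alpha)]\|^2\ge\underline c'\big\}=1$. If $n^{4/\nu}(\log n)^{(\nu-2)/\nu}/p\lesssim1$, then Assumption 2 holds with $a_n=((\log n)/p)^{1/2}$,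 $\rho_0=0$, $\underline\varsigma=\bar\varsigma=1$.
   Context: Setup: data form a $p\times n$ matrix $\mathbf X=\mathbf H+\mathbf U$ whose $i$th column is $\mathbf x_i=\boldsymbol\eta(\boldsymbol\alpha_i)+\mathbf u_i$, $i=1,\dots,n$, with entries $x_{il}$, where $\boldsymbol\alpha_i\in\mathbb R^r$ ($r$ fixed) are unobserved latent variables, $\boldsymbol\eta=(\eta_1,\dots,\eta_p)':\mathbb R^r\to\mathbb R^p$ are unobserved latent functions, $\mathbf H$ has $i$th column $\boldsymbol\eta(\boldsymbol\alpha_i)$, $\mathbf U$ has $i$th column $\mathbf u_i=(u_{i1},\dots,u_{ip})'$, and $\mathbb E[\mathbf u_i\mid\mathscr F]=0$, where $\mathscr F$ is the $\sigma$-field generated by $(\boldsymbol\alpha_i)_{i\le n}$ and $\boldsymbol\eta(\cdot)$. Asymptotics are as $n,p\to\infty$. Assumption 1: (a) $(\boldsymbol\alpha_i)_{i\le n}$ are i.i.d. with compact convex support $\mathcal A\subset\mathbb R^r$ and a density bounded and bounded away from zero on $\mathcal A$; (b) each $\eta_l$ is $\bar m$ times continuously differentiable for some $\bar m\ge 2$, with all partial derivatives of order at most $\bar m$ bounded by a constant not depending on $l$; (c) the $u_{il}$ are independent across $i$ and $l$ conditional on $\mathscr F$, and for some $\nu>0$, $\max_{i,l}\mathbb E[|u_{il}|^{2+\nu}\mid\mathscr F]<\infty$ a.s. Row splitting: the row index set is split into disjoint sets $[p]=\mathcal R^\dagger\cup\mathcal R^\ddagger$ with $p^\dagger=|\mathcal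 R^\dagger|\asymp p^\ddagger=|\mathcal R^\ddagger|\asymp p$; $\mathbf X^\dagger,\mathbf H^\dagger$ are the submatrices of $\mathbf X,\mathbf H$ with rows in $\mathcal R^\dagger$, and $\mathbf A_{\cdot i}$ denotes the $i$th column of $\mathbf A$. $\boldsymbol\eta^\dagger=(\eta_l)_{l\in\mathcal R^\dagger}:\mathbb R^r\to\mathbb R^{p^\dagger}$ and $\nabla\boldsymbol\eta^\dagger(\boldsymbol\alpha)$ is its $p^\dagger\times r$ Jacobian matrix; $s_{\min}$ denotes smallest singular value. For $\boldsymbol\alpha\in\mathcal A$, fix an orthonormal basis of the $r$-dimensional column space of $\nabla\boldsymbol\eta^\dagger(\boldsymbol\alpha)$ (the tangent space at $\boldsymbol\eta^\dagger(\boldsymbol\alpha)$), and let $\mathscr P_{\boldsymbol\alpha,\ell}[\cdot]$ denote orthogonal projection in $\mathbb R^{p^\dagger}$ onto the $\ell$th basis direction. Asymptotic notation: $a_n\lesssim_{\mathbb P}b_n$ means $\lim_{\varepsilon\to\infty}\limsup_n\mathbb P(|a_n/b_n|\ge\varepsilon)=0$; $a_n\gtrsim_{\mathbb P}b_n$ means $b_n\lesssim_{\mathbb P}a_n$; $a_n\lesssim b_n$ means $\limsup_n|a_n/b_n|<\infty$. Assumption 2 (Indirect matching): there exist fixed constants $\rho_0\ge0$, $\underline\varsigma>0$, $\bar\varsigma>0$ and a positive sequence $a_n=o(1)$ such that (a) $\max_{1\le i,j\le n}|\rho(\mathbf X^\dagger_{\cdot i},\mathbf X^\dagger_{\cdot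 j})-\rho(\mathbf H^\dagger_{\cdot i},\mathbf H^\dagger_{\cdot j})-\rho_0|\lesssim_{\mathbb P}a_n$; (b) $\max_{i,j:\boldsymbol\alpha_i\ne\boldsymbol\alpha_j}\rho(\mathbf H^\dagger_{\cdot i},\mathbf H^\dagger_{\cdot j})/\|\boldsymbol\alpha_i-\boldsymbol\alpha_j\|^{\bar\varsigma}\lesssim_{\mathbb P}1$ and $\min_{i,j:\boldsymbol\alpha_i\ne\boldsymbol\alpha_j}\rho(\mathbf H^\dagger_{\cdot i},\mathbf H^\dagger_{\cdot j})/\|\boldsymbol\alpha_i-\boldsymbol\alpha_j\|^{\underline\varsigma}\gtrsim_{\mathbb P}1$. *)

(* Defs.v *)
From HB Require Import structures.
From mathcomp Require Import all_boot all_order all_algebra.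
From mathcomp Require Import all_classical all_reals all_analysis.
From mathcomp Require Import measurable_realfun.
Set Implicit Arguments.
Unset Strict Implicit.
Unset Printing Implicit Defensive.
Import Order.TTheory GRing.Theory Num.Theory.
Import numFieldNormedType.Exports.
Local Open Scope classical_set_scope.
Local Open Scope ring_scope.

Section LinAlg.
Variable R : realType.

Definition enorm (k : nat) (v : 'rV[R]_k) : R :=
  Num.sqrt (\sum_(j < k) v 0 j ^+ 2).

Definition enorm2c (m : nat) (v : 'cV[R]_m) : R := \sum_(j < m) v j 0 ^+ 2.

Definition unitvec (r : nat) (k : 'I_r) : 'rV[R]_r := \row_(j < r) (j == k)%:R.

Definition pderiv (r : nat) (s : seq 'I_r) (f : 'rV[R]_r -> R) : 'rV[R]_r -> R :=
  foldr (fun k g => 'D_(unitvec k) g) f s.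

Definition Cm (r m : nat) (f : 'rV[R]_r -> R) : Prop :=
  forall s : seq 'I_r, (size s <= m)%N ->
    continuous (pderiv s f) /\
    ((size s < m)%N -> forall x k, derivable (pderiv s f) x (unitvec k)).

Definition smin (r : nat) (M : 'M[R]_r) : R :=
  Num.sqrt (inf [set a : R | eigenvalue (M^T *m M) a]).

Definition onb_colspace (m r : nat) (Q J : 'M[R]_(m, r)) : Prop :=
  Q^T *m Q = 1%:M /\ (Q^T == J^T)%MS.

Definition proj_norm2 (m r : nat) (Q : 'M[R]_(m, r)) (l : 'I_r) (v : 'cV[R]_m) : R :=
  enorm2c (((col l Q)^T *m v) 0 0 *: col l Q).

Fixpoint iint (k : nat) : ('rV[R]_k -> \bar R) -> \bar R :=
  match k with
  | 0 => fun h => h 0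
  | k'.+1 => fun h =>
      (\int[@lebesgue_measure R]_x iint (fun v : 'rV[R]_k' => h (row_mx (\row_(_ < 1) x) v)))%E
  end.

End LinAlg.
Arguments unitvec {R r}.
Arguments iint {R k}.
Arguments enorm {R k}.
Arguments enorm2c {R m}.

Section Model.
Variable R : realType.

Definition jac (m r : nat) (S : {set 'I_m}) (eta : nat -> 'rV[R]_r -> R)
  (a : 'rV[R]_r) : 'M[R]_(#|S|, r) :=
  \matrix_(j < #|S|, k < r) 'D_(unitvec k) (eta (nat_of_ord (enum_val j : 'I_m))) a.

Definition etavec (m r : nat) (S : {set 'I_m}) (eta : nat -> 'rV[R]_r -> R)
  (a : 'rV[R]_r) : 'cV[R]_#|S| :=
  \col_(j < #|S|) eta (nat_of_ord (enum_val j : 'I_m)) a.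

Definition gram (m r : nat) (S : {set 'I_m}) (eta : nat -> 'rV[R]_r -> R)
  (a : 'rV[R]_r) : 'M[R]_r :=
  (#|S|%:R)^-1 *: ((jac S eta a)^T *m jac S eta a).

(* pseudo-max distance between columns i and j of the data Y (Y i l = entry
   in row l of column i), restricted to rows in S, columns in [n] *)
Definition rho (n m : nat) (S : {set 'I_m}) (Y : nat -> nat -> R) (i j : nat) : R :=
  \big[Num.max/0]_(k < n | (nat_of_ord k != i) && (nat_of_ord k != j))
     `| (#|S|%:R)^-1 * \sum_(l in S) (Y i l - Y j l) * Y k l |.

Definition lesssim (a b : nat -> R) : Prop :=
  exists C : R, \forall n \near \oo, `|a n| <= C * `|b n|.

End Model.

Section Prob.
Variables (R : realType) (d : measure_display) (T : measurableType d)
          (P : probability T R).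

(* a_n <~_P b_n : lim_{eps -> oo} limsup_n P(|a_n / b_n| >= eps) = 0,
   with |a_n / b_n| >= eps written as eps |b_n| <= |a_n| *)
Definition lesssimP (a b : nat -> T -> R) : Prop :=
  limn_esup (fun n => P [set w | x * `|b n w| <= `|a n w|]) @[x --> +oo] --> 0%E.

Definition measurable_wrt (F : set (set T)) (g : T -> \bar R) : Prop :=
  forall B : set (\bar R), measurable B -> F (g @^-1` B).

Definition cexp_version (F : set (set T)) (f g : T -> \bar R) : Prop :=
  measurable_wrt F g /\ (forall w, (0 <= g w)%E) /\
  forall A, F A -> (\int[P]_(w in A) g w = \int[P]_(w in A) f w)%E.

(* E[v | F] = 0 (generalized conditional expectation):
   E[v^+|F] = E[v^-|F] < oo a.s. *)
Definition cond_mean_zero (F : set (set T)) (v : T -> R) : Prop :=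
  exists g, cexp_version F (fun w => (Num.max (v w) 0)%:E) g /\
            cexp_version F (fun w => (Num.max (- v w) 0)%:E) g /\
            {ae P, forall w, (g w < +oo)%E}.

Definition cond_indep (F : set (set T)) (u : nat -> nat -> T -> R) : Prop :=
  forall s : seq (nat * nat), uniq s ->
  forall B : nat * nat -> set R, (forall k, measurable (B k)) ->
  forall g : nat * nat -> T -> \bar R,
    (forall k, k \in s ->
       cexp_version F (fun w => (\1_(B k) (u k.1 k.2 w))%:E) (g k)) ->
  forall A, F A ->
    P (A `&` \big[setI/setT]_(k <- s) (u k.1 k.2 @^-1` B k)) =
    (\int[P]_(w in A) \prod_(k <- s) g k w)%E.

Definition indep_family (S : nat -> set (set T)) : Prop :=
  forall s : seq nat, uniq s -> forall A : nat -> set T,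
    (forall i, i \in s -> S i (A i)) ->
    P (\big[setI/setT]_(i <- s) A i) = (\prod_(i <- s) P (A i))%E.

Definition sigma_rv (r : nat) (X : T -> 'rV[R]_r) : set (set T) :=
  <<s [set A | exists k (B : set R), measurable B /\ A = (fun w => X w 0 k) @^-1` B] >>.

Definition sigmaF (r : nat) (alpha : nat -> T -> 'rV[R]_r)
  (eta : nat -> T -> 'rV[R]_r -> R) : set (set T) :=
  <<s [set A | (exists i k (B : set R), measurable B /\
                   A = (fun w => alpha i w 0 k) @^-1` B) \/
               (exists l a (B : set R), measurable B /\
                   A = (fun w => eta l w a) @^-1` B)] >>.

(* each alpha_i has the density f w.r.t. Lebesgue measure on R^r, with f
   vanishing off Aset and bounded and bounded away from zero on Aset
   (stated on measurable rectangles, which determine the law) *)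
Definition density_on (r : nat) (alpha : nat -> T -> 'rV[R]_r)
  (Aset : set 'rV[R]_r) : Prop :=
  exists (f : 'rV[R]_r -> R) (c C : R), 0 < c /\
    (forall a, Aset a -> c <= f a <= C) /\
    (forall a, ~ Aset a -> f a = 0) /\
    forall i (B : 'I_r -> set R), (forall k, measurable (B k)) ->
      P [set w | forall k, B k (alpha i w 0 k)] =
      iint (fun a => (f a * \prod_(k < r) \1_(B k) (a 0 k))%:E).

End Prob.

(* Main.v *)
Require Import Defs.
From HB Require Import structures.
From mathcomp Require Import all_boot all_order all_algebra.
From mathcomp Require Import all_classical all_reals all_analysis.
From mathcomp Require Import measurable_realfun.
From mathcomp Require Import zify ring lra.
Set Implicit Arguments.
Unset Strict Implicit.
Unset Printing Implicit Defensive.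
Import Order.TTheory GRing.Theory Num.Theory.
Import numFieldNormedType.Exports.
Local Open Scope classical_set_scope.
Local Open Scope ring_scope.

(** Proof idea. Noise: restrict to the event in F where the conditional moments of order 2+nu are at most K. For i <> k the sums over l of u_il u_kl and of eta_l(alpha_i) u_kl have terms that are centred and independent given F and the i-th column. Truncate the terms at 1/lam with lam = sqrt (log n / p): an exponential bound for the truncated part and Chebyshev's inequality for the excess give a tail of order n^-4 + x^-2 n^-2, because the rate condition says lam^nu = O(log n / n^2). A union bound over the n^2 pairs concludes.

The upper ratio bound is the Lipschitz property. For the lower one put a = alpha_i, D = alpha_i - alpha_j. The function f(z), the average over l of (grad eta_l(a) . D) eta_l(z), has at a the gradient w = gram(a) D, and |w| >= c |D|. The support contains a cube, and by convexity the segments from a to the cube; with probability tending to one the sample meets every grid cell of a fixed mesh inside the support. Two sample points near a + t (x0 - a + b sign(w) / 2) and a + t (x0 - a - b sign(w) / 2) therefore have f-values that differ by a multiple of |D|, so that one of them is large; it differs by O(|D|^2) from the average defining rho. Pairs at distance bounded away from zero are covered by condition (i). *)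

(** * Sub-sigma-algebras *)

(** Only moments of order 2 + [nu] are available, so the Chebyshev part of the tail decays merely
    like x^-2. The union over n^2 pairs uses up its factor n^-2, and what remains is small for large
    x, not for large n; [lesssimP] asks for no more.

    Conditional expectations occur only as integrals over sets of F, and centring means that the
    positive and negative parts have equal integrals. Multiplying such a relation by a function of
    other noise coordinates is the crux: [le_integral_transfer] does it by conditional independence.
    The two parts stay separate throughout, so that all integrals are of nonnegative functions.

    In the lower bound nothing is known about f at a itself; only increments of f are controlled to
    first order, hence two sample points. Their first-order gap is linear in t and the Taylor error
    quadratic, which fixes t. The cube exists because a law with a density charges no hyperplane.

    Monotonicity of P is used between measurable events only. This is why random functions at random
    points, Gram matrices and smallest singular values need measurability proofs. *)

Section SubSigma.
Context d (T : measurableType d) (R : realType) (P : probability T R).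
Local Open Scope ereal_scope.
Implicit Types (G : set (set T)) (f W Z : T -> R).

(** Putting the coarser σ-algebra on the carrier makes every closure lemma for measurable functions
    apply to it as it stands. *)
Definition mwrt G f := @measurable_fun _ _ (g_sigma_algebraType G) R setT f.

Lemma sub_gen G : G `<=` measurable -> <<s G>> `<=` measurable.
Proof. exact: smallest_sub (@sigma_algebra_measurable _ T). Qed.

Lemma mwrt_preimage G f (B : set R) : mwrt G f -> measurable B -> <<s G>> (f @^-1` B).
Proof. by move=> mf mB; have := mf measurableT _ mB; rewrite setTI. Qed.

Lemma mwrt_measurable G f : G `<=` measurable -> mwrt G f -> measurable_fun setT f.
Proof.
move=> Gm mf _ B mB; rewrite setTI.
by apply: (sub_gen Gm); exact: mwrt_preimage.
Qed.

Lemma mwrt_sub G G' f : G `<=` <<s G'>> -> mwrt G f -> mwrt G' f.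
Proof.
move=> GG' mf _ B mB; rewrite setTI.
have := mf measurableT _ mB; rewrite setTI.
by apply: smallest_sub => //; exact: smallest_sigma_algebra.
Qed.

Lemma mwrt_indic G A : <<s G>> A -> mwrt G (\1_A : T -> R).
Proof. by move=> GA; exact: (@measurable_indic _ (g_sigma_algebraType G) R setT A). Qed.

Import HBNNSimple.

(** An inequality between conditional expectations given G, tested against a weight. For a simple W
    it is the hypothesis on the level sets of W; monotone convergence gives the rest. *)
Lemma le_integral_mwrt G f1 f2 W : G `<=` measurable ->
  measurable_fun setT f1 -> measurable_fun setT f2 ->
  (forall w, (0 <= f1 w)%R) -> (forall w, (0 <= f2 w)%R) ->
  (forall A, <<s G>> A -> \int[P]_(w in A) (f1 w)%:E <= \int[P]_(w in A) (f2 w)%:E) ->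
  mwrt G W -> (forall w, (0 <= W w)%R) ->
  \int[P]_w (W w * f1 w)%:E <= \int[P]_w (W w * f2 w)%:E.
Proof.
move=> Gm mf1 mf2 f10 f20 f12 mW W0.
pose T' := g_sigma_algebraType G : measurableType _.
have mW' : measurable_fun [set: T'] (EFin \o W) by exact/measurable_EFinP.
(* The approximation is built on [T'], so that its level sets belong to [<<s G>>], where the
   hypothesis applies. *)
pose h := nnsfun_approx (measurableT : measurable [set: T']) mW'.
have h0 n w : (0 <= h n w)%R by [].
have cvh (w : T') : (h n w)%:E @[n --> \oo] --> (W w)%:E.
  by apply: cvg_nnsfun_approx => //= x _; rewrite lee_fin.
have mh n : measurable_fun setT (h n : T -> R).
  by apply: (@mwrt_measurable G) => //; exact: measurable_funP.
have ndh (w : T') m n : (m <= n)%N -> (h m w <= h n w)%R.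
  by move=> mn; exact/lefP/nd_nnsfun_approx.
have step f : measurable_fun setT f -> (forall w, 0 <= f w)%R ->
    \int[P]_w (W w * f w)%:E = limn (fun n => \int[P]_w (h n w * f w)%:E).
  move=> mf f0; rewrite -monotone_convergence//.
  - apply: eq_integral => w _; apply/esym/cvg_lim => //.
    under eq_fun do rewrite EFinM.
    by rewrite EFinM; apply: cvgeMr.
  - by move=> n; apply/measurable_EFinP; apply: measurable_funM.
  - by move=> n w _; rewrite lee_fin mulr_ge0.
  - move=> w _ m n mn; rewrite lee_fin ler_wpM2r//.
    exact: ndh.
have cv f : measurable_fun setT f -> (forall w, 0 <= f w)%R ->
    cvgn (fun n => \int[P]_w (h n w * f w)%:E).
  move=> mf f0; apply: ereal_nondecreasing_is_cvgn => m n mn.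
  apply: ge0_le_integral => //.
  - by move=> w _; rewrite lee_fin mulr_ge0.
  - by apply/measurable_EFinP; apply: measurable_funM.
  - by apply/measurable_EFinP; apply: measurable_funM.
  - by move=> w _; rewrite lee_fin ler_wpM2r//; exact: ndh.
rewrite !step//; apply: lee_lim; [exact: cv|exact: cv|].
apply: nearW => n.
have Gh y : <<s G>> (h n @^-1` [set y]).
  by apply: mwrt_preimage => //; exact: measurable_funP.
have E f : measurable_fun setT f -> (forall w, 0 <= f w)%R ->
   \int[P]_w (h n w * f w)%:E =
   \sum_(y \in range (h n)) (y%:E * \int[P]_(w in h n @^-1` [set y]) (f w)%:E).
  move=> mf f0.
  have H w : (h n w * f w)%:E =
      \sum_(y \in range (h n)) (y * \1_(h n @^-1` [set y]) w * f w)%:E.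
    by rewrite fsumEFin// -mulr_fsuml -?fimfunE.
  under eq_integral do rewrite H.
  rewrite ge0_integral_fsum//; last 2 first.
  - move=> y; apply/measurable_EFinP; apply: measurable_funM => //.
    apply: measurable_funM => //.
    by apply: measurable_indic; apply: (sub_gen Gm); exact: Gh.
  - move=> y w _; rewrite EFinM mule_ge0 ?lee_fin//.
    by rewrite -lee_fin EFinM nnfun_muleindic_ge0.
  apply: eq_fsbigr => y; rewrite inE => -[w0 _ <-{y}].
  set A := _ @^-1` _.
  have mA : d.-measurable (A : set T) by apply: (sub_gen Gm); exact: Gh.
  under eq_integral do rewrite -mulrA EFinM.
  rewrite ge0_integralZl_EFin//; last 2 first.
  - by move=> w _; rewrite lee_fin mulr_ge0.
  - by apply/measurable_EFinP; apply: measurable_funM => //; exact: measurable_indic.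
  congr (_ * _); rewrite [RHS]integral_mkcond; apply: eq_integral => w _.
  by rewrite patchE indicE; case: ifPn; rewrite ?mul1r ?mul0r.
rewrite !E//; apply: lee_fsum => // y [w _ <-].
by apply: lee_wpmul2l; [rewrite lee_fin|exact: f12].
Qed.

Lemma eq_integral_mwrt G f1 f2 W : G `<=` measurable ->
  measurable_fun setT f1 -> measurable_fun setT f2 ->
  (forall w, (0 <= f1 w)%R) -> (forall w, (0 <= f2 w)%R) ->
  (forall A, <<s G>> A -> \int[P]_(w in A) (f1 w)%:E = \int[P]_(w in A) (f2 w)%:E) ->
  mwrt G W -> (forall w, (0 <= W w)%R) ->
  \int[P]_w (W w * f1 w)%:E = \int[P]_w (W w * f2 w)%:E.
Proof.
move=> Gm mf1 mf2 f10 f20 f12 mW W0.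
apply/eqP; rewrite eq_le; apply/andP; split; apply: (le_integral_mwrt Gm) => // A GA;
  by rewrite f12.
Qed.

Lemma integral_in_indic A f : measurable A -> 
  \int[P]_(w in A) (f w)%:E = \int[P]_w (\1_A w * f w)%:E.
Proof.
move=> mA; rewrite integral_mkcond; apply: eq_integral => w _.
by rewrite patchE indicE; case: ifPn; rewrite ?mul1r ?mul0r.
Qed.

End SubSigma.

(** * Conditional probabilities by the Radon-Nikodym theorem *)

Section CondProb.
Context d (T : measurableType d) (R : realType) (P : probability T R).
Variables (G : set (set T)) (E : set T).
Hypotheses (Gm : G `<=` measurable) (mE : measurable E).
Local Open Scope ereal_scope.
Local Notation T' := (g_sigma_algebraType G).

(** Pushing P forward along this identity map restricts it to the σ-algebra generated by G. *)
Definition sub_emb : T -> T' := fun x => x.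

Let mid : measurable_fun setT sub_emb.
Proof. by move=> _ B mB; rewrite setTI; apply: sub_gen mB. Qed.

HB.instance Definition _ := isMeasurableFun.Build _ _ _ _ sub_emb mid.

(** Its density with respect to the restriction of P is the conditional probability of E given G. *)
Definition trace_prob : set T' -> \bar R := fun A => P (A `&` E).

Let nu0 : trace_prob set0 = 0. Proof. by rewrite /trace_prob set0I measure0. Qed.

Let nu_ge0 A : 0 <= trace_prob A. Proof. exact: measure_ge0. Qed.

Let nu_sigma_additive : semi_sigma_additive trace_prob.
Proof.
exact: (@measure_semi_sigma_additive _ _ _ (pushforward (mrestr P mE) sub_emb)).
Qed.

HB.instance Definition _ := isMeasure.Build _ _ _ trace_prob nu0 nu_ge0 nu_sigma_additive.

Let nu_fin : fin_num_fun trace_prob.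
Proof.
by move=> A mA; rewrite fin_num_measure//; apply: measurableI => //; exact: (sub_gen Gm).
Qed.

HB.instance Definition _ := @Measure_isFinite.Build _ _ _ trace_prob nu_fin.

(** [trace_prob] is at most P, hence dominated. Its density is finite everywhere, so [fine] makes it
    real valued. *)
Lemma cond_prob_exists :
  exists Z : T -> R, [/\ mwrt G Z, (forall w, (0 <= Z w)%R) &
    forall A, <<s G>> A -> \int[P]_(w in A) (Z w)%:E = P (A `&` E)].
Proof.
pose mu' : probability T' R := distribution P sub_emb.
have dom : trace_prob `<< mu'.
  apply/null_content_dominatesP => A mA A0; apply/eqP; rewrite eq_le measure_ge0 andbT.
  rewrite -A0; apply: le_measure; rewrite ?inE//.
  - by apply: measurableI => //; exact: (sub_gen Gm).
  - exact: (sub_gen Gm).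
have [f [f0 ffin fint fE]] := radon_nikodym_sigma_finite dom.
have mf : measurable_fun setT f by exact: measurable_int fint.
have mf' : mwrt G (fine \o f) by apply: measurableT_comp.
exists (fine \o f); split => //.
- by move=> w; rewrite fine_ge0.
move=> A GA; rewrite -[RHS]/(trace_prob A) fE//.
rewrite ge0_integral_pushforward//.
- by apply: eq_integral => w _; rewrite /= fineK.
- exact: measurable_funTS.
Qed.

End CondProb.

(** * Conditional independence *)

Section Dens.
Context d (T : measurableType d) (R : realType) (P : {measure set T -> \bar R}).
Variable (f : T -> R).
Hypotheses (mf : measurable_fun setT f) (f0 : forall w, (0 <= f w)%R).
Local Open Scope ereal_scope.

(** Seen as a measure, the integral over a varying set falls under the uniqueness theorem for
    measures that agree on a π-system. *)
Definition dens (A : set T) : \bar R := \int[P]_(w in A) (f w)%:E.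

Let dens0 : dens set0 = 0. Proof. by rewrite /dens integral_set0. Qed.

Let dens_ge0 A : 0 <= dens A.
Proof. by apply: integral_ge0 => w _; rewrite lee_fin. Qed.

Let dens_sigma_additive : semi_sigma_additive dens.
Proof.
move=> F mF tF mUF; rewrite /dens ge0_integral_bigcup//.
- apply: is_cvg_ereal_nneg_natsum_cond => n _ _.
  by apply: integral_ge0 => w _; rewrite lee_fin.
- by apply: measurable_funTS; exact/measurable_EFinP.
- by move=> w _; rewrite lee_fin.
Qed.

HB.instance Definition _ := isMeasure.Build _ _ _ dens dens0 dens_ge0 dens_sigma_additive.

Definition dens_measure : {measure set T -> \bar R} := dens.

Lemma dens_measureE A : dens_measure A = \int[P]_(w in A) (f w)%:E.
Proof. by []. Qed.

End Dens.

Section CondIndep.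
Context d (T : measurableType d) (R : realType) (P : probability T R).
Local Open Scope ereal_scope.

Lemma integral_unique_pi (G : set (set T)) (f1 f2 : T -> R) : G `<=` measurable -> G setT ->
  setI_closed G -> measurable_fun setT f1 -> measurable_fun setT f2 ->
  (forall w, (0 <= f1 w)%R) -> (forall w, (0 <= f2 w)%R) ->
  \int[P]_w (f1 w)%:E < +oo ->
  (forall A, G A -> \int[P]_(w in A) (f1 w)%:E = \int[P]_(w in A) (f2 w)%:E) ->
  forall A, <<s G>> A -> \int[P]_(w in A) (f1 w)%:E = \int[P]_(w in A) (f2 w)%:E.
Proof.
move=> Gm GT GI mf1 mf2 f10 f20 f1oo f12 A GA.
rewrite -(dens_measureE P mf1 f10) -(dens_measureE P mf2 f20).
apply: (g_sigma_algebra_measure_unique G Gm (fun=> setT)) => //.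
by rewrite bigcup_const//; exists 0%N.
Qed.

Variables (F : set (set T)) (u : nat -> nat -> T -> R).
Hypotheses (sF : sigma_algebra setT F) (Fm : F `<=` measurable).
Hypothesis mu : forall i l, measurable_fun setT (u i l).
Hypothesis ci : cond_indep P F u.

Let gF : <<s F>> = F. Proof. exact: sigma_algebra_id. Qed.

Let FI A B : F A -> F B -> F (A `&` B).
Proof. by rewrite -gF; apply: (@measurableI _ (g_sigma_algebraType F)). Qed.

Let FT : F setT.
Proof. by rewrite -gF; apply: (@measurableT _ (g_sigma_algebraType F)). Qed.

Definition cyl (s : seq (nat * nat)) (B : nat * nat -> set R) : set T :=
  \big[setI/setT]_(k <- s) (u k.1 k.2 @^-1` B k).

Lemma cylP s B w : cyl s B w <-> forall k, k \in s -> B k (u k.1 k.2 w).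
Proof. by rewrite /cyl -bigcap_seq; split=> [H k ks|H k ks]; exact: H. Qed.

Lemma measurable_cyl s B : (forall k, measurable (B k)) -> measurable (cyl s B).
Proof.
move=> mB; rewrite /cyl; elim/big_ind: _ => //; first exact: measurableI.
by move=> k _; rewrite -[X in measurable X]setTI; exact: mu.
Qed.

(* The pi-system generating the sigma-algebra of F together with the u_k, k in I. *)
Definition Fcyl (I : pred (nat * nat)) : set (set T) :=
  [set E | exists A s B, [/\ F A, uniq s, {subset s <= I},
     (forall k, measurable (B k)) & E = A `&` cyl s B]].

Lemma Fcyl_measurable I : Fcyl I `<=` measurable.
Proof.
move=> _ [A [s [B [FA us sI mB ->]]]]; apply: measurableI; first exact: Fm.
exact: measurable_cyl.
Qed.

Lemma sub_Fcyl I : F `<=` Fcyl I.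
Proof.
move=> A FA; exists A, [::], (fun=> setT); split => //.
by rewrite /cyl big_nil setIT.
Qed.

Lemma FcylT I : Fcyl I setT. Proof. exact: sub_Fcyl. Qed.

Lemma FcylS (I J : pred (nat * nat)) : {subset I <= J} -> Fcyl I `<=` Fcyl J.
Proof.
move=> IJ _ [A [s [B [FA us sI mB ->]]]]; exists A, s, B; split => //.
by move=> k /sI /IJ.
Qed.

Lemma FcylI I : setI_closed (Fcyl I).
Proof.
move=> _ _ [A [s [B [FA us sI mB ->]]]] [A' [s' [B' [FA' us' sI' mB' ->]]]].
(* An index missing from one list receives [setT], a vacuous constraint, so the two lists may
   overlap. *)
exists (A `&` A'), (undup (s ++ s')),
  (fun k => (if k \in s then B k else setT) `&` (if k \in s' then B' k else setT)).
split.
- exact: FI.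
- exact: undup_uniq.
- by move=> k; rewrite mem_undup mem_cat => /orP[/sI|/sI'].
- by move=> k; apply: measurableI; case: ifP.
- apply/seteqP; split => [w [[Aw /cylP Bw] [A'w /cylP B'w]]|w [[Aw A'w] /cylP BBw]].
    split => //; apply/cylP => k _; split; case: ifPn => //; [exact: Bw|exact: B'w].
  split; split => //; apply/cylP => k ks;
    have [] := BBw k; rewrite ?mem_undup ?mem_cat ?ks ?orbT//.
Qed.

Lemma mwrt_Fcyl I k : k \in I -> mwrt (Fcyl I) (u k.1 k.2).
Proof.
move=> kI _ B mB; rewrite setTI; apply: sub_sigma_algebra.
exists setT, [:: k], (fun=> B); split => //.
- by move=> j; rewrite inE => /eqP ->.
- by rewrite /cyl big_seq1 setTI.
Qed.

(** Z is a real-valued version of the conditional probability of E given F. *)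
Definition cprob (E : set T) (Z : T -> R) :=
  [/\ mwrt F Z, (forall w, (0 <= Z w)%R) &
    forall A, F A -> \int[P]_(w in A) (Z w)%:E = P (A `&` E)].

Lemma cprob_ex E : measurable E -> exists Z, cprob E Z.
Proof. by move=> mE; have [Z [? ? H]] := cond_prob_exists P Fm mE; exists Z; split => // A FA; apply: H; rewrite gF. Qed.

Lemma cprob_measurable E Z : cprob E Z -> measurable_fun setT Z.
Proof. by case=> mZ _ _; exact: mwrt_measurable mZ. Qed.

Lemma cprob_weight E Z W : measurable E -> cprob E Z -> mwrt F W -> (forall w, (0 <= W w)%R) ->
  \int[P]_w (W w * Z w)%:E = \int[P]_(w in E) (W w)%:E.
Proof.
move=> mE cZ mW W0; have mZ := cprob_measurable cZ; case: cZ => FZ Z0 ZE.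
rewrite integral_in_indic//.
rewrite (@eq_integral_mwrt _ _ _ P F Z \1_E W)//.
- by apply: eq_integral => w _; rewrite mulrC.
- by move=> A; rewrite gF => FA; rewrite ZE// integral_indic//; [rewrite setIC|exact: Fm].
Qed.

Lemma cprob_cyl s B : uniq s -> (forall k, measurable (B k)) ->
  forall g : nat * nat -> T -> R, (forall k, k \in s -> cprob (u k.1 k.2 @^-1` B k) (g k)) ->
  cprob (cyl s B) (fun w => \prod_(k <- s) g k w)%R.
Proof.
move=> us mB g gE; split.
- apply: (@measurable_prod _ (g_sigma_algebraType F)) => k ks.
  by have [] := gE k ks.
- by move=> w; rewrite big_seq_cond; apply: prodr_ge0 => k; rewrite andbT => /gE[].
- move=> A FA; rewrite /cyl (ci us mB (g := fun k w => (g k w)%:E))//.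
    by apply: eq_integral => w _; rewrite prodEFin.
  move=> k ks; have [mg g0 gA] := gE k ks; split; last split.
  + move=> C mC; have mg' : measurable_fun [set: g_sigma_algebraType F] (EFin \o g k).
      exact/measurable_EFinP.
    by have := mg' measurableT _ mC; rewrite setTI -[X in X -> _]/(<<s F>> _) gF.
  + by move=> w; rewrite lee_fin.
  + move=> C FC; rewrite gA//.
    rewrite (_ : (fun w => _) = fun w => (\1_(u k.1 k.2 @^-1` B k) w)%:E) //.
    rewrite integral_indic//; [by rewrite setIC|exact: Fm|].
    by rewrite -[X in measurable X]setTI; exact: mu.
Qed.

Lemma mu_pre k B : measurable B -> measurable (u k.1 k.2 @^-1` B).
Proof. by move=> mB; rewrite -[X in measurable X]setTI; exact: mu. Qed.

Lemma cprob_cyl_ex (B : nat * nat -> set R) : (forall k, measurable (B k)) ->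
  exists g, forall k, cprob (u k.1 k.2 @^-1` B k) (g k).
Proof. by move=> mB; have [g gE] := choice (fun k => cprob_ex (mu_pre k (mB k))); exists g. Qed.

Let disj (I J : pred (nat * nat)) := forall k, k \in I -> k \in J -> False.

(** Disjointness of I and J makes the concatenated index list duplicate free, so conditional
    independence factors the probability of the joint cylinder. The two factors are versions of the
    conditional probabilities of E and D, and replacing one by Z does not change the integral. *)
Lemma Fcyl_indep0 I J E D Z : disj I J -> Fcyl I E -> Fcyl J D -> cprob E Z ->
  P (E `&` D) = \int[P]_(w in D) (Z w)%:E.
Proof.
move=> IJ FE FD cZ.
have mE := Fcyl_measurable FE; have mD := Fcyl_measurable FD.
case: FE FD => A [s [B [FA us sI mB EE]]] [A' [s' [B' [FA' us' sI' mB' DE]]]].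
(* One family of sets for the concatenated list; disjointness makes it equal to B' on all of s'. *)
pose C k := if k \in s then B k else B' k.
have mC k : measurable (C k) by rewrite /C; case: ifP.
have [g gE] := cprob_cyl_ex mC.
have uss' : uniq (s ++ s').
  by rewrite cat_uniq us us' andbT/=; apply/hasPn => k ks'; apply/negP => /sI /IJ; apply; exact: sI'.
have Cs : cyl s C = cyl s B.
  by rewrite /cyl; apply: eq_big_seq => k ks; rewrite /C ks.
have Cs' : cyl s' C = cyl s' B'.
  rewrite /cyl; apply: eq_big_seq => k ks; rewrite /C; case: ifPn => // /sI kI.
  by have := IJ _ kI (sI' _ ks).
have [mW W0 WE] := cprob_cyl us mC (fun k _ => gE k).
have [mW' W0' WE'] := cprob_cyl us' mC (fun k _ => gE k).
have [mV V0 VE] := cprob_cyl uss' mC (fun k _ => gE k).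
set W := (fun w => \prod_(k <- s) g k w)%R in mW W0 WE.
set W' := (fun w => \prod_(k <- s') g k w)%R in mW' W0' WE'.
have cE : cprob E (fun w => \1_A w * W w)%R.
  split.
  - apply: (@measurable_funM _ (g_sigma_algebraType F)) => //.
    by apply: mwrt_indic; rewrite gF.
  - by move=> w; apply: mulr_ge0; [rewrite indicE|exact: W0].
  - move=> A0 FA0; rewrite EE setIA -Cs -WE; last exact: FI.
    rewrite integral_mkcond [RHS]integral_mkcond; apply: eq_integral => w _.
    rewrite !patchE in_setI indicE; case: (w \in A0) => //=.
    by case: (w \in A); rewrite ?mul1r ?mul0r.
have cD : cprob D (fun w => \1_A' w * W' w)%R.
  split.
  - apply: (@measurable_funM _ (g_sigma_algebraType F)) => //.
    by apply: mwrt_indic; rewrite gF.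
  - by move=> w; apply: mulr_ge0; [rewrite indicE|exact: W0'].
  - move=> A0 FA0; rewrite DE setIA -Cs' -WE'; last exact: FI.
    rewrite integral_mkcond [RHS]integral_mkcond; apply: eq_integral => w _.
    rewrite !patchE in_setI indicE; case: (w \in A0) => //=.
    by case: (w \in A'); rewrite ?mul1r ?mul0r.
have [mZ Z0 _] := cZ; have [mE' E0' _] := cE; have [mD' D0' _] := cD.
rewrite -(cprob_weight mD cD)//.
under eq_integral do rewrite mulrC.
rewrite (cprob_weight mE cZ)// -(cprob_weight mE cE)//.
have -> : E `&` D = (A `&` A') `&` cyl (s ++ s') C.
  rewrite /cyl big_cat/= -!/(cyl _ _) Cs Cs' EE DE.
  by rewrite setIACA.
rewrite -VE; last exact: FI.
rewrite integral_mkcond; apply: eq_integral => w _.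
rewrite patchE in_setI !indicE big_cat/= -/(W w) -/(W' w).
by do 2 case: (w \in _); rewrite ?mul1r ?mul0r ?mulr0// mulrC.
Qed.

Lemma integral_indic_lt E : measurable E -> \int[P]_w ((\1_E w : R)%:E) < +oo.
Proof.
move=> mE; rewrite integral_indic// setIT.
by apply: le_lt_trans (probability_le1 P mE) _; rewrite ltey.
Qed.

(** The integral of P(E|F) over D equals that of P(D|F) over E. By this symmetry the π-system
    argument runs twice: first D becomes general while E is a generator, then E becomes general. *)
Lemma Fcyl_indep I J E D Z : disj I J -> <<s Fcyl I>> E -> <<s Fcyl J>> D -> cprob E Z ->
  P (E `&` D) = \int[P]_(w in D) (Z w)%:E.
Proof.
move=> IJ gE gD cZ.
have mE : measurable E by apply: sub_gen gE; exact: Fcyl_measurable.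
have mD : measurable D by apply: sub_gen gD; exact: Fcyl_measurable.
have [Y cY] := cprob_ex mD.
have [mZ Z0 _] := cZ; have [mY Y0 _] := cY.
have stepB E' : Fcyl I E' -> P (E' `&` D) = \int[P]_(w in E') (Y w)%:E.
  move=> FE'; have mE' := Fcyl_measurable FE'.
  have [Z' cZ'] := cprob_ex mE'.
  have [mZ' Z0' _] := cZ'.
  rewrite -(cprob_weight mE' cZ')//; under eq_integral do rewrite mulrC.
  rewrite (cprob_weight mD cY)//.
  rewrite -integral_indic//.
  apply: (@integral_unique_pi (Fcyl J)) => //.
  - exact: Fcyl_measurable.
  - exact: FcylT.
  - exact: FcylI.
  - exact: cprob_measurable cZ'.
  - exact: integral_indic_lt.
  - move=> D' FD'; rewrite integral_indic//; last exact: Fcyl_measurable FD'.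
    exact: (Fcyl_indep0 IJ FE' FD' cZ').
rewrite -(cprob_weight mD cY)//; under eq_integral do rewrite mulrC.
rewrite (cprob_weight mE cZ)//.
rewrite setIC -integral_indic//.
apply: (@integral_unique_pi (Fcyl I)) => //.
- exact: Fcyl_measurable.
- exact: FcylT.
- exact: FcylI.
- exact: cprob_measurable cY.
- exact: integral_indic_lt.
- move=> E' FE'; rewrite integral_indic//; last exact: Fcyl_measurable FE'.
  by rewrite setIC; exact: stepB.
Qed.

(* Conditional independence transfers a comparison given F to one given F and the other coordinates. *)
Lemma le_integral_transfer I J f1 f2 W : disj I J ->
  mwrt (Fcyl J) f1 -> mwrt (Fcyl J) f2 ->
  (forall w, (0 <= f1 w)%R) -> (forall w, (0 <= f2 w)%R) ->
  (forall A, F A -> \int[P]_(w in A) (f1 w)%:E <= \int[P]_(w in A) (f2 w)%:E) ->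
  mwrt (Fcyl I) W -> (forall w, (0 <= W w)%R) ->
  \int[P]_w (W w * f1 w)%:E <= \int[P]_w (W w * f2 w)%:E.
Proof.
move=> IJ m1 m2 f10 f20 f12 mW W0.
have m1' := mwrt_measurable (@Fcyl_measurable J) m1.
have m2' := mwrt_measurable (@Fcyl_measurable J) m2.
apply: (le_integral_mwrt (@Fcyl_measurable I)) => // E gE.
have mE : measurable E by apply: sub_gen gE; exact: Fcyl_measurable.
have [Z cZ] := cprob_ex mE; have [mZ Z0 _] := cZ.
(* Against an f that depends on the J coordinates, the indicator of E may be replaced by P(E|F).
   That weight is F-measurable, so a comparison on the sets of F suffices. *)
have H f : mwrt (Fcyl J) f -> (forall w, (0 <= f w)%R) ->
    \int[P]_(w in E) (f w)%:E = \int[P]_w (Z w * f w)%:E.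
  move=> mf f0; rewrite integral_in_indic//.
  under eq_integral do rewrite mulrC.
  rewrite (@eq_integral_mwrt _ _ _ P (Fcyl J) \1_E Z f)//.
  - by apply: eq_integral => w _; rewrite mulrC.
  - exact: Fcyl_measurable.
  - exact: cprob_measurable cZ.
  - move=> D gD; rewrite integral_indic//.
      exact: (Fcyl_indep IJ gE gD cZ).
    by apply: sub_gen gD; exact: Fcyl_measurable.
rewrite !H//; apply: (le_integral_mwrt Fm) => // A; rewrite gF; exact: f12.
Qed.

Lemma eq_integral_transfer I J f1 f2 W : disj I J ->
  mwrt (Fcyl J) f1 -> mwrt (Fcyl J) f2 ->
  (forall w, (0 <= f1 w)%R) -> (forall w, (0 <= f2 w)%R) ->
  (forall A, F A -> \int[P]_(w in A) (f1 w)%:E = \int[P]_(w in A) (f2 w)%:E) ->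
  mwrt (Fcyl I) W -> (forall w, (0 <= W w)%R) ->
  \int[P]_w (W w * f1 w)%:E = \int[P]_w (W w * f2 w)%:E.
Proof.
move=> IJ m1 m2 f10 f20 f12 mW W0; apply/eqP; rewrite eq_le.
by apply/andP; split; apply: (le_integral_transfer IJ) => // A FA; rewrite f12.
Qed.

(** Factors are peeled off one at a time. The product of the others is a weight on coordinates
    disjoint from those of the chosen factor, so the factor may be replaced by its conditional
    bound. *)
Lemma integral_prod_le (L : eqType) (I : L -> pred (nat * nat)) (f : L -> T -> R)
    (b : L -> R) (s : seq L) : uniq s ->
  (forall l l', l != l' -> disj (I l) (I l')) ->
  (forall l, mwrt (Fcyl (I l)) (f l)) -> (forall l w, (0 <= f l w)%R) ->
  (forall l, (0 <= b l)%R) ->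
  (forall l A, F A -> \int[P]_(w in A) (f l w)%:E <= (b l)%:E * P A) ->
  \int[P]_w (\prod_(l <- s) f l w)%:E <= (\prod_(l <- s) b l)%:E.
Proof.
move=> us dI mf f0 b0 fb; elim: s us => [_|l s IH /= /andP[ls us]].
  under eq_integral do rewrite big_nil.
  by rewrite big_nil integral_cst// mul1e; exact: probability_le1.
under eq_integral do rewrite big_cons mulrC.
rewrite big_cons.
pose J : pred (nat * nat) := [pred k | has (fun l' => k \in I l') s].
have dJ : disj J (I l).
  move=> k /hasP[l' l's kl'] kl; apply: (dI l' l _ k) => //.
  by apply: contraNneq ls => <-.
apply: (@le_trans _ _ (\int[P]_w ((\prod_(l <- s) f l w) * b l)%:E)).
  apply: (le_integral_transfer dJ) => //.
  - exact: (@measurable_cst _ _ (g_sigma_algebraType (Fcyl (I l)))).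
  - by move=> A FA; rewrite integral_cst//; [exact: fb|exact: Fm].
  - apply: (@measurable_prod _ (g_sigma_algebraType (Fcyl J))) => l' l's.
    have sub : {subset I l' <= J} by move=> k kl'; apply/hasP; exists l'.
    apply: mwrt_sub (mf l') => E /(FcylS sub); exact: sub_sigma_algebra.
  - by move=> w; apply: prodr_ge0.
under eq_integral do rewrite mulrC EFinM.
rewrite ge0_integralZl_EFin//.
- by rewrite EFinM lee_wpmul2l ?lee_fin// IH.
- by move=> w _; rewrite lee_fin; apply: prodr_ge0.
- apply/measurable_EFinP; apply: measurable_prod => l' _.
  exact: mwrt_measurable (@Fcyl_measurable _) (mf l').
Qed.

End CondIndep.

(** * Tail bounds for sums *)

Section RealBounds.
Variable R : realType.
Implicit Types x z q lam : R.

Lemma expR_le_quadratic x : `|x| <= 1 -> expR x <= 1 + x + 2 * x ^+ 2.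
Proof.
rewrite ler_norml => /andP[x1 x2].
(* Halving keeps 1 - x / 2 positive up to x = 1, so that the bound on [expR (- (x / 2))] can be
   inverted; squaring recovers [expR x]. *)
have h : expR (x / 2) <= 1 + x / 2 + x ^+ 2 / 2.
  have h1 := expR_ge1Dx (- (x / 2)).
  rewrite expRN in h1.
  have e0 := expR_gt0 (x / 2).
  have h2 : (1 - x / 2) * expR (x / 2) <= 1.
    by rewrite mulrC -ler_pdivlMl// mulr1.
  have h3 : 1 <= (1 - x / 2) * (1 + x / 2 + x ^+ 2 / 2) by nra.
  have h4 : (1 - x / 2) * expR (x / 2) <= (1 - x / 2) * (1 + x / 2 + x ^+ 2 / 2) by lra.
  by rewrite ler_pM2l in h4 => //; lra.
have -> : expR x = expR (x / 2) ^+ 2 by rewrite -expRM_natl; congr expR; lra.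
have e0 := expR_gt0 (x / 2).
have : expR (x / 2) ^+ 2 <= (1 + x / 2 + x ^+ 2 / 2) ^+ 2.
  by rewrite ler_pXn2r// nnegrE; [exact: ltW|exact: le_trans (ltW e0) h].
move/le_trans; apply.
have x20 : 0 <= x ^+ 2 by exact: sqr_ge0.
have x21 : x ^+ 2 <= 1 by nra.
nra.
Qed.

Lemma sqr_le_powR q z : 2 <= q -> z ^+ 2 <= 1 + `|z| `^ q.
Proof.
move=> q2; rewrite -real_normK ?num_real//.
have [z1|z1] := leP `|z| 1.
  have := powR_ge0 `|z| q; have := normr_ge0 z; nra.
rewrite -powR_mulrn//; apply: le_trans (_ : `|z| `^ q <= _); last by rewrite lerDr.
by apply: ler_powR; [exact: ltW|].
Qed.

Lemma le_powR_ge1 q z : 1 <= q -> 1 <= z -> z <= z `^ q.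
Proof.
move=> q1 z1; rewrite -[leLHS]powRr1 ?(le_trans ler01)//.
exact: ler_powR.
Qed.

Definition trunc lam z := if lam * `|z| <= 1 then z else 0.
(** An absolute value instead of the signed remainder: sums of excesses are nonnegative, and their
    second moments need no centring. *)
Definition excess lam z := if lam * `|z| <= 1 then 0 else `|z|.

Lemma measurable_trunc lam : measurable_fun setT (trunc lam).
Proof.
apply: measurable_fun_ifT => //.
apply: measurable_fun_ler => //.
by apply: measurable_funM => //; exact: normr_measurable.
Qed.

Lemma measurable_excess lam : measurable_fun setT (excess lam).
Proof.
apply: measurable_fun_ifT => //.
apply: measurable_fun_ler => //.
by apply: measurable_funM => //; exact: normr_measurable.
Qed.

Lemma le_trunc_excess lam z : z <= trunc lam z + excess lam z.
Proof. by rewrite /trunc /excess; case: ifP => _; rewrite ?addr0// add0r ler_norm. Qed.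

Lemma excess_ge0 lam z : 0 <= excess lam z.
Proof. by rewrite /excess; case: ifP. Qed.

(** The negative part of z stands on the left and the positive part on the right, so that every term
    is nonnegative and can be integrated as it is. For a centred variable the two integrals then
    cancel. Beyond the truncation level the linear term is absorbed by (lam |z|)^q. *)
Lemma exp_trunc_le lam q z : 0 < lam -> 2 <= q ->
  expR (lam * trunc lam z) + lam * Num.max (- z) 0 <=
  1 + 2 * lam ^+ 2 + lam * Num.max z 0 + (lam `^ q + 2 * lam ^+ 2) * `|z| `^ q.
Proof.
move=> l0 q2.
have zz : lam * Num.max z 0 = lam * z + lam * Num.max (- z) 0.
  rewrite -mulrDr; congr (_ * _).
  by rewrite /Num.max oppr_lt0; case: (ltgtP z 0) => [h|h|->]; rewrite ?subrr ?addr0 ?oppr0 ?addr0.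
rewrite zz.
have pz := powR_ge0 `|z| q.
have pl := powR_ge0 lam q.
have l2 : 0 <= lam ^+ 2 by exact: sqr_ge0.
rewrite /trunc; case: ifPn => [h|]; last rewrite -ltNge => h.
  have h' : `|lam * z| <= 1 by rewrite normrM gtr0_norm.
  have := expR_le_quadratic h'; have := sqr_le_powR z q2.
  rewrite exprMn => h1 h2.
  have : lam ^+ 2 * z ^+ 2 <= lam ^+ 2 * (1 + `|z| `^ q) by rewrite ler_wpM2l.
  have : 0 <= lam `^ q * `|z| `^ q by rewrite mulr_ge0.
  lra.
rewrite mulr0 expR0.
have q1 : 1 <= q by lra.
have := le_powR_ge1 q1 (ltW h); rewrite (powRM _ (ltW l0))// => h1.
have := ler_norm (- z); rewrite normrN => h2.
have : lam * - z <= lam * `|z| by rewrite ler_wpM2l// ltW.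
have : 0 <= lam ^+ 2 * `|z| `^ q by rewrite mulr_ge0.
lra.
Qed.

(** Where the excess is nonzero, lam |z| > 1, so a positive power of lam |z| may be inserted as a
    factor. *)
Lemma excess_le lam q z : 0 < lam -> 2 <= q -> excess lam z <= lam `^ (q - 1) * `|z| `^ q.
Proof.
move=> l0 q2; rewrite /excess; case: ifPn => [h|]; first by rewrite mulr_ge0 ?powR_ge0.
rewrite -ltNge => h.
have z0 : 0 < `|z| by rewrite -(pmulr_rgt0 _ l0) (lt_trans ltr01).
have -> : `|z| `^ q = `|z| `^ (q - 1) * `|z|.
  rewrite -[X in _ * X]powRr1// -powRD; last by rewrite (gt_eqF z0) implybT.
  by congr powR; lra.
rewrite mulrA -(powRM _ (ltW l0))// ler_peMl//.
by rewrite -[leLHS](powRr0 (lam * `|z|)); apply: ler_powR; [exact: ltW|lra].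
Qed.

Lemma excess_sqr_le lam q z : 0 < lam -> 2 <= q ->
  excess lam z ^+ 2 <= lam `^ (q - 2) * `|z| `^ q.
Proof.
move=> l0 q2; rewrite /excess; case: ifPn => [h|]; first by rewrite expr0n mulr_ge0 ?powR_ge0.
rewrite -ltNge => h.
have z0 : 0 < `|z| by rewrite -(pmulr_rgt0 _ l0) (lt_trans ltr01).
have -> : `|z| `^ q = `|z| `^ (q - 2) * `|z| ^+ 2.
  rewrite -(@powR_mulrn _ `|z|)// -powRD; last by rewrite (gt_eqF z0) implybT.
  by congr powR; lra.
rewrite mulrA -(powRM _ (ltW l0))// ler_peMl ?sqr_ge0//.
by rewrite -[leLHS](powRr0 (lam * `|z|)); apply: ler_powR; [exact: ltW|lra].
Qed.

End RealBounds.

Section RealIntegrals.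
Context d (T : measurableType d) (R : realType) (P : probability T R).
Implicit Types f g : T -> R.
Local Open Scope ereal_scope.

Lemma integral_realD (A : set T) f g : measurable A -> measurable_fun setT f -> measurable_fun setT g ->
  (forall w, 0 <= f w)%R -> (forall w, 0 <= g w)%R ->
  \int[P]_(w in A) (f w + g w)%:E = \int[P]_(w in A) (f w)%:E + \int[P]_(w in A) (g w)%:E.
Proof.
move=> mA mf mg f0 g0; under eq_integral do rewrite EFinD.
by rewrite ge0_integralD//; try (by move=> w _; rewrite lee_fin);
  apply: measurable_funTS; exact/measurable_EFinP.
Qed.

Lemma integral_realZ (A : set T) k f : measurable A -> measurable_fun setT f ->
  (forall w, 0 <= f w)%R -> (0 <= k)%R ->
  \int[P]_(w in A) (k * f w)%:E = k%:E * \int[P]_(w in A) (f w)%:E.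
Proof.
move=> mA mf f0 k0; under eq_integral do rewrite EFinM.
rewrite ge0_integralZl_EFin//; first by move=> w _; rewrite lee_fin.
by apply: measurable_funTS; exact/measurable_EFinP.
Qed.

Lemma le_integral_real (A : set T) f g : measurable A -> measurable_fun setT f -> measurable_fun setT g ->
  (forall w, 0 <= f w)%R -> (forall w, f w <= g w)%R ->
  \int[P]_(w in A) (f w)%:E <= \int[P]_(w in A) (g w)%:E.
Proof.
move=> mA mf mg f0 fg; apply: ge0_le_integral => //.
- by move=> w _; rewrite lee_fin.
- by apply: measurable_funTS; exact/measurable_EFinP.
- by apply: measurable_funTS; exact/measurable_EFinP.
- by move=> w _; rewrite lee_fin.
Qed.

Lemma integral_real_cst (A : set T) (k : R) : measurable A ->
  \int[P]_(w in A) k%:E = k%:E * P A.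
Proof. by move=> mA; rewrite integral_cst. Qed.

End RealIntegrals.

Section Tail.
Context d (T : measurableType d) (R : realType) (P : probability T R).
Variables (F : set (set T)) (u : nat -> nat -> T -> R).
Hypotheses (sF : sigma_algebra setT F) (Fm : F `<=` measurable).
Hypothesis mu : forall i l, measurable_fun setT (u i l).
Hypothesis ci : cond_indep P F u.
Local Open Scope ereal_scope.

Let FT : F setT.
Proof. by case: sF => F0 FC _; rewrite -(setD0 setT); exact: FC. Qed.

Variables (I : nat -> pred (nat * nat)) (zeta : nat -> T -> R) (q M lam : R).
Hypothesis dI : forall l l', l != l' -> forall k, k \in I l -> k \in I l' -> False.
Hypothesis mz : forall l, mwrt (Fcyl F u (I l)) (zeta l).
Hypothesis zmean : forall l A, F A ->
  \int[P]_(w in A) (Num.max (zeta l w) 0)%:E = \int[P]_(w in A) (Num.max (- zeta l w) 0)%:E.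
Hypothesis zmom : forall l A, F A ->
  \int[P]_(w in A) (`|zeta l w| `^ q)%:E <= M%:E * P A.
Hypotheses (q2 : (2 <= q)%R) (M0 : (0 <= M)%R) (l0 : (0 < lam)%R).

Lemma Tail_mz l : measurable_fun setT (zeta l).
Proof. exact: mwrt_measurable (@Fcyl_measurable _ _ _ _ _ Fm mu _) (@mz l). Qed.

Let mcomp (f : R -> R) l : measurable_fun setT f -> mwrt (Fcyl F u (I l)) (f \o zeta l).
Proof. by move=> mf; apply: measurableT_comp => //; exact: mz. Qed.

Let mcomp' (f : R -> R) l : measurable_fun setT f -> measurable_fun setT (fun w => (f (zeta l w))%:E).
Proof. by move=> mf; apply/measurable_EFinP; apply: measurableT_comp => //; exact: Tail_mz. Qed.

Let mpow : measurable_fun setT (fun z : R => `|z| `^ q)%R.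
Proof. by apply: (measurableT_comp (f := fun z : R => z `^ q)%R). Qed.

Let mpos : measurable_fun setT (fun z : R => Num.max z 0)%R.
Proof. exact: (measurable_maxr (f := id) (g := cst 0%R)). Qed.

Let mneg : measurable_fun setT (fun z : R => Num.max (- z) 0)%R.
Proof. by apply: (@measurable_maxr _ _ _ _ (fun z : R => - z)%R (cst 0%R)) => //; exact: measurableT_comp. Qed.

Let c := (2 * lam ^+ 2 + (lam `^ q + 2 * lam ^+ 2) * M)%R.

(** [exp_trunc_le] is integrated over A, the two equal integrals of the parts are cancelled, and 1 +
    c <= e^c is applied. *)
Lemma exp_trunc_moment l A : F A ->
  \int[P]_(w in A) (expR (lam * trunc lam (zeta l w)))%:E <= (expR c)%:E * P A.
Proof.
move=> FA; have mA := Fm FA.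
pose a := \int[P]_(w in A) (expR (lam * trunc lam (zeta l w)))%:E.
pose m := \int[P]_(w in A) (Num.max (- zeta l w) 0)%:E.
pose v := \int[P]_(w in A) (`|zeta l w| `^ q)%:E.
have m0 : 0 <= m by apply: integral_ge0 => w _; rewrite lee_fin le_max lexx orbT.
have v0 : 0 <= v by apply: integral_ge0 => w _; rewrite lee_fin powR_ge0.
have vM : v <= M%:E * P A by exact: zmom.
have Pfin : P A \is a fin_num by exact: fin_num_measure.
have vfin : v \is a fin_num.
  by rewrite ge0_fin_numE//; apply: le_lt_trans vM _; rewrite -(fineK Pfin) -EFinM ltry.
have mf (f : R -> R) : measurable_fun setT f -> measurable_fun setT (f \o zeta l).
  by move=> hf; apply: measurableT_comp => //; exact: Tail_mz.
have mf1 := mf _ mpos; have mf2 := mf _ mneg; have mf3 := mf _ mpow.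
have n0 w : (0 <= Num.max (- zeta l w) 0)%R by rewrite le_max lexx orbT.
have p0 w : (0 <= Num.max (zeta l w) 0)%R by rewrite le_max lexx orbT.
have w0 w : (0 <= `|zeta l w| `^ q)%R by exact: powR_ge0.
(* Cancelling in the extended reals requires finiteness; it follows from the moment of order q. *)
have mfin : m \is a fin_num.
  rewrite ge0_fin_numE//; apply: (@le_lt_trans _ _ (P A + v)); last first.
    by rewrite -(fineK Pfin) -(fineK vfin) -EFinD ltry.
  rewrite -[P A]mul1e -integral_real_cst// -integral_realD//.
  apply: le_integral_real => //; first exact: measurable_funD.
  move=> w; rewrite ge_max; apply/andP; split; last by rewrite addr_ge0.
  have := sqr_le_powR (zeta l w) q2; have := w0 w.
  move: (_ `^ q)%R => p pp h.
  apply: le_trans (ler_norm _) _; rewrite normrN.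
  have : (`|zeta l w| ^+ 2 <= 1 + p)%R by rewrite real_normK ?num_real.
  have := normr_ge0 (zeta l w); nra.
have l00 : (0 <= lam)%R by exact: ltW.
have lq0 : (0 <= lam `^ q + 2 * lam ^+ 2)%R by rewrite addr_ge0 ?powR_ge0// mulr_ge0 ?sqr_ge0.
have c0 : (0 <= 1 + 2 * lam ^+ 2)%R by rewrite addr_ge0// mulr_ge0 ?sqr_ge0.
have mexp : measurable_fun setT (fun w => expR (lam * trunc lam (zeta l w))).
  apply: (mf (fun z => expR (lam * trunc lam z))).
  by apply: measurableT_comp => //; apply: measurable_funM => //; exact: measurable_trunc.
have mm1 := measurable_funM (measurable_cst lam) mf1.
have mm2 := measurable_funM (measurable_cst lam) mf2.
have mm3 := measurable_funM (measurable_cst (lam `^ q + 2 * lam ^+ 2)%R) mf3.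
have main : a + lam%:E * m <= (1 + 2 * lam ^+ 2)%:E * P A + lam%:E * m + (lam `^ q + 2 * lam ^+ 2)%:E * v.
  rewrite {2}/m -zmean// /a /m /v -integral_real_cst//.
  rewrite -!integral_realZ// -!integral_realD//; last first.
  - by move=> w; rewrite mulr_ge0.
  - by move=> w; exact: mulr_ge0.
  - by move=> w; exact: mulr_ge0.
  - by move=> w; rewrite addr_ge0// mulr_ge0.
  - exact: measurable_funD.
  apply: le_integral_real => //.
  - exact: measurable_funD.
  - by apply: measurable_funD => //; exact: measurable_funD.
  - by move=> w; rewrite addr_ge0 ?expR_ge0// mulr_ge0.
  - by move=> w; exact: exp_trunc_le.
have lmfin : lam%:E * m \is a fin_num by rewrite fin_numM.
move: main; rewrite [leRHS]addeAC leeD2rE// => main; apply: le_trans main _.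
apply: (@le_trans _ _ ((1 + c)%:E * P A)).
  rewrite /c addrA; set c1 := (1 + 2 * lam ^+ 2)%R; rewrite [X in _ <= X * _]EFinD [leRHS]muleDl//.
  rewrite leeD2l// EFinM -muleA lee_wpmul2l// lee_fin//.
by rewrite lee_wpmul2r// lee_fin expR_ge1Dx.
Qed.

Lemma markov_ge0 (g : T -> R) (x : R) : measurable_fun setT g -> (forall w, 0 <= g w)%R ->
  (0 <= x)%R -> x%:E * P [set w | (x <= g w)%R] <= \int[P]_w (g w)%:E.
Proof.
move=> mg g0 x0; set E := [set w | _].
have mE : measurable E.
  rewrite (_ : E = g @^-1` `[x, +oo[); last by apply/seteqP; split => w /=; rewrite in_itv/= andbT.
  by rewrite -[X in measurable X]setTI; exact: mg.
rewrite -integral_cst//; apply: (@le_trans _ _ (\int[P]_(w in E) (g w)%:E)).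
  apply: ge0_le_integral => //.
  by apply: measurable_funTS; exact/measurable_EFinP.
apply: ge0_subset_integral => //; first exact/measurable_EFinP.
by move=> w _; rewrite lee_fin.
Qed.

Lemma exp_tail (s : seq nat) (y : R) : uniq s ->
  P [set w | (y <= \sum_(l <- s) trunc lam (zeta l w))%R] <=
  (expR (- (lam * y) + (size s)%:R * c))%:E.
Proof.
move=> us.
have H : \int[P]_w (\prod_(l <- s) expR (lam * trunc lam (zeta l w)))%:E <= (expR ((size s)%:R * c))%:E.
  apply: le_trans (_ : (\prod_(l <- s) expR c)%:E <= _); last first.
    by rewrite big_const_seq count_predT iter_mulr_1 -expRM_natl.
  apply: (integral_prod_le sF Fm mu ci us dI (f := fun l w => expR (lam * trunc lam (zeta l w)))) => //.
  - move=> l; apply: (mcomp (f := fun z => expR (lam * trunc lam z))).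
    apply: measurableT_comp => //; apply: measurable_funM => //; exact: measurable_trunc.
  - exact: exp_trunc_moment.
have mp : measurable_fun setT (fun w => \prod_(l <- s) expR (lam * trunc lam (zeta l w)))%R.
  apply: measurable_prod => l _; apply/measurable_EFinP.
  apply: (mcomp' (f := fun z => expR (lam * trunc lam z))).
  apply: measurableT_comp => //; apply: measurable_funM => //; exact: measurable_trunc.
have := markov_ge0 mp _ (expR_ge0 (lam * y)).
move/(_ _)/le_trans => /(_ _ _ H).
rewrite (_ : [set w | _] = [set w | (y <= \sum_(l <- s) trunc lam (zeta l w))%R]); last first.
  apply/seteqP; split => w /=; rewrite -expR_sum ler_expR -mulr_sumr ler_pM2l//.
rewrite expRD expRN => K.
rewrite EFinM lee_pdivlMl ?expR_gt0//.
apply: K => w; apply: prodr_ge0 => l _; exact: expR_ge0.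
Qed.


Lemma excess_moment l A : F A ->
  \int[P]_(w in A) (excess lam (zeta l w))%:E <= (lam `^ (q - 1) * M)%:E * P A.
Proof.
move=> FA; have mA := Fm FA.
have mE : measurable_fun setT (fun w => excess lam (zeta l w)).
  by apply: (measurableT_comp (f := excess lam)); [exact: measurable_excess|exact: Tail_mz].
have mW : measurable_fun setT (fun w => `|zeta l w| `^ q)%R.
  by apply: (measurableT_comp (f := fun z : R => `|z| `^ q)%R) => //; exact: Tail_mz.
apply: (@le_trans _ _ (\int[P]_(w in A) (lam `^ (q - 1) * `|zeta l w| `^ q)%:E)).
  apply: le_integral_real => //; first exact: measurable_funM.
  - by move=> w; exact: excess_ge0.
  - by move=> w; exact: excess_le.
rewrite integral_realZ ?powR_ge0//.
by rewrite EFinM -muleA lee_wpmul2l ?lee_fin ?powR_ge0// zmom.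
Qed.

Lemma excess_sqr_moment l :
  \int[P]_w (excess lam (zeta l w) ^+ 2)%:E <= (lam `^ (q - 2) * M)%:E.
Proof.
have mE : measurable_fun setT (fun w => excess lam (zeta l w)).
  by apply: (measurableT_comp (f := excess lam)); [exact: measurable_excess|exact: Tail_mz].
have mW : measurable_fun setT (fun w => `|zeta l w| `^ q)%R.
  by apply: (measurableT_comp (f := fun z : R => `|z| `^ q)%R) => //; exact: Tail_mz.
apply: (@le_trans _ _ (\int[P]_w (lam `^ (q - 2) * `|zeta l w| `^ q)%:E)).
  apply: le_integral_real => //; first exact: measurable_funX.
  - exact: measurable_funM.
  - by move=> w; exact: sqr_ge0.
  - by move=> w; exact: excess_sqr_le.
rewrite integral_realZ ?powR_ge0//.
rewrite EFinM lee_wpmul2l ?lee_fin ?powR_ge0//.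
by have := @zmom l setT FT; rewrite probability_setT mule1.
Qed.

Lemma integral_real_sum (L : Type) (s : seq L) (f : L -> T -> R) :
  (forall l, measurable_fun setT (f l)) -> (forall l w, 0 <= f l w)%R ->
  \int[P]_w (\sum_(l <- s) f l w)%:E = \sum_(l <- s) \int[P]_w (f l w)%:E.
Proof.
move=> mf f0; rewrite -ge0_integral_sum//.
- by apply: eq_integral => w _; rewrite sumEFin.
- by move=> l; exact/measurable_EFinP.
- by move=> l w _; rewrite lee_fin.
Qed.

(** Chebyshev's inequality for the uncentred sum. Diagonal terms give the part linear in the number
    of summands; off the diagonal the conditional moments multiply and give the quadratic part. *)
Lemma excess_tail (s : seq nat) (y : R) : uniq s -> (0 < y)%R ->
  P [set w | (y <= \sum_(l <- s) excess lam (zeta l w))%R] <=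
  (((size s)%:R * (lam `^ (q - 2) * M) + (size s)%:R ^+ 2 * (lam `^ (q - 1) * M) ^+ 2) / y ^+ 2)%:E.
Proof.
move=> us y0.
have mE l : measurable_fun setT (fun w => excess lam (zeta l w)).
  by apply: (measurableT_comp (f := excess lam)); [exact: measurable_excess|exact: Tail_mz].
pose S w := (\sum_(l <- s) excess lam (zeta l w))%R.
have S0 w : (0 <= S w)%R by apply: sumr_ge0 => l _; exact: excess_ge0.
have mS : measurable_fun setT S by apply: measurable_sum.
have mS2 : measurable_fun setT (fun w => S w ^+ 2)%R by exact: measurable_funX.
have pos2 : (0 <= y ^+ 2)%R by exact: sqr_ge0.
have := markov_ge0 mS2 (fun w => sqr_ge0 (S w)) pos2.
rewrite (_ : [set w | _] = [set w | (y <= S w)%R]); last first.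
  by apply/seteqP; split => w /=; rewrite ler_pXn2r ?nnegrE// ltW.
move=> K; rewrite mulrC EFinM lee_pdivlMl ?exprn_gt0//; apply: le_trans K _.
have E2 : forall w, (S w ^+ 2 = \sum_(l <- s) \sum_(l' <- s) excess lam (zeta l w) * excess lam (zeta l' w))%R.
  by move=> w; rewrite expr2 /S big_distrlr.
under eq_integral do rewrite E2.
have mEE l l' : measurable_fun setT (fun w => excess lam (zeta l w) * excess lam (zeta l' w))%R.
  exact: measurable_funM.
have EE0 l l' w : (0 <= excess lam (zeta l w) * excess lam (zeta l' w))%R.
  by rewrite mulr_ge0 ?excess_ge0.
rewrite integral_real_sum; last 2 first.
- by move=> l; exact: measurable_sum.
- by move=> l w; exact: sumr_ge0.
under eq_bigr => l _ do rewrite integral_real_sum//.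
pose a := (lam `^ (q - 2) * M)%R; pose b := (lam `^ (q - 1) * M)%R.
have a0 : (0 <= a)%R by rewrite mulr_ge0 ?powR_ge0.
have b0 : (0 <= b)%R by rewrite mulr_ge0 ?powR_ge0.
have bound l l' : \int[P]_w (excess lam (zeta l w) * excess lam (zeta l' w))%:E <=
    ((l' == l)%:R * a + b ^+ 2)%:E.
  have [->|ll'] := eqVneq l' l.
    apply: le_trans (_ : a%:E <= _); last by rewrite lee_fin mul1r lerDl sqr_ge0.
    by under eq_integral do rewrite -expr2; exact: excess_sqr_moment.
  have ul : uniq [:: l; l'] by rewrite /= inE eq_sym ll'.
  have := integral_prod_le sF Fm mu ci (f := fun l w => excess lam (zeta l w)) ul dI.
  move=> /(_ (fun=> b)).
  under eq_integral do rewrite big_cons big_seq1.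
  rewrite big_cons big_seq1 mul0r add0r expr2; apply.
  - move=> k; apply: (mcomp (f := excess lam)); exact: measurable_excess.
  - by move=> k w; exact: excess_ge0.
  - by [].
  - by move=> k A FA; exact: excess_moment.
apply: (@le_trans _ _ (\sum_(l <- s) \sum_(l' <- s) ((l' == l)%:R * a + b ^+ 2)%:E)).
  by apply: lee_sum => l _; apply: lee_sum => l' _.
under eq_bigr do rewrite sumEFin.
rewrite sumEFin lee_fin.
under eq_bigr do rewrite big_split/= big_const_seq count_predT iter_addr_0.
rewrite big_split/= big_const_seq count_predT iter_addr_0.
rewrite -/a -/b; apply: lerD; last first.
  by rewrite -[X in (X <= _)%R]mulr_natl -[(b ^+ 2 *+ _)%R]mulr_natl mulrA -expr2.
rewrite [leLHS](_ : _ = \sum_(l <- s) a)%R; last first.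
  apply: eq_big_seq => l ls; rewrite -mulr_suml.
  rewrite -natr_sum (_ : (\sum_(i <- s) (i == l))%N = 1%N) ?mul1r//.
  transitivity (\sum_(i <- s | i == l) 1)%N; last by rewrite sum1_count count_uniq_mem ?ls.
  by rewrite [RHS]big_mkcond/=; apply: eq_bigr => i _; case: eqP.
by rewrite big_const_seq count_predT iter_addr_0 mulr_natl.
Qed.

Lemma sum_tail (s : seq nat) (y : R) : uniq s -> (0 < y)%R ->
  P [set w | (2 * y <= \sum_(l <- s) zeta l w)%R] <=
  (expR (- (lam * y) + (size s)%:R * c) +
   ((size s)%:R * (lam `^ (q - 2) * M) + (size s)%:R ^+ 2 * (lam `^ (q - 1) * M) ^+ 2) / y ^+ 2)%:E.
Proof.
move=> us y0.
have mE l : measurable_fun setT (fun w => excess lam (zeta l w)).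
  by apply: (measurableT_comp (f := excess lam)); [exact: measurable_excess|exact: Tail_mz].
have mTr l : measurable_fun setT (fun w => trunc lam (zeta l w)).
  by apply: (measurableT_comp (f := trunc lam)); [exact: measurable_trunc|exact: Tail_mz].
have mge (g : T -> R) (x : R) : measurable_fun setT g -> measurable [set w | (x <= g w)%R].
  move=> mg; rewrite (_ : [set w | _] = g @^-1` `[x, +oo[).
    by rewrite -[X in measurable X]setTI; exact: mg.
  by apply/seteqP; split => w /=; rewrite in_itv/= andbT.
apply: (@le_trans _ _ (P ([set w | (y <= \sum_(l <- s) trunc lam (zeta l w))%R] `|`
   [set w | (y <= \sum_(l <- s) excess lam (zeta l w))%R]))).
  apply: le_measure; rewrite ?inE.
  - by apply: mge; apply: measurable_sum => l; exact: Tail_mz.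
  - by apply: measurableU; apply: mge; exact: measurable_sum.
  - move=> w /= h; apply/orP; rewrite -implyNb; apply/implyP; rewrite -ltNge => h'.
    have : (\sum_(l <- s) zeta l w <= \sum_(l <- s) trunc lam (zeta l w) + \sum_(l <- s) excess lam (zeta l w))%R.
      by rewrite -big_split/=; apply: ler_sum => l _; exact: le_trunc_excess.
    by move: h h'; set A := (\sum_(l <- s) zeta l w)%R; set B := (\sum_(l <- s) trunc _ _)%R; set C := (\sum_(l <- s) excess _ _)%R; lra.
apply: le_trans (measureU2 _ _ _) _.
- by apply: mge; exact: measurable_sum.
- by apply: mge; exact: measurable_sum.
rewrite EFinD; apply: leeD; [exact: exp_tail|exact: excess_tail].
Qed.

End Tail.

(** This lets the centring of one factor pass to a product while only nonnegative functions are
    integrated. *)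
Lemma max_mul (R : realType) (x y : R) :
  Num.max (x * y) 0 = Num.max x 0 * Num.max y 0 + Num.max (- x) 0 * Num.max (- y) 0.
Proof.
have [x0|x0] := leP 0 x; have [y0|y0] := leP 0 y.
- by rewrite [Num.max (- x) 0]max_r ?oppr_le0// mul0r addr0 max_l ?mulr_ge0.
- by rewrite mulr0 add0r [Num.max (- x) 0]max_r ?oppr_le0// mul0r max_r// nmulr_lle0.
- by rewrite mul0r add0r [Num.max (- y) 0]max_r ?oppr_le0// mulr0 max_r// nmulr_rle0.
- rewrite mul0r add0r [Num.max (- x) 0]max_l ?oppr_ge0 ?ltW// [Num.max (- y) 0]max_l ?oppr_ge0 ?ltW//.
  by rewrite mulrNN max_l// mulr_le0 ?ltW.
Qed.

(** * Products of a noise entry with a variable built on other coordinates *)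

Section PairTail.
Context d (T : measurableType d) (R : realType) (P : probability T R).
Variables (F : set (set T)) (u : nat -> nat -> T -> R).
Hypotheses (sF : sigma_algebra setT F) (Fm : F `<=` measurable).
Hypothesis mu : forall i l, measurable_fun setT (u i l).
Hypothesis ci : cond_indep P F u.
Variables (G : set T) (q K : R).
Hypotheses (FG : F G) (q2 : 2 <= q) (K0 : 0 <= K).
Hypothesis umean : forall i l, cond_mean_zero P F (u i l).
Hypothesis umom : forall i l A, F A ->
  (\int[P]_(w in A `&` G) (`|u i l w| `^ q)%:E <= K%:E * P A)%E.
Local Open Scope ereal_scope.

(** For G in F the restriction preserves centring and turns an almost sure moment bound into a bound
    with one constant. *)
Definition restr_noise k w := (u k.1 k.2 w * \1_G w)%R.
Local Notation U := restr_noise.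

Let FI A B : F A -> F B -> F (A `&` B).
Proof.
have gF : <<s F>> = F by exact: sigma_algebra_id.
by rewrite -gF; apply: (@measurableI _ (g_sigma_algebraType F)).
Qed.

Let mG : measurable G. Proof. exact: Fm. Qed.

Lemma mwrt_F_Fcyl J (X : T -> R) : mwrt F X -> mwrt (Fcyl F u J) X.
Proof. by apply: mwrt_sub => A FA; apply: sub_sigma_algebra; apply: sub_Fcyl. Qed.

Lemma mwrt_restr_noise J k : k \in J -> mwrt (Fcyl F u J) (U k).
Proof.
move=> kJ; apply: (@measurable_funM _ (g_sigma_algebraType (Fcyl F u J))).
  exact: mwrt_Fcyl.
by apply: mwrt_F_Fcyl; apply: mwrt_indic; apply: sub_sigma_algebra.
Qed.

Lemma integral_setI_indic A (f : T -> R) :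
  \int[P]_(w in A) (f w * \1_G w)%:E = \int[P]_(w in A `&` G) (f w)%:E.
Proof.
rewrite integral_mkcond [RHS]integral_mkcond; apply: eq_integral => w _.
rewrite !patchE in_setI indicE; case: (w \in A) => //=.
by case: (w \in G); rewrite ?mulr1 ?mulr0.
Qed.

Lemma restr_noise_mean k A : F A ->
  \int[P]_(w in A) (Num.max (U k w) 0)%:E = \int[P]_(w in A) (Num.max (- U k w) 0)%:E.
Proof.
move=> FA; have [g [[_ [_ gp]] [[_ [_ gn]] _]]] := umean k.1 k.2.
have FAG : F (A `&` G) by exact: FI.
transitivity (\int[P]_(w in A) (Num.max (u k.1 k.2 w) 0 * \1_G w)%:E).
  apply: eq_integral => w _; rewrite /U indicE; case: (w \in G); rewrite ?mulr1 ?mulr0//.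
  by rewrite maxxx.
transitivity (\int[P]_(w in A) (Num.max (- u k.1 k.2 w) 0 * \1_G w)%:E); last first.
  apply: eq_integral => w _; rewrite /U indicE; case: (w \in G); rewrite ?mulr1 ?mulr0//.
  by rewrite oppr0 maxxx.
by rewrite !integral_setI_indic -gp// -gn.
Qed.

Lemma restr_noise_moment k A : F A ->
  \int[P]_(w in A) (`|U k w| `^ q)%:E <= K%:E * P A.
Proof.
move=> FA; rewrite (eq_integral (fun w => (`|u k.1 k.2 w| `^ q * \1_G w)%:E)); last first.
  move=> w _; rewrite /U indicE; case: (w \in G); rewrite ?mulr1 ?mulr0// normr0 powR0//.
  by rewrite gt_eqF// (lt_le_trans _ q2).
by rewrite integral_setI_indic; exact: umom.
Qed.

Let mpow : measurable_fun setT (fun z : R => `|z| `^ q)%R.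
Proof. by apply: (measurableT_comp (f := fun z : R => z `^ q)%R). Qed.

Let mpos : measurable_fun setT (fun z : R => Num.max z 0)%R.
Proof. exact: (measurable_maxr (f := id) (g := cst 0%R)). Qed.

Let mneg : measurable_fun setT (fun z : R => Num.max (- z) 0)%R.
Proof. by apply: (@measurable_maxr _ _ _ _ (fun z : R => - z)%R (cst 0%R)) => //; exact: measurableT_comp. Qed.

Let mw (X : T -> R) J (f : R -> R) : measurable_fun setT f -> mwrt (Fcyl F u J) X -> mwrt (Fcyl F u J) (f \o X).
Proof. by move=> mf mX; exact: measurableT_comp. Qed.

Let mwT J (X : T -> R) : mwrt (Fcyl F u J) X -> measurable_fun setT X.
Proof. exact: mwrt_measurable (@Fcyl_measurable _ _ _ _ _ Fm mu _). Qed.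

Variables (k : nat) (J : pred (nat * nat)) (l : nat) (X : T -> R) (C : R).
Hypotheses (mX : mwrt (Fcyl F u J) X) (klJ : (k, l) \notin J).
Hypothesis C0 : (0 <= C)%R.
Hypothesis Xmom : forall A, F A -> \int[P]_(w in A) (`|X w| `^ q)%:E <= C%:E * P A.

Let kl : pred (nat * nat) := pred1 (k, l).

Let dJ : forall k', k' \in J -> k' \in kl -> False.
Proof. by move=> k' kJ /eqP kE; move: klJ; rewrite -kE kJ. Qed.

Let mwU : mwrt (Fcyl F u kl) (U (k, l)).
Proof. by apply: mwrt_restr_noise; rewrite inE. Qed.

(** By [max_mul] the parts of X * U are sums of products of parts. X depends on coordinates other
    than (k, l), so in each product the positive part of U may be exchanged for the negative one. *)
Lemma prod_noise_mean A : F A ->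
  \int[P]_(w in A) (Num.max (X w * U (k, l) w) 0)%:E =
  \int[P]_(w in A) (Num.max (- (X w * U (k, l) w)) 0)%:E.
Proof.
move=> FA; have mA := Fm FA.
have n0 (x : R) : (0 <= Num.max x 0)%R by rewrite le_max lexx orbT.
have mXp := mw mpos mX; have mXn := mw mneg mX.
have mUp := mw mpos mwU; have mUn := mw mneg mwU.
have mA1 : mwrt (Fcyl F u J) (\1_A : T -> R).
  by apply: mwrt_F_Fcyl; apply: mwrt_indic; exact: sub_sigma_algebra.
have tr (W : T -> R) : mwrt (Fcyl F u J) W -> (forall w, 0 <= W w)%R ->
  \int[P]_(w in A) (W w * Num.max (U (k, l) w) 0)%:E =
  \int[P]_(w in A) (W w * Num.max (- U (k, l) w) 0)%:E.
  move=> mW W0; rewrite [LHS](integral_in_indic _ _ mA) [RHS](integral_in_indic _ _ mA).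
  under eq_integral do rewrite mulrA.
  under [RHS]eq_integral do rewrite mulrA.
  apply: (eq_integral_transfer sF Fm mu ci (W := fun w => \1_A w * W w)%R dJ mUp mUn) => //.
  - by move=> w; exact: n0.
  - by move=> w; exact: n0.
  - by move=> B FB; exact: restr_noise_mean.
  - exact: (@measurable_funM _ (g_sigma_algebraType (Fcyl F u J))).
  - by move=> w; rewrite mulr_ge0.
have Ep := @max_mul R.
have mUpT := mwT mUp; have mUnT := mwT mUn; have mXpT := mwT mXp; have mXnT := mwT mXn.
under eq_integral do rewrite Ep.
under [RHS]eq_integral do rewrite -mulrN Ep opprK.
rewrite !integral_realD//; try (by move=> w; rewrite mulr_ge0 ?n0); try exact: measurable_funM.
congr (_ + _); first by rewrite tr.
by rewrite tr.
Qed.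

Lemma prod_noise_moment A : F A ->
  \int[P]_(w in A) (`|X w * U (k, l) w| `^ q)%:E <= (K * C)%:E * P A.
Proof.
move=> FA; have mA := Fm FA.
have mA1 : mwrt (Fcyl F u J) (\1_A : T -> R).
  by apply: mwrt_F_Fcyl; apply: mwrt_indic; exact: sub_sigma_algebra.
have mXp := mw mpow mX; have mUp := mw mpow mwU.
have mXpT := mwT mXp; have mUpT := mwT mUp.
under eq_integral do rewrite normrM powRM//.
apply: (@le_trans _ _ (\int[P]_(w in A) (`|X w| `^ q * K)%:E)).
  rewrite [leLHS](integral_in_indic _ _ mA) [leRHS](integral_in_indic _ _ mA).
  under eq_integral do rewrite mulrA.
  under [leRHS]eq_integral do rewrite mulrA.
  apply: (@le_integral_transfer _ _ _ P _ _ sF Fm mu ci J kl _ (fun=> K) (fun w => \1_A w * `|X w| `^ q)%R dJ mUp) => //.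
  - exact: (@measurable_cst _ _ (g_sigma_algebraType (Fcyl F u kl))).
  - by move=> w; exact: powR_ge0.
  - by move=> B FB; rewrite integral_real_cst; [exact: restr_noise_moment|exact: Fm].
  - exact: (@measurable_funM _ (g_sigma_algebraType (Fcyl F u J))).
under eq_integral do rewrite mulrC.
rewrite integral_realZ//.
by rewrite EFinM -muleA lee_wpmul2l// Xmom.
Qed.

End PairTail.

Section PairTail2.
Context d (T : measurableType d) (R : realType) (P : probability T R).
Variables (F : set (set T)) (u : nat -> nat -> T -> R).
Hypotheses (sF : sigma_algebra setT F) (Fm : F `<=` measurable).
Hypothesis mu : forall i l, measurable_fun setT (u i l).
Hypothesis ci : cond_indep P F u.
Variables (G : set T) (q K : R).
Hypotheses (FG : F G) (q2 : 2 <= q) (K0 : 0 <= K).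
Hypothesis umean : forall i l, cond_mean_zero P F (u i l).
Hypothesis umom : forall i l A, F A ->
  (\int[P]_(w in A `&` G) (`|u i l w| `^ q)%:E <= K%:E * P A)%E.
Local Open Scope ereal_scope.
Local Notation U := (restr_noise u G).

(** The bound of [sum_tail] for L summands with conditional moment constant M: a Chernoff term for
    the truncated sum and a Chebyshev term for the excess. *)
Definition tail_bound (M lam y L : R) : R :=
  (expR (- (lam * y) + L * (2 * lam ^+ 2 + (lam `^ q + 2 * lam ^+ 2) * M)) +
   (L * (lam `^ (q - 2) * M) + L ^+ 2 * (lam `^ (q - 1) * M) ^+ 2) / y ^+ 2)%R.

Variables (k : nat) (J : nat -> pred (nat * nat)) (X : nat -> T -> R) (C lam : R).
Hypotheses (mX : forall l, mwrt (Fcyl F u (J l)) (X l)).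
Hypothesis dJ : forall l l', l != l' -> forall k', k' \in J l -> k' \in J l' -> False.
Hypothesis kJ : forall l l', (k, l') \notin J l.
Hypotheses (C0 : (0 <= C)%R) (l0 : (0 < lam)%R).
Hypothesis Xmom : forall l A, F A -> \int[P]_(w in A) (`|X l w| `^ q)%:E <= C%:E * P A.

Let I l : pred (nat * nat) := predU (J l) (pred1 (k, l)).

(** Made for two cases: X l a noise entry of another column, with J l its single index, and X l a
    latent value, with J l empty. The factor 2 pays for both signs of the sum. *)
Lemma pair_tail (s : seq nat) (y : R) : uniq s -> (0 < y)%R ->
  P [set w | (2 * y <= `|\sum_(l <- s) X l w * U (k, l) w|)%R] <=
  (2 * tail_bound (K * C) lam y (size s)%:R)%:E.
Proof.
move=> us y0.
have dI l l' : l != l' -> forall k', k' \in I l -> k' \in I l' -> False.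
  move=> ll' [a b] /orP[h1|/eqP[h1 h1']] /orP[h2|/eqP[h2 h2']].
  - exact: (dJ ll' h1 h2).
  - by move: h1; rewrite h2 => h1; have /negP := kJ l b; apply.
  - by move: h2; rewrite h1 => h2; have /negP := kJ l' b; apply.
  - by move: ll'; rewrite -h1' -h2' eqxx.
have sub l : Fcyl F u (J l) `<=` <<s Fcyl F u (I l)>>.
  apply: subset_trans (@sub_sigma_algebra _ setT _).
  by apply: FcylS => k' k'J; apply/orP; left.
have mU l : mwrt (Fcyl F u (I l)) (U (k, l)).
  by apply: mwrt_restr_noise => //; apply/orP; right; rewrite inE.
have mz l : mwrt (Fcyl F u (I l)) (fun w => X l w * U (k, l) w)%R.
  apply: (@measurable_funM _ (g_sigma_algebraType (Fcyl F u (I l)))) => //.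
    exact: mwrt_sub (@sub l) (@mX l).
  exact: mU.
have mzN l : mwrt (Fcyl F u (I l)) (fun w => - (X l w * U (k, l) w))%R.
  have h := @mz l; have mo : measurable_fun [set: R] (fun z : R => - z)%R by exact: measurableT_comp.
  exact: measurableT_comp mo h.
have KC0 : (0 <= K * C)%R by exact: mulr_ge0.
have mean l A : F A -> _ := @prod_noise_mean _ _ _ P _ _ sF Fm mu ci G FG umean k (J l) l (X l) (@mX l) (kJ l l) A.
have mom l A : F A -> _ := @prod_noise_moment _ _ _ P _ _ sF Fm mu ci G q K FG q2 K0 umom k (J l) l (X l) C (@mX l) (kJ l l) (@Xmom l) A.
have mzT l : measurable_fun setT (fun w => X l w * U (k, l) w)%R.
  by have h := @mz l; exact: mwrt_measurable (@Fcyl_measurable _ _ _ _ _ Fm mu _) h.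
have mge (g : T -> R) (x : R) : measurable_fun setT g -> measurable [set w | (x <= g w)%R].
  move=> mg; rewrite (_ : [set w | _] = g @^-1` `[x, +oo[).
    by rewrite -[X in measurable X]setTI; exact: mg.
  by apply/seteqP; split => w /=; rewrite in_itv/= andbT.
have H1 := sum_tail sF Fm mu ci dI mz mean mom q2 KC0 l0 us y0.
have H2 : P [set w | (2 * y <= \sum_(l <- s) - (X l w * U (k, l) w))%R] <= (tail_bound (K * C) lam y (size s)%:R)%:E.
  apply: (sum_tail sF Fm mu ci dI mzN _ _ q2 KC0 l0 us y0).
  - by move=> l A FA; under [RHS]eq_integral do rewrite opprK; rewrite mean.
  - by move=> l A FA; under eq_integral do rewrite normrN; exact: mom.
rewrite [X in X%:E]mulr_natl mulr2n EFinD.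
apply: le_trans (leeD H1 H2).
apply: le_trans (measureU2 _ _ _); last 2 first.
- by apply: mge; exact: measurable_sum.
- by apply: mge; apply: measurable_sum => l; exact: measurableT_comp.
apply: le_measure; rewrite ?inE.
- by apply: mge; apply: measurableT_comp => //; exact: measurable_sum.
- apply: measurableU; apply: mge; first exact: measurable_sum.
  by apply: measurable_sum => l; exact: measurableT_comp.
- by move=> w /=; rewrite ler_normr sumrN => /orP.
Qed.

End PairTail2.

(** * Random functions at random points *)

Section Caratheodory.
Context d (T : measurableType d) (R : realType) (r : nat).

Definition grid_point (m : nat) (z : 'rV[int]_r) : 'rV[R]_r :=
  \row_k ((z 0 k)%:~R / m.+1%:R).

Definition grid_floor (m : nat) (x : 'rV[R]_r) : 'rV[int]_r :=
  \row_k Num.floor (m.+1%:R * x 0 k).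

Lemma grid_floor_cvg (x : 'rV[R]_r) : grid_point m (grid_floor m x) @[m --> \oo] --> x.
Proof.
apply/cvg_ballP => eps eps0; near=> m; split => // i k; rewrite ord1 !mxE /ball/=.
have m0 : 0 < m.+1%:R :> R by [].
have /andP[h1 h2] := floor_itv (m.+1%:R * x 0 k).
have -> : x 0 k - (Num.floor (m.+1%:R * x 0 k))%:~R / m.+1%:R =
    (m.+1%:R * x 0 k - (Num.floor (m.+1%:R * x 0 k))%:~R) / m.+1%:R.
  by rewrite mulrBl mulrAC divff ?mul1r// gt_eqF.
rewrite ger0_norm; last by rewrite divr_ge0// subr_ge0.
apply: le_lt_trans (_ : m.+1%:R^-1 < _).
  by rewrite ler_pdivrMr// mulVf ?gt_eqF// lerBlDr addrC ltW// -intrD1.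
near: m; exact: (near_infty_natSinv_lt (PosNum eps0)).
Unshelve. all: by end_near. Qed.

(* Approximating the argument on ever finer grids makes a continuous random function at a random point a limit of measurable functions. *)
Lemma measurable_eval (e : T -> 'rV[R]_r -> R) (a : T -> 'rV[R]_r) :
  (forall x, measurable_fun setT (e ^~ x)) -> (forall w, continuous (e w)) ->
  (forall k, measurable_fun setT (fun w => a w 0 k)) ->
  measurable_fun setT (fun w => e w (a w)).
Proof.
move=> me ce ma.
apply: (@measurable_fun_cvg _ _ _ _ (fun m w => e w (grid_point m (grid_floor m (a w))))); last first.
  move=> w _; apply: (@cvg_comp _ _ _ (fun m => grid_point m (grid_floor m (a w))) (e w) _ (nbhs (a w))).
    exact: grid_floor_cvg.
  exact: ce.
move=> m _ B mB; rewrite setTI.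
rewrite (_ : _ @^-1` B = \bigcup_(z : 'rV[int]_r)
   ([set w | forall k, Num.floor (m.+1%:R * a w 0 k) = z 0 k] `&` (e ^~ (grid_point m z) @^-1` B))); last first.
  apply/seteqP; split => w /=.
    by move=> h; exists (grid_floor m (a w)) => //; split => // k; rewrite mxE.
  move=> [z _ [hz /=]]; suff -> : grid_floor m (a w) = z by [].
  by apply/rowP => k; rewrite mxE hz.
apply: countable_bigcupT_measurable => // z.
apply: measurableI; last by rewrite -[X in measurable X]setTI; exact: me.
rewrite (_ : [set w | _] = \bigcap_(k in [set: 'I_r]) ((fun w => a w 0 k) @^-1`
    [set x | (z 0 k)%:~R <= m.+1%:R * x < (z 0 k + 1)%:~R])); last first.
  apply/seteqP; split => w /= h k.
    by move=> _ /=; rewrite -(h k); exact: floor_itv.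
  by apply: floor_def; exact: h.
apply: fin_bigcap_measurable => // k _.
rewrite -[X in measurable X]setTI; apply: ma => //.
rewrite (_ : [set x | _] = (fun x : R => m.+1%:R * x) @^-1` `[(z 0 k)%:~R, (z 0 k + 1)%:~R[ ); last first.
  by apply/seteqP; split => x /=; rewrite in_itv.
rewrite -[X in measurable X]setTI.
by apply: measurable_funM.
Qed.

Lemma measurable_derive (e : T -> 'rV[R]_r -> R) (v x : 'rV[R]_r) :
  (forall x, measurable_fun setT (e ^~ x)) -> (forall w, derivable (e w) x v) ->
  measurable_fun setT (fun w => 'D_v (e w) x).
Proof.
move=> me de.
apply: (@measurable_fun_cvg _ _ _ _ (fun m w => m.+1%:R * (e w (m.+1%:R^-1 *: v + x) - e w x))); last first.
  move=> w _; have := de w; rewrite /derivable => /cvg_ex[l hl].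
  have -> : 'D_v (e w) x = l by exact: cvg_lim hl.
  have h0 : (m.+1%:R^-1 : R) @[m --> \oo] --> (0 : R).
    by apply/cvgrPdist_lt => eps eps0; near=> m; rewrite sub0r normrN gtr0_norm ?invr_gt0//;
      near: m; exact: (near_infty_natSinv_lt (PosNum eps0)).
  have := (cvgr_dnbhsP _ _ _).1 hl (fun m => m.+1%:R^-1) (conj _ h0).
  move=> /(_ (fun m => _)) H; apply: cvg_trans (H _).
    apply: near_eq_cvg; apply: nearW => m /=; by rewrite invrK.
  by move=> m; rewrite gt_eqF// invr_gt0.
move=> m; apply: measurable_funM => //; apply: measurable_funB => //; exact: me.
Unshelve. all: by end_near. Qed.

End Caratheodory.

(** * Taylor expansion *)

Section Taylor.
Variables (R : realType) (r : nat).
Implicit Types (f : 'rV[R]_r -> R) (x a b e : 'rV[R]_r).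

Definition l1dist a b : R := \sum_(k < r) `|b 0 k - a 0 k|.

Lemma line_is_derive f x e (t : R) : derivable f (x + t *: e) e ->
  is_derive t (1 : R) (fun s : R => f (x + s *: e)) ('D_e f (x + t *: e)).
Proof.
move=> df.
have E : (fun h : R => h^-1 *: (f (x + (h *: 1 + t) *: e) - f (x + t *: e))) =
         (fun h : R => h^-1 *: (f (h *: e + (x + t *: e)) - f (x + t *: e))).
  by apply/funext => h; rewrite scalerDl addrCA [h *: 1]mulr1.
split; first by rewrite /derivable/= E.
by rewrite /derive /= E.
Qed.

Lemma line_mvt f x e (s : R) : (forall y, derivable f y e) ->
  exists2 th : R, `|th| <= `|s| & f (x + s *: e) - f x = s * 'D_e f (x + th *: e).
Proof.
move=> df; pose g (t : R) := f (x + t *: e).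
have dg t : is_derive t (1 : R) g ('D_e f (x + t *: e)) by apply: line_is_derive.
have cg (A : set R) : {within A, continuous g}.
  apply: continuous_subspaceT => t.
  by apply: differentiable_continuous; apply/derivable1_diffP; case: (dg t).
have g0 : g 0 = f x by rewrite /g scale0r addr0.
have [s0|s0|->] := ltgtP s 0; last first.
- by exists 0; rewrite ?normr0// scale0r addr0 subrr mul0r.
- have [c /itvP cs] := MVT s0 (fun t _ => dg t) (cg _).
  rewrite g0 subr0 => ->; exists c; last by rewrite mulrC.
  by rewrite !ger0_norm ?cs// ltW.
- have [c /itvP cs] := MVT s0 (fun t _ => dg t) (cg _).
  rewrite g0 sub0r => h; exists c; last first.
    by rewrite -[LHS]opprB h mulrN opprK mulrC.
  have c0 : c <= 0 by rewrite cs.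
  have sc : s <= c by rewrite cs.
  by rewrite !ler0_norm ?lerN2// ltW.
Qed.

(** The path from a to b that changes one coordinate at a time. *)
Let pt a b (j : nat) : 'rV[R]_r := \row_k (if (k < j)%N then b 0 k else a 0 k).

(** Only partial derivatives are given, so the mean value theorem is used along segments parallel to
    the axes. This is also why l1 distances appear in the estimates. *)
Lemma telescoped_mvt f a b : (forall y k, derivable f y (unitvec k)) ->
  exists2 xi : 'I_r -> 'rV[R]_r, (forall j k, `|xi j 0 k - a 0 k| <= `|b 0 k - a 0 k|) &
    f b - f a = \sum_(j < r) (b 0 j - a 0 j) * 'D_(unitvec j) f (xi j).
Proof.
move=> df.
have step (j : 'I_r) : exists y : 'rV[R]_r, (forall k, `|y 0 k - a 0 k| <= `|b 0 k - a 0 k|) /\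
    f (pt a b j.+1) - f (pt a b j) = (b 0 j - a 0 j) * 'D_(unitvec j) f y.
  have [th th1 thE] := line_mvt (pt a b j) (b 0 j - a 0 j) (fun y => df y j).
  exists (pt a b j + th *: unitvec j); split.
    move=> k; rewrite !mxE; case: (eqVneq k j) => [->|kj].
      by rewrite ltnn mulr1 addrAC subrr add0r.
    by rewrite mulr0 addr0; case: ifP => _ //; rewrite subrr normr0.
  rewrite -thE; congr (f _ - _); apply/rowP => k; rewrite !mxE ltnS.
  case: (eqVneq k j) => [->|kj]; first by rewrite leqnn ltnn mulr1 addrCA subrr addr0.
  by rewrite mulr0 addr0 leq_eqVlt (negbTE (_ : (k != j :> nat))).
have [xi hxi] := choice step.
exists xi; first by move=> j; case: (hxi j).
have -> : f b - f a = f (pt a b r) - f (pt a b 0).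
  by congr (f _ - f _); apply/rowP => k; rewrite mxE ?ltn_ord.
rewrite -(telescope_sumr (fun j => f (pt a b j)) (leq0n r)) big_mkord.
by apply: eq_bigr => j _; case: (hxi j).
Qed.

Lemma l1dist_ge0 a b : 0 <= l1dist a b.
Proof. exact: sumr_ge0. Qed.

Lemma lipschitz_partial f (C : R) a b : (forall y k, derivable f y (unitvec k)) ->
  (forall y k, `|'D_(unitvec k) f y| <= C) -> `|f b - f a| <= C * l1dist a b.
Proof.
move=> df fC; have [xi _ ->] := telescoped_mvt a b df.
apply: le_trans (ler_norm_sum _ _ _) _.
rewrite mulr_sumr; apply: ler_sum => k _.
by rewrite normrM mulrC ler_wpM2r.
Qed.

Lemma taylor2 f (C : R) a b : 0 <= C -> (forall y k, derivable f y (unitvec k)) ->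
  (forall k y k', derivable ('D_(unitvec k) f) y (unitvec k')) ->
  (forall k y k', `|'D_(unitvec k') ('D_(unitvec k) f) y| <= C) ->
  `|f b - f a - \sum_(k < r) (b 0 k - a 0 k) * 'D_(unitvec k) f a| <= C * l1dist a b ^+ 2.
Proof.
move=> C0 df ddf fC; have [xi hxi ->] := telescoped_mvt a b df.
rewrite -sumrB; apply: le_trans (ler_norm_sum _ _ _) _.
have -> : C * l1dist a b ^+ 2 = \sum_(k < r) `|b 0 k - a 0 k| * (C * l1dist a b).
  by rewrite -mulr_suml -/(l1dist a b); ring.
apply: ler_sum => k _; rewrite -mulrBr normrM ler_wpM2l//.
apply: le_trans (lipschitz_partial _ _ (ddf k) (fC k)) _.
by rewrite ler_wpM2l//; apply: ler_sum => k' _.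
Qed.

End Taylor.

(** * Iterated integrals and convex bodies *)

Section IteratedIntegral.
Variable R : realType.
Local Open Scope ereal_scope.
Local Notation leb := (@lebesgue_measure R).

Import HBNNSimple.

(** The density is not assumed measurable and neither are its partial integrals; the bound comes
    straight from the integral as a supremum over simple functions. *)
Lemma ge0_integral_ge_cst (d : measure_display) (T : measurableType d)
    (leb : {measure set T -> \bar R}) (g : T -> \bar R) (A : set T) (c : R) :
  measurable A -> (0 <= c)%R -> (forall x, 0 <= g x) -> (forall x, A x -> c%:E <= g x) ->
  c%:E * leb A <= \int[leb]_x g x.
Proof.
move=> mA c0 g0 cg.
rewrite ge0_integralTE//.
pose h := scale_nnsfun (indic_nnsfun R mA) c0.
have -> : c%:E * leb A = sintegral leb h.
  by rewrite [RHS](sintegralrM leb c) sintegral_indic.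
apply: ereal_sup_ubound; exists h => // x /=.
rewrite /h/= /mindic indicE; have [xA|xA] := boolP (x \in A).
  by rewrite mulr1; apply: cg; rewrite inE in xA.
by rewrite mulr0.
Qed.

Lemma iint_ge0 (k : nat) (h : 'rV[R]_k -> \bar R) : (forall v, 0 <= h v) -> 0 <= iint h.
Proof.
elim: k h => [|k IH] h h0 //=.
by apply: integral_ge0 => x _; apply: IH.
Qed.

Lemma row_mx_ord0 (k : nat) (x : R) (v : 'rV[R]_k) :
  row_mx (\row_(_ < 1) x) v 0%R (ord0 : 'I_k.+1) = x.
Proof. by rewrite -[ord0](_ : lshift k (ord0 : 'I_1) = _) ?row_mxEl ?mxE//; apply/val_inj. Qed.

Lemma row_mx_lift0 (k : nat) (x : R) (v : 'rV[R]_k) (j : 'I_k) :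
  row_mx (\row_(_ < 1) x) v 0%R (lift ord0 j : 'I_k.+1) = v 0%R j.
Proof. by rewrite -[lift ord0 j](_ : rshift 1 j = _) ?row_mxEr//; apply/val_inj. Qed.

Lemma iint_box_ge (k : nat) (h : 'rV[R]_k -> \bar R) (c s : R) (lo : 'I_k -> R) :
  (0 <= c)%R -> (0 <= s)%R -> (forall v, 0 <= h v) ->
  (forall v : 'rV[R]_k, (forall j, (lo j <= v 0 j <= lo j + s)%R) -> c%:E <= h v) ->
  (c * s ^+ k)%:E <= iint h.
Proof.
move=> c0 s0; elim: k h lo => [|k IH] h lo h0 hc /=.
  by rewrite expr0 mulr1; apply: hc => -[].
rewrite exprSr mulrA EFinM.
have -> : s%:E = leb [set` `[lo ord0, (lo ord0 + s)%R]%R].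
  rewrite lebesgue_measure_itv/= lte_fin ltrDl.
  case: ltgtP s0 => // [s0 _|<- _] //.
  by rewrite -EFinD addrAC subrr add0r.
apply: ge0_integral_ge_cst => //.
- by rewrite mulr_ge0// exprn_ge0.
- by move=> x; apply: iint_ge0.
- move=> x /=; rewrite in_itv/= => xlo.
  apply: (IH _ (fun j => lo (lift ord0 j))) => // v vlo.
  apply: hc => j; case: (unliftP ord0 j) => [j' ->|->].
    by rewrite row_mx_lift0.
  by rewrite row_mx_ord0.
Qed.

Lemma iint_eq0 (k : nat) (h : 'rV[R]_k -> \bar R) : (forall v, h v = 0) -> iint h = 0.
Proof.
elim: k h => [|k IH] h h0 //=.
by apply: integral0_eq => x _; apply: IH.
Qed.

(** If a later coefficient is nonzero, every slice is again a hyperplane and the inner integral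
    vanishes. Otherwise the equation fixes the first coordinate, and the outer integrand lives on
    one point. *)
Lemma iint_hyperplane0 (k : nat) (h : 'rV[R]_k -> \bar R) (v : 'I_k -> R) (b : R) :
  (exists j, v j != 0%R) ->
  (forall x : 'rV[R]_k, (\sum_j v j * x 0 j != b)%R -> h x = 0) -> iint h = 0.
Proof.
elim: k h v b => [|k IH] h v b [j vj] h0 /=; first by case: j vj.
have sumE x (y : 'rV[R]_k) : (\sum_j v j * row_mx (\row_(_ < 1) x) y 0 (j : 'I_k.+1) =
   v ord0 * x + \sum_j v (lift ord0 j) * y 0 j)%R.
  rewrite big_ord_recl row_mx_ord0; congr (_ + _)%R.
  by apply: eq_bigr => i _; rewrite row_mx_lift0.
have [[j' vj']|nov] := pselect (exists j', v (lift ord0 j') != 0%R).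
  apply: integral0_eq => x _.
  apply: (IH _ (fun j => v (lift ord0 j)) (b - v ord0 * x)%R); first by exists j'.
  move=> y hy; apply: h0; rewrite sumE; apply: contraNneq hy => <-.
  by rewrite addrAC subrr add0r.
have v0 j' : v (lift ord0 j') = 0%R.
  by apply/eqP; apply: contra_notT nov => hv; exists j'.
have v00 : v ord0 != 0%R.
  by move: vj; case: (unliftP ord0 j) => [j' ->|-> //]; rewrite v0 eqxx.
set g := (fun x : R => _).
have g0 x : x != (b / v ord0)%R -> g x = 0.
  move=> hx; apply: iint_eq0 => y; apply: h0; rewrite sumE big1 ?addr0.
    by apply: contra hx => /eqP <-; rewrite (mulrC (v ord0)) mulfK.
  by move=> i _; rewrite v0 mul0r.
rewrite (_ : g = g \_ [set (b / v ord0)%R]).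
  by rewrite -integral_mkcond integral_set1.
apply/funext => x; rewrite patchE; case: ifPn => //; rewrite notin_setE /= => /eqP; exact: g0.
Qed.

End IteratedIntegral.

Section ConvexBody.
Variables (R : realType) (r : nat) (A : set 'rV[R]_r).
Hypothesis cA : convex_set A.

Lemma convexP (x y : 'rV[R]_r) (t : R) : A x -> A y -> 0 <= t <= 1 -> A (t *: x + (1 - t) *: y).
Proof.
move=> Ax Ay /andP[t0 t1].
have := cA (Itv01 t0 t1) (mem_set Ax) (mem_set Ay).
by rewrite inE.
Qed.

Lemma convex_comb (a0 : 'rV[R]_r) (k : nat) (x : 'I_k -> 'rV[R]_r) (y : 'I_k -> R) :
  A a0 -> (forall j, A (a0 + x j)) -> (forall j, 0 <= y j) -> \sum_j y j <= 1 ->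
  A (a0 + \sum_j y j *: x j).
Proof.
move=> Aa0; elim: k x y => [|k IH] x y Ax y0 ys; first by rewrite big_ord0 addr0.
rewrite big_ord_recl; rewrite big_ord_recl in ys.
(* The induction renormalises by 1 - [y ord0]; when this is not positive, all other weights
   vanish. *)
have [y1|y1] := leP 1 (y ord0).
  have s0 : \sum_(i < k) y (lift ord0 i) = 0.
    apply/eqP; rewrite eq_le sumr_ge0// andbT; lra.
  have yi i : y (lift ord0 i) = 0.
    by move/eqP: s0; rewrite psumr_eq0// => /allP/(_ i (mem_index_enum _))/eqP.
  have -> : y ord0 = 1 by apply/eqP; rewrite eq_le y1 andbT; move: ys; rewrite s0 addr0.
  by rewrite big1 ?addr0 ?scale1r// => i _; rewrite yi scale0r.
have y10 : 0 < 1 - y ord0 by rewrite subr_gt0.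
have := IH (fun i => x (lift ord0 i)) (fun i => y (lift ord0 i) / (1 - y ord0)).
move=> /(_ (fun i => Ax _) (fun i => divr_ge0 (y0 _) (ltW y10))).
rewrite -mulr_suml ler_pdivrMr// mul1r => /(_ _) H.
have {H}Az : A (a0 + \sum_j (y (lift ord0 j) / (1 - y ord0)) *: x (lift ord0 j)).
  by apply: H; rewrite lerBrDl.
have := convexP (Ax ord0) Az (t := y ord0); rewrite y0 (ltW y1) => /(_ isT).
congr A; rewrite !scalerDr addrACA -scalerDl [y ord0 + _]addrC subrK scale1r; congr (_ + (_ + _)).
rewrite scaler_sumr; apply: eq_bigr => i _.
by rewrite scalerA mulrCA divff ?mulr1// gt_eqF.
Qed.

Hypothesis flat : forall (v : 'I_r -> R) (b : R), (exists j, v j != 0) ->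
  exists2 x, A x & \sum_j v j * x 0 j != b.

(** As long as k < r, some nonzero v is orthogonal to the directions found so far. The set does not
    lie in the hyperplane normal to v through a0, and a point outside it gives an independent
    direction. *)
Lemma affine_basis (a0 : 'rV[R]_r) (k : nat) : A a0 -> (k <= r)%N ->
  exists M : 'M[R]_(k, r), row_free M /\ forall j, A (a0 + row j M).
Proof.
move=> Aa0; elim: k => [_|k IH kr].
  by exists 0; split=> [|[]//]; rewrite /row_free mxrank0.
have [M [fM AM]] := IH (ltnW kr).
have : kermx M^T != 0.
  rewrite -mxrank_eq0 mxrank_ker mxrank_tr -lt0n subn_gt0.
  by move: fM; rewrite /row_free => /eqP ->.
move=> /rowV0Pn[v vK v0].
have [j vj] : exists j, v 0 j != 0.
  by apply/existsP; rewrite -negb_forall; apply: contra v0 => /forallP h; apply/eqP/rowP => j; rewrite mxE; exact/eqP.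
have [x Ax xb] := @flat (fun j => v 0 j) (\sum_j v 0 j * a0 0 j) (ex_intro _ j vj).
exists (col_mx (x - a0) M : 'M[R]_(1 + k, r)); split; last first.
  move=> i; have [i' ->|->] := unliftP ord0 i.
    rewrite (_ : lift ord0 i' = rshift 1 i'); last exact/val_inj.
    rewrite (_ : row (rshift 1 i') (col_mx (x - a0) M) = row i' M)//.
    by apply/rowP => l; rewrite [LHS]mxE [RHS]mxE col_mxEd.
  rewrite (_ : ord0 = lshift k (ord0 : 'I_1)); last exact/val_inj.
  rewrite (_ : row (lshift k ord0) (col_mx (x - a0) M) = x - a0) ?[a0 + _]addrC ?subrK//.
  by apply/rowP => l; rewrite [LHS]mxE col_mxEu.
rewrite /row_free; have /eqP rM := fM.
have vM : v *m M^T = 0 by apply/sub_kermxP.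
have nsub : ~~ (x - a0 <= M)%MS.
  apply: contra xb => /submxP[D DE]; rewrite -subr_eq0 -sumrB.
  have : (v *m (x - a0)^T) = 0 by rewrite DE trmx_mul mulmxA vM mul0mx.
  move=> /matrixP/(_ 0 0); rewrite !mxE => H; apply/eqP; rewrite -[RHS]H; apply: eq_bigr => i _.
  by rewrite !mxE mulrBr.
rewrite eqn_leq rank_leq_row/= -(addsmxE (x - a0) M).
suff : (\rank M < \rank ((x - a0)%R + M)%MS)%N by rewrite rM.
rewrite ltn_neqAle mxrankS ?addsmxSr// andbT.
apply: contra nsub => /eqP h.
have := mxrank_leqif_sup (addsmxSr (x - a0) M); rewrite -h => -[_].
by rewrite eqxx => /esym; apply: submx_trans; exact: addsmxSl.
Qed.

(* An inscribed simplex with affinely independent vertices contains a cube around its barycentre. *)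
Lemma convex_body_box : (0 < r)%N -> A !=set0 ->
  exists (x0 : 'rV[R]_r) (b : R), 0 < b /\
    forall d : 'rV[R]_r, (forall k, `|d 0 k| <= b) -> A (x0 + d).
Proof.
move=> r0 [a0 Aa0].
have [M [fM AM]] := affine_basis Aa0 (leqnn r).
have uM : M \in unitmx by rewrite -row_free_unit.
pose N := invmx M.
pose S := 1 + \sum_(i < r) \sum_(j < r) `|N i j|.
have S0 : 0 < S by rewrite ltr_pwDl// sumr_ge0// => i _; exact: sumr_ge0.
have r1 : 0 < r.+1%:R :> R by [].
have rr : 0 < r%:R :> R by rewrite ltr0n.
(* Each of the r weights 1 / (r + 1) may move by c: it stays nonnegative, and the total is at most r
   / (r + 1) + r c = 1. Division by S, which bounds the sums of entries of the inverse matrix, turns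
   c into the size of the cube. *)
pose c : R := (r%:R * r.+1%:R)^-1.
have c0 : 0 < c by rewrite invr_gt0 mulr_gt0.
exists (a0 + \sum_(j < r) r.+1%:R^-1 *: row j M), (c / S); split; first exact: divr_gt0.
move=> d db.
have dN j : `|(d *m N) 0 j| <= c.
  rewrite mxE; apply: le_trans (ler_norm_sum _ _ _) _.
  apply: (@le_trans _ _ (\sum_(i < r) (c / S) * `|N i j|)).
    by apply: ler_sum => i _; rewrite normrM ler_wpM2r.
  rewrite -mulr_sumr -mulrA ler_piMr ?(ltW c0)// mulrC ler_pdivrMr// mul1r.
  apply: le_trans (_ : \sum_(i < r) \sum_(j < r) `|N i j| <= _); last by rewrite lerDr.
  by apply: ler_sum => i _; rewrite (bigD1 j)//= lerDl sumr_ge0.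
have cr : c <= r.+1%:R^-1.
  by rewrite /c invfM ler_piMl ?invr_ge0// invf_le1// ler1n.
have -> : a0 + \sum_(j < r) r.+1%:R^-1 *: row j M + d =
    a0 + \sum_(j < r) (r.+1%:R^-1 + (d *m N) 0 j) *: row j M.
  rewrite -addrA; congr (_ + _).
  under [RHS]eq_bigr do rewrite scalerDl.
  rewrite big_split/=; congr (_ + _).
  by rewrite -[LHS](mulmxKV uM) -/N [LHS]mulmx_sum_row.
apply: convex_comb => // [j|].
  have := dN j; rewrite ler_norml => /andP[h1 _].
  by rewrite addrC -lerBlDr sub0r (le_trans _ h1)// lerN2.
rewrite big_split/= sumr_const card_ord.
apply: (@le_trans _ _ (r.+1%:R^-1 *+ r + \sum_(j < r) c)).
  rewrite lerD2l; apply: ler_sum => j _.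
  exact: le_trans (ler_norm _) (dN j).
rewrite sumr_const card_ord -[c *+ r]mulr_natr -[_ *+ r]mulr_natr.
have -> : c * r%:R = r.+1%:R^-1 by rewrite /c invfM mulrAC mulVf ?gt_eqF// mul1r.
by rewrite -[X in _ + X]mulr1 -mulrDr natr1 mulVf// gt_eqF.
Qed.

End ConvexBody.

(** * Coverage of the support by the sample *)

Lemma measure_bigsetU_le (R : realType) (d : measure_display) (T : measurableType d)
    (P : {measure set T -> \bar R}) (I : Type) (s : seq I) (F : I -> set T) :
  (forall i, measurable (F i)) ->
  (P (\big[setU/set0]_(i <- s) F i) <= \sum_(i <- s) P (F i))%E.
Proof.
move=> mF; elim: s => [|i s IH]; first by rewrite !big_nil measure0.
rewrite !big_cons; apply: le_trans (measureU2 _ _ _) _ => //.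
  exact: bigsetU_measurable.
exact: leeD2l.
Qed.

Lemma compact_coord_bounded (R : realType) (r : nat) (A : set 'rV[R]_r) : compact A ->
  exists b : R, forall x, A x -> forall k, `|x 0 k| <= b.
Proof.
move=> cA; have [M [Mr hM]] := compact_bounded cA.
exists (M + 1) => x Ax k; have := hM (M + 1).
rewrite ltrDl ltr01 => /(_ isT x Ax) /=.
apply: le_trans; rewrite [leRHS]/Num.norm /= mx_normrE.
by apply/bigmax_geP; right => /=; exists (0, k).
Qed.

Section Sampling.
Context (R : realType) (d : measure_display) (T : measurableType d) (P : probability T R).
Variables (r : nat) (alpha : nat -> T -> 'rV[R]_r) (A : set 'rV[R]_r).
Hypotheses (r0 : (0 < r)%N)
  (malpha : forall i k, measurable_fun setT (fun w => alpha i w 0 k))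
  (cA : compact A) (vA : convex_set A)
  (ind : indep_family P (fun i => sigma_rv (alpha i)))
  (dens : density_on P alpha A).

Definition hits (i : nat) (lo : 'I_r -> R) (s : R) : set T :=
  [set w | forall k, lo k <= alpha i w 0 k <= lo k + s].

Let box (lo : 'I_r -> R) (s : R) (k : 'I_r) : set R := [set` `[lo k, lo k + s]].

Let mbox lo s k : measurable (box lo s k). Proof. exact: measurable_itv. Qed.

Let hitsE i lo s : hits i lo s = [set w | forall k, box lo s k (alpha i w 0 k)].
Proof. by apply/seteqP; split => w h k; have := h k; rewrite /box/= in_itv. Qed.

Lemma measurable_hits i lo s : measurable (hits i lo s).
Proof.
rewrite (_ : hits i lo s = \bigcap_(k in [set: 'I_r]) ((fun w => alpha i w 0 k) @^-1` box lo s k)).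
  apply: fin_bigcap_measurable => // k _; rewrite -[X in measurable X]setTI.
  by apply: malpha => //; exact: measurable_itv.
by rewrite hitsE; apply/seteqP; split => w h k; [move=> _; exact: h|exact: (h k I)].
Qed.

(** All that is used of the density. The last item holds because a density vanishing off a
    hyperplane would have total mass zero. *)
Lemma density_facts : exists2 c : R, 0 < c &
  [/\ (forall i lo s, 0 <= s -> (forall v : 'rV[R]_r, (forall k, lo k <= v 0 k <= lo k + s) -> A v) ->
        ((c * s ^+ r)%:E <= P (hits i lo s))%E),
      (forall i lo s, (forall v : 'rV[R]_r, (forall k, lo k <= v 0 k <= lo k + s) -> ~ A v) ->
        P (hits i lo s) = 0%E) &
      (forall (v : 'I_r -> R) (b : R), (exists j, v j != 0) ->
         exists2 x : 'rV[R]_r, A x & \sum_j v j * x 0 j != b)].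
Proof.
have [f [c [C [c0 [fA [fNA fE]]]]]] := dens.
have f0 v : 0 <= f v.
  have [Av|Av] := pselect (A v); last by rewrite fNA.
  by have /andP[+ _] := fA v Av; apply: le_trans; exact: ltW.
have prod01 (B : 'I_r -> set R) (v : 'rV[R]_r) : 0 <= \prod_(k < r) (\1_(B k) (v 0 k) : R).
  by apply: prodr_ge0.
exists c => //; split.
- move=> i lo s s0 hA; rewrite hitsE fE; last exact: mbox.
  apply: (@iint_box_ge _ _ _ _ _ lo) => //; first exact: ltW.
    by move=> v; rewrite lee_fin mulr_ge0.
  move=> v hv; rewrite lee_fin big1 ?mulr1; last first.
    by move=> k _; rewrite indicE mem_set// /box/= in_itv/= hv.
  by have /andP[] := fA v (hA v hv).
- move=> i lo s hA; rewrite hitsE fE; last exact: mbox.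
  apply: iint_eq0 => v.
  have [hv|hv] := pselect (forall k, lo k <= v 0 k <= lo k + s).
    by rewrite fNA ?mul0r//; exact: hA.
  have [k hk] : exists k, ~ (lo k <= v 0 k <= lo k + s) by apply/existsNP.
  by rewrite (bigD1 k)//= indicE memNset ?mul0r ?mulr0// /box/= in_itv.
- move=> v b vj; apply: contrapT => h.
  have : P setT = 0%E; last by rewrite probability_setT => /eqP; rewrite eqe oner_eq0.
  have -> : [set: T] = [set w | forall k, (fun=> setT) k (alpha 0%N w 0 k)].
    by apply/seteqP; split.
  rewrite (fE 0%N (fun=> setT))//; apply: (iint_hyperplane0 vj (b := b)) => x xb.
  rewrite fNA ?mul0r// => Ax; apply: h; by exists x.
Qed.

Lemma body_box : exists (x0 : 'rV[R]_r) (b : R), 0 < b /\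
    forall d : 'rV[R]_r, (forall k, `|d 0 k| <= b) -> A (x0 + d).
Proof.
have [c c0 [_ _ flat]] := density_facts.
apply: convex_body_box => //.
have [x Ax _] := flat (fun=> 1) 0 (ex_intro _ (Ordinal r0) (oner_neq0 _)).
by exists x.
Qed.

Definition cell (m : nat) (z : 'rV[int]_r) (k : 'I_r) : R := (z 0 k)%:~R / m.+1%:R.

Lemma in_cell (m : nat) (x : 'rV[R]_r) k :
  cell m (grid_floor m x) k <= x 0 k <= cell m (grid_floor m x) k + m.+1%:R^-1.
Proof.
have m0 : 0 < m.+1%:R :> R by [].
have E (y : R) : y / m.+1%:R + m.+1%:R^-1 = (y + 1) / m.+1%:R by rewrite mulrDl mul1r.
rewrite /cell mxE E ler_pdivrMr// ler_pdivlMr// [x 0 k * _]mulrC.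
have /andP[h1 h2] := floor_itv (m.+1%:R * x 0 k).
by rewrite h1/= ltW// -intrD1.
Qed.

Lemma cell_dist (m : nat) (z : 'rV[int]_r) (x y : 'rV[R]_r) :
  (forall k, cell m z k <= x 0 k <= cell m z k + m.+1%:R^-1) ->
  (forall k, cell m z k <= y 0 k <= cell m z k + m.+1%:R^-1) ->
  forall k, `|y 0 k - x 0 k| <= m.+1%:R^-1.
Proof.
move=> hx hy k; have /andP[h1 h2] := hx k; have /andP[h3 h4] := hy k.
move: (x 0 k) (y 0 k) (cell m z k) (m.+1%:R^-1 : R) h1 h2 h3 h4 => a b c e h1 h2 h3 h4.
by rewrite ler_norml; apply/andP; split; lra.
Qed.

(** The law is accessible only through boxes. The complement of the support is open, hence a point
    outside lies in a small grid cell that misses the support; there are countably many such cells,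
    each of mass zero. *)
Lemma as_in_support : exists N : set T, [/\ measurable N, P N = 0%E &
  forall w, ~ N w -> forall i, A (alpha i w)].
Proof.
have [c c0 [_ null _]] := density_facts.
pose D i (mz : nat * 'rV[int]_r) : set T :=
  if `[< forall v : 'rV[R]_r, (forall k, cell mz.1 mz.2 k <= v 0 k <= cell mz.1 mz.2 k + mz.1.+1%:R^-1) -> ~ A v >]
  then hits i (cell mz.1 mz.2) mz.1.+1%:R^-1 else set0.
have mD i mz : measurable (D i mz) by rewrite /D; case: ifP => _ //; exact: measurable_hits.
have PD i mz : P (D i mz) = 0%E.
  by rewrite /D; case: ifPn => [/asboolP h|_]; rewrite ?measure0//; exact: null.
pose E n : set T := if unpickle n is Some (i, mz) then D i mz else set0.
have mE n : measurable (E n) by rewrite /E; case: unpickle => [[i mz]|].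
have PE n : P (E n) = 0%E by rewrite /E; case: unpickle => [[i mz]|]; rewrite ?measure0.
exists (\bigcup_n E n); split.
- exact: bigcupT_measurable.
- apply/eqP; rewrite eq_le measure_ge0 andbT.
  apply: le_trans (measure_sigma_subadditive _ _ _ (subset_refl _)) _ => //.
    exact: bigcupT_measurable.
  by rewrite eseries0// => n _ _; exact: PE.
- move=> w Nw i; apply: contrapT => nA; apply: Nw.
  have oA : open (~` A) by apply: closed_openC; apply: compact_closed => //; exact: norm_hausdorff.
  have /nbhs_ballP[e /= e0 he] : nbhs (alpha i w) (~` A) by apply: open_nbhs_nbhs.
  have [m _ hm] := near_infty_natSinv_lt (PosNum e0).
  have hm' := hm m (leqnn m).
  exists (pickle (i, (m, grid_floor m (alpha i w)))) => //.
  rewrite /E pickleK /D asboolT /=.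
    by move=> k; exact: in_cell.
  move=> v hv; apply: he; split => // a k; rewrite ord1 -ball_normE /= distrC.
  apply: le_lt_trans hm'.
  by apply: (cell_dist _ hv) => k'; exact: in_cell.
Qed.


Lemma miss_prob (lo : 'I_r -> R) (s q : R) (st len : nat) :
  0 <= q <= 1 -> (forall i, (q%:E <= P (hits i lo s))%E) ->
  (P (\big[setI/setT]_(i <- iota st len) ~` hits i lo s) <= ((1 - q) ^+ len)%:E)%E.
Proof.
move=> /andP[q0 q1] hq.
rewrite (ind (iota_uniq st len) (A := fun i => ~` hits i lo s)); last first.
  move=> i _; rewrite -setTD; have [_ + _] := smallest_sigma_algebra setT
    [set A0 | exists k (B : set R), measurable B /\ A0 = (fun w => alpha i w 0 k) @^-1` B]; apply.
  rewrite (_ : hits i lo s = \bigcap_(k in [set: 'I_r]) ((fun w => alpha i w 0 k) @^-1` box lo s k)); last first.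
    by rewrite hitsE; apply/seteqP; split => w h k; [move=> _; exact: h|exact: (h k I)].
  apply: (@fin_bigcap_measurable _ (g_sigma_algebraType _)) => // k _.
  by apply: sub_sigma_algebra; exists k, (box lo s k).
have h1 i : (P (~` hits i lo s) <= (1 - q)%:E)%E.
  rewrite probability_setC; last exact: measurable_hits.
  by rewrite EFinB leeB.
apply: (@le_trans _ _ (\prod_(i <- iota st len) (1 - q)%:E)%E).
  elim: (iota st len) => [|i t IH]; first by rewrite !big_nil.
  by rewrite !big_cons lee_pmul// prode_ge0.
rewrite prodEFin big_const_seq count_predT size_iota.
by rewrite iter_mulr_1.
Qed.



(* Each grid cell inside the support has a fixed positive mass, so that with probability tending to one it is hit within each of three disjoint blocks of indices; one block then avoids two prescribed indices. *)
Lemma sample_net (m : nat) : exists Bad : nat -> set T,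
  [/\ forall n, measurable (Bad n), P (Bad n) @[n --> \oo] --> 0%E &
   forall n w, ~ Bad n w -> forall x : 'rV[R]_r,
     (forall y : 'rV[R]_r, (forall k, `|y 0 k - x 0 k| <= m.+1%:R^-1) -> A y) ->
     forall i j : nat, exists k : nat, [/\ (k < n)%N, k != i, k != j &
        forall l, `|alpha k w 0 l - x 0 l| <= m.+1%:R^-1]].
Proof.
have [c c0 [mass _ _]] := density_facts.
have [b hb] := compact_coord_bounded cA.
have [N hN] : exists N : nat, m.+1%:R * b < N%:R.
  exists (Num.truncn (m.+1%:R * `|b|)).+1.
  by apply: le_lt_trans (truncnS_gt _); rewrite ler_wpM2l ?ler_norm.
(* Grid vectors with entries from -N to N form a finite index set; N exceeds (m + 1) b, so the cell
   of every point of the support is among them. *)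
pose z (f : {ffun 'I_r -> 'I_(N + N).+1}) : 'rV[int]_r := \row_k ((f k : nat)%:Z - N%:Z).
pose inA f := `[< forall v : 'rV[R]_r, (forall k, cell m (z f) k <= v 0 k <= cell m (z f) k + m.+1%:R^-1) -> A v >].
pose hs := (m.+1%:R^-1 : R).
pose miss n f g : set T := if inA f then \big[setI/setT]_(i <- iota (g * (n %/ 3)) (n %/ 3)) ~` hits i (cell m (z f)) hs else set0.
have mmiss n f g : measurable (miss n f g).
  rewrite /miss; case: ifP => // _.
  by apply: bigsetI_measurable => i _; apply: measurableC; exact: measurable_hits.
pose Bad n := \big[setU/set0]_(fg : {ffun 'I_r -> 'I_(N + N).+1} * 'I_3) miss n fg.1 fg.2.
exists Bad; split.
- by move=> n; apply: bigsetU_measurable.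
- have hs0 : 0 < hs by rewrite invr_gt0.
  pose q := Num.min 1 (c * hs ^+ r).
  have q0 : 0 < q by rewrite lt_min ltr01 mulr_gt0// exprn_gt0.
  have q1 : q <= 1 by rewrite ge_min lexx.
  have bound n : (P (Bad n) <= (#|{: {ffun 'I_r -> 'I_(N + N).+1} * 'I_3}|%:R * (1 - q) ^+ (n %/ 3))%:E)%E.
    apply: le_trans (_ : \sum_(fg : {ffun 'I_r -> 'I_(N + N).+1} * 'I_3) P (miss n fg.1 fg.2) <= _)%E.
      by apply: measure_bigsetU_le.
    rewrite mulr_natl -sumr_const -sumEFin big_mkcond [leRHS]big_mkcond/=; apply: lee_sum => fg _.
    rewrite /miss; case: ifPn => [/asboolP hA|_]; last first.
      by rewrite measure0 lee_fin exprn_ge0// subr_ge0.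
    apply: miss_prob; first by rewrite ltW.
    move=> i; apply: le_trans (mass i _ _ (ltW hs0) hA).
    by rewrite lee_fin ge_min lexx orbT.
  apply: (@squeeze_cvge _ _ _ _ (cst 0%E) _ (fun n => (#|{: {ffun 'I_r -> 'I_(N + N).+1} * 'I_3}|%:R * (1 - q) ^+ (n %/ 3))%:E)).
  + by apply: nearW => n; rewrite measure_ge0/= bound.
  + exact: cvg_cst.
  + apply: cvg_EFin; first exact: nearW.
    rewrite -[X in _ --> X](mulr0 #|{: {ffun 'I_r -> 'I_(N + N).+1} * 'I_3}|%:R).
    apply: cvgM; first exact: cvg_cst.
    apply: (@cvg_comp _ _ _ (fun n => n %/ 3)%N (fun n => (1 - q) ^+ n) _ \oo).
      apply/cvgnyPge => k; near=> n; rewrite leq_divRL//; near: n; exact: nbhs_infty_ge.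
    by apply: cvg_expr; rewrite ger0_norm ?subr_ge0// gtrBl.
- move=> n w nB x hx i j.
  have Ax : A x by apply: hx => k; rewrite subrr normr0 invr_ge0.
  pose f : {ffun 'I_r -> 'I_(N + N).+1} := [ffun k => inord `|(grid_floor m x 0 k + N%:Z)%R|%N].
  have zf : z f = grid_floor m x.
    apply/rowP => k; rewrite !mxE /f ffunE.
    have hxk := hb x Ax k.
    have h1 : `|m.+1%:R * x 0 k| < N%:R.
      by rewrite normrM ger0_norm// (le_lt_trans _ hN)// ler_wpM2l.
    move: h1; rewrite ltr_norml => /andP[h1 h2].
    have h3 : - N%:Z <= Num.floor (m.+1%:R * x 0 k).
      by rewrite real_floor_ge_int ?num_real// mulrNz ltW.
    have h4 : Num.floor (m.+1%:R * x 0 k) <= N%:Z.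
      have := le_lt_trans (floor_le (m.+1%:R * x 0 k)) h2.
      by rewrite -[N%:R]/(N%:Z%:~R) ltr_int => /ltW.
    rewrite mxE; move: h3 h4; move: (Num.floor _) => fl h3 h4.
    by rewrite inordK; lia.
  have fA : inA f.
    apply/asboolP => v hv; apply: hx; rewrite zf in hv.
    by apply: (cell_dist _ hv) => k; exact: in_cell.
  have hit (g : 'I_3) : exists k, [/\ (g * (n %/ 3) <= k)%N, (k < g * (n %/ 3) + n %/ 3)%N & hits k (cell m (z f)) hs w].
    apply: contrapT => nh; apply: nB.
    rewrite /Bad -bigcup_seq; exists (f, g) => //=; first by rewrite mem_index_enum.
    rewrite /miss fA -bigcap_seq => k /=; rewrite mem_iota => /andP[k1 k2] hk.
    by apply: nh; exists k.
  pose t := (n %/ 3)%N.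
  (* For n < 3 the blocks are empty and [miss] is an intersection over no index, that is the whole
     space; outside [Bad] the blocks are therefore nonempty. *)
  have t0 : (0 < t)%N.
    have [k [k1 k2 _]] := hit ord0; rewrite lt0n; apply/eqP => t0.
    by move: k2; rewrite -/t t0 muln0.
  have [g gi gj] : exists2 g : 'I_3, (g : nat) != (i %/ t)%N & (g : nat) != (j %/ t)%N.
    pose g0 : 'I_3 := inord 0; pose g1 : 'I_3 := inord 1; pose g2 : 'I_3 := inord 2.
    have [e0 e1 e2] : [/\ (g0 : nat) = 0%N, (g1 : nat) = 1%N & (g2 : nat) = 2%N] by rewrite /g0 /g1 /g2 !inordK.
    case: (eqVneq (g0 : nat) (i %/ t)%N) => [h0|h0]; case: (eqVneq (g0 : nat) (j %/ t)%N) => [h0'|h0'].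
    - by exists g1; rewrite e1; [rewrite -h0 e0|rewrite -h0' e0].
    - case: (eqVneq (g1 : nat) (j %/ t)%N) => [h1|h1].
        by exists g2; rewrite e2; [rewrite -h0 e0|rewrite -h1 e1].
      by exists g1 => //; rewrite e1 -h0 e0.
    - case: (eqVneq (g1 : nat) (i %/ t)%N) => [h1|h1].
        by exists g2; rewrite e2; [rewrite -h1 e1|rewrite -h0' e0].
      by exists g1 => //; rewrite e1 -h0' e0.
    - by exists g0.
  have [k [k1 k2 hk]] := hit g.
  have kg : (k %/ t)%N = g.
    apply/eqP; rewrite eqn_leq leq_divRL// k1 andbT -ltnS ltn_divLR// mulSn addnC; exact: k2.
  exists k; split.
  + apply: (leq_trans k2); rewrite -mulSnr; apply: leq_trans (leq_divM n 3).
    by rewrite mulnC leq_mul2l ltn_ord orbT.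
  + by apply: contraNneq gi => <-; rewrite kg.
  + by apply: contraNneq gj => <-; rewrite kg.
  + by apply: (@cell_dist m (z f)) => l; [rewrite zf; exact: in_cell|exact: hk].
Unshelve. all: by end_near. Qed.

End Sampling.

(** * Smallest singular value *)

Lemma continuous_sum_real (R : realType) (T : topologicalType) (I : Type) (s : seq I) (F : I -> T -> R) :
  (forall i, continuous (F i)) -> continuous (fun x => \sum_(i <- s) F i x).
Proof.
move=> cF x; elim: s => [|i s IH].
  by under eq_fun do rewrite big_nil; exact: cvg_cst.
rewrite /continuous_at; under eq_cvg do rewrite big_cons.
by rewrite big_cons; apply: cvgD; [exact: cF|exact: IH].
Qed.

Section Rayleigh.
Variables (R : realType) (r : nat).

Definition sqn (k : nat) (v : 'rV[R]_k) : R := \sum_(j < k) v 0 j ^+ 2.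

Lemma sqnE k (v : 'rV[R]_k) : sqn v = (v *m v^T) 0 0.
Proof. by rewrite mxE; apply: eq_bigr => j _; rewrite mxE expr2. Qed.

Lemma sqn_ge0 k (v : 'rV[R]_k) : 0 <= sqn v.
Proof. by apply: sumr_ge0 => j _; exact: sqr_ge0. Qed.

Lemma sqn_eq0 k (v : 'rV[R]_k) : sqn v = 0 -> v = 0.
Proof.
move=> /eqP; rewrite psumr_eq0 => [/allP h|j _]; last exact: sqr_ge0.
by apply/rowP => j; rewrite mxE; have := h j (mem_index_enum _); rewrite sqrf_eq0 => /eqP.
Qed.

Lemma sqnZ k t (v : 'rV[R]_k) : sqn (t *: v) = t ^+ 2 * sqn v.
Proof. by rewrite /sqn mulr_sumr; apply: eq_bigr => j _; rewrite mxE exprMn. Qed.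

Lemma sqnD k (v y : 'rV[R]_k) : sqn (v + y) = sqn v + 2 * (v *m y^T) 0 0 + sqn y.
Proof.
rewrite /sqn mxE mulr_sumr -!big_split/=; apply: eq_bigr => j _.
by rewrite !mxE; ring.
Qed.

Lemma continuous_sqn_mul k (N : 'M[R]_(r, k)) : continuous (fun v : 'rV[R]_r => sqn (v *m N)).
Proof.
have cN j : continuous (fun v : 'rV[R]_r => (v *m N) 0 j).
  rewrite (_ : (fun v : 'rV[R]_r => _) = (fun v => \sum_i v 0 i * N i j)); last first.
    by apply/funext => v; rewrite mxE.
  apply: continuous_sum_real => i v.
  by apply: continuousM; [exact: coord_continuous|exact: cst_continuous].
by apply: continuous_sum_real => j v; apply: continuousM; exact: cN.
Qed.

Lemma continuous_sqn : continuous (@sqn r).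
Proof.
have := @continuous_sqn_mul r 1%:M.
by rewrite (_ : (fun v => _) = @sqn r)//; apply/funext => v; rewrite mulmx1.
Qed.

(** The quadratic form attains its minimum on the compact unit sphere, and vanishing of the first
    variation makes a minimiser an eigenvector. *)
Lemma rayleigh_min k (N : 'M[R]_(r, k)) : (0 < r)%N ->
  exists a : R, [/\ 0 <= a, eigenvalue (N *m N^T) a & forall v, a * sqn v <= sqn (v *m N)].
Proof.
move=> r0; pose S : set 'rV[R]_r := [set v | sqn v = 1].
have S0 : S !=set0.
  exists (unitvec (Ordinal r0)); rewrite /S/= /sqn (bigD1 (Ordinal r0))//= mxE eqxx expr1n big1 ?addr0//.
  by move=> j /negbTE jn; rewrite mxE jn expr0n.
have csqn := continuous_sqn.
have cS : compact S.
  apply: bounded_closed_compact.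
    exists 1; split => // M M1 v Sv; rewrite /Num.norm/= mx_normrE.
    apply: bigmax_le => [|[i j] _]; first by rewrite (le_trans ler01) ?ltW.
    rewrite ord1/=; apply: le_trans (ltW M1).
    rewrite -(@ler_pXn2r _ 2)// ?nnegrE// expr1n real_normK ?num_real//.
    by rewrite -Sv /sqn (bigD1 j)//= lerDl sumr_ge0// => i' _; exact: sqr_ge0.
  rewrite (_ : S = (@sqn r) @^-1` [set 1]); last by [].
  by apply: (preimage_closed (f := @sqn r)) => [v _|]; [exact: csqn|exact: closed_eq].
have [v0 Sv0 v0min] : exists2 v0, v0 \in S & forall t, t \in S -> sqn (v0 *m N) <= sqn (t *m N).
  have cf : {within S, continuous (fun v : 'rV[R]_r => sqn (v *m N))}.
    by apply: continuous_subspaceT; exact: continuous_sqn_mul.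
  have [v0 v0S v0min] := compact_EVT_min S0 cS cf.
  by exists v0.
move: Sv0; rewrite inE /S/= => Sv0.
pose a := sqn (v0 *m N).
have amin v : a * sqn v <= sqn (v *m N).
  have [->|vn0] := eqVneq v 0.
    by rewrite mul0mx /sqn !big1 ?mulr0// => j _; rewrite mxE expr0n.
  have sv : 0 < sqn v.
    by rewrite lt_neqAle sqn_ge0 andbT eq_sym; apply: contra vn0 => /eqP/sqn_eq0 ->.
  pose s := Num.sqrt (sqn v).
  have s0 : 0 < s by rewrite sqrtr_gt0.
  have s2 : s ^+ 2 = sqn v by rewrite sqr_sqrtr// ltW.
  have := v0min (s^-1 *: v); rewrite inE /S/= sqnZ exprVn s2 mulVf ?gt_eqF// => /(_ erefl).
  by rewrite -scalemxAl sqnZ exprVn s2 mulrC ler_pdivlMr.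
exists a; split => //; first exact: sqn_ge0.
have [g gE] : exists g, g = v0 *m (N *m N^T) - a *: v0 by exists (v0 *m (N *m N^T) - a *: v0).
have g0 : sqn g = 0.
  apply/eqP; rewrite eq_le sqn_ge0 andbT.
  (* first-order optimality of the minimiser v0 in the direction -g *)
  pose q := sqn (g *m N) - a * sqn g.
  have key (s : R) : 0 < s -> 2 * sqn g <= s * q.
    move=> s0; have := amin (v0 - s *: g).
    have cross l (x y : 'rV[R]_l) (t : R) : (x *m (t *: y)^T) 0 0 = t * (x *m y^T) 0 0.
      by rewrite linearZ/= -scalemxAr mxE.
    rewrite -scaleNr mulmxDl !sqnD -scalemxAl !sqnZ sqrrN Sv0 -/a !cross.
    have E : sqn g = (v0 *m N *m (g *m N)^T) 0 0 - a * (v0 *m g^T) 0 0.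
      have sub (x y : 'M[R]_1) : (x - y) 0 0 = x 0 0 - y 0 0 by rewrite !mxE.
      have scal (x : 'M[R]_1) : (a *: x) 0 0 = a * x 0 0 by rewrite mxE.
      by rewrite sqnE {1}gE mulmxBl sub -scalemxAl scal trmx_mul !mulmxA.
    move: E; rewrite /q; move: (sqn g) (sqn (g *m N)) ((v0 *m g^T) 0 0) ((v0 *m N *m (g *m N)^T) 0 0) => G Q p p' -> h.
    have : s * (2 * (p' - a * p)) <= s * (s * (Q - a * (p' - a * p))) by nra.
    by rewrite ler_pM2l.
  rewrite leNgt; apply/negP => gp.
  have [q0|q0] := leP q 0.
    by have := key 1 ltr01; rewrite mul1r; lra.
  have := key (sqn g / q) (divr_gt0 gp q0); rewrite divfK ?gt_eqF//; lra.
apply/eigenvalueP; exists v0.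
  by apply/eqP; rewrite -subr_eq0 -gE; apply/eqP; exact: sqn_eq0.
by apply/eqP => v00; move: Sv0; rewrite v00 /sqn big1 => [/esym/eqP|j _]; rewrite ?oner_eq0// mxE expr0n.
Qed.

(** Replaces the infimum over eigenvalues by a family of quadratic inequalities. These give the
    lower bound on w in [local_lower] and reduce measurability to countably many v. *)
Lemma smin_geP (M : 'M[R]_r) (c : R) : (0 < r)%N -> 0 < c ->
  c <= smin M <-> forall v : 'rV[R]_r, c ^+ 2 * sqn v <= sqn (v *m M^T).
Proof.
move=> r0 c0; have [a [a0 ea amin]] := rayleigh_min M^T r0.
rewrite trmxK in ea.
have eig a' : eigenvalue (M^T *m M) a' -> a <= a'.
  move=> /eigenvalueP[v vE vn0].
  have sv : 0 < sqn v.
    by rewrite lt_neqAle sqn_ge0 andbT eq_sym; apply: contra vn0 => /eqP/sqn_eq0 ->.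
  have := amin v; rewrite [X in _ <= X]sqnE trmx_mul trmxK mulmxA -[_ *m _ *m M]mulmxA vE.
  by rewrite -scalemxAl mxE -sqnE ler_pM2r.
have infE : inf [set a : R | eigenvalue (M^T *m M) a] = a.
  apply/eqP; rewrite eq_le; apply/andP; split.
    by apply: ge_inf => //; exists a => x; exact: eig.
  by apply: lb_le_inf; [exists a|move=> x; exact: eig].
rewrite /smin infE; split.
  move=> ca v; apply: le_trans (amin v); rewrite ler_wpM2r ?sqn_ge0//.
  by rewrite -(sqr_sqrtr a0) ler_pXn2r// nnegrE ?sqrtr_ge0// ltW.
move=> h; rewrite -[c](ger0_norm (ltW c0)) -sqrtr_sqr ler_sqrt//.
have /eigenvalueP[v vE vn0] := ea.
have sv : 0 < sqn v.
  by rewrite lt_neqAle sqn_ge0 andbT eq_sym; apply: contra vn0 => /eqP/sqn_eq0 ->.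
have := h v; rewrite [X in _ <= X]sqnE trmx_mul trmxK mulmxA -[_ *m _ *m M]mulmxA vE.
by rewrite -scalemxAl mxE -sqnE ler_pM2r.
Qed.

(** Both sides of the inequality in [smin_geP] are continuous in v, so it suffices to test it at the
    grid points of all meshes. *)
Lemma measurable_smin_ge d (T : measurableType d) (M : T -> 'M[R]_r) (c : R) :
  (0 < r)%N -> 0 < c -> (forall i j, measurable_fun setT (fun w => M w i j)) ->
  measurable [set w | c <= smin (M w)].
Proof.
move=> r0 c0 mM.
pose v (mz : nat * 'rV[int]_r) : 'rV[R]_r := grid_point R mz.1 mz.2.
rewrite (_ : [set w | _] = \bigcap_(mz in [set: nat * 'rV[int]_r])
   [set w | c ^+ 2 * sqn (v mz) <= sqn (v mz *m (M w)^T)]); last first.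
  apply/seteqP; split => w /=; first by move=> /(smin_geP _ r0 c0) h mz _; exact: h.
  move=> h; apply/(smin_geP _ r0 c0) => x.
  pose f (y : 'rV[R]_r) := sqn (y *m (M w)^T) - c ^+ 2 * sqn y.
  have cf : continuous f.
    move=> y; have h1 := @continuous_sqn_mul _ (M w)^T y.
    have h2 : {for y, continuous (fun y : 'rV[R]_r => c ^+ 2 * sqn y)}.
      by apply: continuousM; [exact: cst_continuous|exact: continuous_sqn].
    exact: (cvgB h1 h2).
  have H : f (grid_point R m (grid_floor m x)) @[m --> \oo] --> f x.
    apply: (@cvg_comp _ _ _ (fun m => grid_point R m (grid_floor m x)) f _ (nbhs x)).
      exact: grid_floor_cvg.
    exact: cf.
  rewrite -subr_ge0 -/(f x) -(cvg_lim (@Rhausdorff R) H).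
  apply: limr_ge; first by apply/cvg_ex; exists (f x).
  by apply: nearW => m /=; rewrite subr_ge0; exact: (h (m, grid_floor m x)).
rewrite -[X in measurable X]setCK setC_bigcap; apply: measurableC.
apply: countable_bigcupT_measurable => // mz; apply: measurableC.
rewrite -[X in measurable X]setTI; apply: measurable_fun_ler => //.
apply: measurable_sum => j; apply: measurable_funX.
under eq_fun do rewrite mxE; apply: measurable_sum => i.
by apply: measurable_funM => //; under eq_fun do rewrite mxE; exact: mM.
Qed.

End Rayleigh.

(** * Local lower bound for the pseudo-max distance *)

Section Average.
Variables (R : realType) (M : nat) (S : {set 'I_M}).

Definition avg (f : 'I_M -> R) : R := (#|S|%:R)^-1 * \sum_(l in S) f l.

Lemma avg_le (f : 'I_M -> R) (B : R) : 0 <= B -> (forall l, `|f l| <= B) -> `|avg f| <= B.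
Proof.
move=> B0 fB; rewrite /avg normrM ger0_norm ?invr_ge0//.
(* Over an empty row set the average is 0, since the inverse of 0 is 0. *)
have [S0|S0] := eqVneq #|S| 0%N; first by rewrite S0 invr0 mul0r.
rewrite mulrC ler_pdivrMr ?ltr0n ?lt0n//.
apply: le_trans (ler_norm_sum _ _ _) _.
rewrite mulr_natr -sumr_const; exact: ler_sum.
Qed.

Lemma avgB (f g : 'I_M -> R) : avg f - avg g = avg (fun l => f l - g l).
Proof. by rewrite /avg -mulrBr sumrB. Qed.

Lemma eq_avg (f g : 'I_M -> R) : (forall l, f l = g l) -> avg f = avg g.
Proof. by move=> fg; congr (_ * _); apply: eq_bigr. Qed.

Lemma avg_sum r (F : 'I_r -> 'I_M -> R) : avg (fun l => \sum_k F k l) = \sum_k avg (F k).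
Proof. by rewrite /avg exchange_big/= mulr_sumr. Qed.

Lemma avgZ (x : R) (f : 'I_M -> R) : avg (fun l => x * f l) = x * avg f.
Proof. by rewrite /avg -mulr_sumr mulrCA. Qed.

Lemma rho_ge (n : nat) (Y : nat -> nat -> R) (i j k : nat) : (k < n)%N -> k != i -> k != j ->
  `|avg (fun l => (Y i l - Y j l) * Y k l)| <= rho n S Y i j.
Proof.
move=> kn ki kj.
by rewrite /rho; apply/bigmax_geP; right; exists (Ordinal kn) => //=; rewrite ki.
Qed.

Lemma rho_le (n : nat) (Y : nat -> nat -> R) (i j : nat) (B : R) : 0 <= B ->
  (forall k, (k < n)%N -> k != i -> k != j ->
     `|avg (fun l => (Y i l - Y j l) * Y k l)| <= B) -> rho n S Y i j <= B.
Proof. by move=> B0 h; apply: bigmax_le => // k /andP[ki kj]; exact: h. Qed.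

End Average.

Section Norms.
Variables (R : realType) (r : nat).
Implicit Types x y w : 'rV[R]_r.

Lemma sum_const_ord (z : R) : \sum_(k < r) z = r%:R * z.
Proof. by rewrite sumr_const card_ord mulr_natl. Qed.

Lemma l1distC x y : l1dist x y = l1dist y x.
Proof. by apply: eq_bigr => k _; rewrite distrC. Qed.

Lemma enormE x : enorm x = Num.sqrt (sqn x). Proof. by []. Qed.

Lemma sqn_le_l1 w : sqn w <= (\sum_k `|w 0 k|) ^+ 2.
Proof.
rewrite expr2 mulr_suml; apply: ler_sum => k _.
rewrite -real_normK ?num_real// expr2 ler_wpM2l//.
by rewrite (bigD1 k)//= lerDl sumr_ge0.
Qed.

Lemma enorm_le_l1 x y : enorm (x - y) <= l1dist y x.
Proof.
rewrite enormE -[leRHS]ger0_norm ?l1dist_ge0// -sqrtr_sqr ler_wsqrtr//.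
rewrite (_ : l1dist y x = \sum_k `|(x - y) 0 k|) ?sqn_le_l1//.
by apply: eq_bigr => k _; rewrite !mxE.
Qed.

Lemma l1_le_enorm x y : l1dist y x <= r%:R * enorm (x - y).
Proof.
rewrite -sum_const_ord; apply: ler_sum => k _.
rewrite enormE -sqrtr_sqr ler_wsqrtr// /sqn (bigD1 k)//= !mxE lerDl.
by apply: sumr_ge0 => j _; exact: sqr_ge0.
Qed.

End Norms.

Section LocalBound.
Variables (R : realType) (r : nat).

(** What the estimates use of a latent function, with one constant for the value, the increments,
    the gradient and the second-order remainder. *)
Record regular_fun (C : R) (f : 'rV[R]_r -> R) : Prop := RegularFun {
  reg_bound : forall x, `|f x| <= C;
  reg_lip : forall x y, `|f y - f x| <= C * l1dist x y;
  reg_grad : forall x k, `|'D_(unitvec k) f x| <= C;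
  reg_taylor : forall a x,
    `|f x - f a - \sum_(k < r) (x 0 k - a 0 k) * 'D_(unitvec k) f a| <= C * l1dist a x ^+ 2 }.

Lemma rho_lipschitz (C : R) (n M : nat) (S : {set 'I_M}) (eta : nat -> 'rV[R]_r -> R)
    (al : nat -> 'rV[R]_r) (i j : nat) : 0 <= C -> (forall l, regular_fun C (eta l)) ->
  rho n S (fun i l => eta l (al i)) i j <= C * (r%:R * C) * enorm (al i - al j).
Proof.
move=> C0 reg; have e0 : 0 <= enorm (al i - al j) by rewrite enormE sqrtr_ge0.
apply: rho_le => [|k _ _ _]; first by rewrite !mulr_ge0.
apply: avg_le => [|l]; first by rewrite !mulr_ge0.
rewrite normrM -[C * _ * _]mulrA [leRHS]mulrC ler_pM ?(reg_bound (reg l))//.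
apply: le_trans (reg_lip (reg l) _ _) _.
by rewrite [r%:R * C]mulrC -mulrA ler_wpM2l// l1_le_enorm.
Qed.

Variable A : set 'rV[R]_r.
Hypotheses (r0 : (0 < r)%N) (vA : convex_set A).
Variables (x0 : 'rV[R]_r) (b Bd : R).
Hypotheses (b0 : 0 < b) (Abox : forall d : 'rV[R]_r, (forall k, `|d 0 k| <= b) -> A (x0 + d))
  (Abd : forall x, A x -> forall k, `|x 0 k| <= Bd).

(** The point is the convex combination of a and x0 + s + e / t with weights 1 - t and t; half of
    the cube serves the direction s and half the error e / t. *)
Lemma shrunk_box (t : R) (a s e : 'rV[R]_r) : A a -> 0 < t <= 1 ->
  (forall k, `|s 0 k| <= b / 2) -> (forall k, `|e 0 k| <= t * b / 2) ->
  A (a + t *: (x0 + s - a) + e).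
Proof.
move=> Aa /andP[t0 t1] sb eb.
have -> : a + t *: (x0 + s - a) + e = t *: (x0 + (s + t^-1 *: e)) + (1 - t) *: a.
  by apply/rowP => k; rewrite !mxE; field; rewrite gt_eqF.
apply: convexP => //; last by rewrite ltW.
apply: Abox => k; rewrite !mxE.
apply: le_trans (ler_normD _ _) _.
have t'0 : 0 <= t^-1 by rewrite invr_ge0 ltW.
rewrite normrM (ger0_norm t'0).
have : t^-1 * `|e 0 k| <= b / 2 by rewrite mulrC ler_pdivrMr// mulrAC [b * t]mulrC; exact: eb.
have := sb k; move: `|s 0 k| (t^-1 * `|e 0 k|) => u v; lra.
Qed.

Section Gram.
Variables (C : R) (M : nat) (S : {set 'I_M}) (eta : nat -> 'rV[R]_r -> R).
Hypotheses (C0 : 0 < C) (reg : forall l, regular_fun C (eta l)).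
Variables (a D : 'rV[R]_r).

(** The derivative of [eta l] at a along D, a first-order substitute for the difference between the
    two columns in row l. *)
Let theta (l : 'I_M) := \sum_(k < r) D 0 k * 'D_(unitvec k) (eta l) a.
Let w : 'rV[R]_r := D *m (gram S eta a)^T.
Let f (x : 'rV[R]_r) := avg S (fun l => theta l * eta l x).
Let D1 := \sum_(k < r) `|D 0 k|.

Lemma gram_row k : w 0 k = avg S (fun l => theta l * 'D_(unitvec k) (eta l) a).
Proof.
rewrite /w mxE.
under eq_bigr do rewrite !mxE.
transitivity (\sum_(k' < r) avg S (fun l => D 0 k' * 'D_(unitvec k') (eta l) a * 'D_(unitvec k) (eta l) a)).
  apply: eq_bigr => k' _; rewrite mulrCA; congr (_ * _).
  rewrite [RHS]big_enum_val mulr_sumr; apply: eq_bigr => j _.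
  by rewrite !mxE; ring.
by rewrite -avg_sum; apply: eq_avg => l; rewrite mulr_suml.
Qed.

Lemma theta_le l : `|theta l| <= C * D1.
Proof.
apply: le_trans (ler_norm_sum _ _ _) _; rewrite mulr_sumr; apply: ler_sum => k _.
by rewrite normrM mulrC ler_wpM2r// reg_grad.
Qed.

Lemma f_taylor x : `|f x - f a - \sum_(k < r) (x 0 k - a 0 k) * w 0 k| <= C * D1 * (C * l1dist a x ^+ 2).
Proof.
have D10 : 0 <= D1 by exact: sumr_ge0.
have C0' := ltW C0; have l20 := sqr_ge0 (l1dist a x).
under eq_bigr do rewrite gram_row -avgZ.
rewrite -avg_sum !avgB; apply: avg_le => [|l].
  by apply: mulr_ge0; exact: mulr_ge0.
have -> : theta l * eta l x - theta l * eta l a -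
   \sum_(k < r) (x 0 k - a 0 k) * (theta l * 'D_(unitvec k) (eta l) a) =
   theta l * (eta l x - eta l a - \sum_(k < r) (x 0 k - a 0 k) * 'D_(unitvec k) (eta l) a).
  by rewrite !mulrBr mulr_sumr; congr (_ - _); apply: eq_bigr => k _; rewrite mulrCA.
by rewrite normrM ler_pM// ?theta_le// reg_taylor.
Qed.

End Gram.

(* Moving from a towards the inscribed cube in two directions that differ along the signs of w makes f vary by a multiple of |w|, while the quadratic Taylor error is negligible at a small fixed scale t. *)
Lemma local_lower (C c : R) : 0 < C -> 0 < c ->
  exists (m : nat) (kappa eps : R), 0 < kappa /\ 0 < eps /\
  forall (M n : nat) (S : {set 'I_M}) (eta : nat -> 'rV[R]_r -> R) (al : nat -> 'rV[R]_r) (i j : nat),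
  (forall l, regular_fun C (eta l)) ->
  (forall x : 'rV[R]_r, (forall y : 'rV[R]_r, (forall k, `|y 0 k - x 0 k| <= m.+1%:R^-1) -> A y) ->
     forall i j : nat, exists k : nat, [/\ (k < n)%N, k != i, k != j &
        forall l, `|al k 0 l - x 0 l| <= m.+1%:R^-1]) ->
  A (al i) -> c <= smin (gram S eta (al i)) -> enorm (al i - al j) <= eps ->
  kappa * enorm (al i - al j) <= rho n S (fun i l => eta l (al i)) i j.
Proof.
move=> C0 c0.
have Ax0 : A x0 by rewrite -[x0]addr0; apply: Abox => k; rewrite mxE normr0 ltW.
have Bd0 : 0 <= Bd by exact: le_trans (normr_ge0 _) (Abd Ax0 (Ordinal r0)).
have rr0 : 0 < r%:R :> R by rewrite ltr0n.
(* Chosen so that the two sample points lie within l1 distance t * Lam of a. *)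
pose Lam := r%:R * (2 * Bd + b).
have L0 : 0 < Lam by rewrite mulr_gt0// ltr_wpDl// mulr_ge0.
(* Small enough that the Taylor errors at both points together, 2 C^2 (t Lam)^2 D1, do not exceed
   kap D1. *)
pose t := Num.min 1 (b * c / (8 * r%:R * C ^+ 2 * Lam ^+ 2)).
have C20 : 0 < C ^+ 2 by exact: exprn_gt0.
have L20 : 0 < Lam ^+ 2 by exact: exprn_gt0.
have den0 : 0 < 8 * r%:R * C ^+ 2 * Lam ^+ 2 by apply: mulr_gt0 => //; apply: mulr_gt0 => //; apply: mulr_gt0.
have t0 : 0 < t by rewrite lt_min ltr01 divr_gt0// mulr_gt0.
have t1 : t <= 1 by rewrite ge_min lexx.
have t2 : t * (8 * r%:R * C ^+ 2 * Lam ^+ 2) <= b * c.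
  by rewrite -ler_pdivlMr// ge_min lexx orbT.
(* The first-order gap is at least t b W / 2 with r W >= c D1, which is 2 kap D1; the Taylor errors
   take half of it. *)
pose kap := t * b * c / (4 * r%:R).
have kap0 : 0 < kap by rewrite divr_gt0 ?mulr_gt0.
(* With this mesh, replacing the two ideal points by sample points costs at most t b W / 4 each, out
   of an ideal gap t b W. *)
have h0 : 0 < t * b / 4 by rewrite divr_gt0 ?mulr_gt0.
have [m _ hm] := near_infty_natSinv_lt (PosNum h0).
have hm' : m.+1%:R^-1 <= t * b / 4 by apply: ltW; exact: (hm m (leqnn m)).
(* Within this radius C^2 D1 <= kap / 4, so replacing [theta] by the true difference costs at most
   kap D1 / 4. *)
have e0 : 0 < kap / (4 * C ^+ 2 * r%:R) by rewrite divr_gt0// !mulr_gt0// ?exprn_gt0.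
exists m, (kap / 4), (kap / (4 * C ^+ 2 * r%:R)); split; first by rewrite divr_gt0.
split => // M n S eta al i j reg net Ai sm De.
set a := al i in Ai sm De *; set D := a - al j in De *.
pose w : 'rV[R]_r := D *m (gram S eta a)^T.
pose theta (l : 'I_M) := \sum_(k < r) D 0 k * 'D_(unitvec k) (eta l) a.
pose f (x : 'rV[R]_r) := avg S (fun l => theta l * eta l x).
pose D1 := \sum_(k < r) `|D 0 k|.
have D1E : D1 = l1dist (al j) a by apply: eq_bigr => k _; rewrite !mxE.
have D10 : 0 <= D1 by exact: sumr_ge0.
have D1e : D1 <= r%:R * enorm D by rewrite D1E l1_le_enorm.
have eD1 : enorm D <= D1 by rewrite D1E enorm_le_l1.
pose W := \sum_(k < r) `|w 0 k|.
have W0 : 0 <= W by exact: sumr_ge0.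
have Wge : c * enorm D <= W.
  have := (smin_geP _ r0 c0).1 sm D; rewrite -/w => h.
  rewrite -[leRHS]ger0_norm// -sqrtr_sqr -[c]ger0_norm ?(ltW c0)// -sqrtr_sqr enormE.
  rewrite -sqrtrM ?sqr_ge0// ler_wsqrtr//.
  exact: le_trans h (sqn_le_l1 w).
have WD : c * D1 <= r%:R * W.
  apply: (@le_trans _ _ (c * (r%:R * enorm D))); first by rewrite ler_wpM2l// ltW.
  by rewrite mulrCA ler_wpM2l// ltW.
(* A corner of the half-size cube: its inner product with w is b / 2 times the l1 norm of w. *)
pose sg : 'rV[R]_r := \row_k (if 0 <= w 0 k then b / 2 else - (b / 2)).
have sgb k : `|sg 0 k| <= b / 2.
  by rewrite mxE; case: ifP => _; rewrite ?normrN ger0_norm// divr_ge0// ltW.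
have sgbN k : `|(- sg) 0 k| <= b / 2 by rewrite mxE normrN.
have sgw : \sum_(k < r) sg 0 k * w 0 k = b / 2 * W.
  rewrite mulr_sumr; apply: eq_bigr => k _; rewrite mxE; case: leP => h.
    by rewrite ger0_norm.
    by rewrite ltr0_norm// mulNr mulrN.
have tb0 : 0 < t * b by exact: mulr_gt0.
pose y (s : 'rV[R]_r) : 'rV[R]_r := a + t *: (x0 + s - a).
have netA (s : 'rV[R]_r) : (forall k, `|s 0 k| <= b / 2) -> exists k : nat,
    [/\ (k < n)%N, k != i, k != j & forall l, `|al k 0 l - y s 0 l| <= m.+1%:R^-1].
  move=> sb; apply: net => z hz; rewrite -[z](subrKC (y s)).
  apply: shrunk_box => //; first by rewrite t0.
  move=> k; rewrite [X in `|X|]mxE [(- y s) 0 k]mxE; apply: le_trans (hz k) _; apply: le_trans hm' _; lra.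
have [kp [kpn kpi kpj hp]] := netA _ sgb.
have [kn [knn kni knj hn]] := netA _ sgbN.
have distA (s : 'rV[R]_r) k : (forall k, `|s 0 k| <= b / 2) -> (forall l, `|al k 0 l - y s 0 l| <= m.+1%:R^-1) ->
    l1dist a (al k) <= t * Lam.
  move=> sb hk; rewrite /l1dist /Lam mulrCA -(sum_const_ord r (t * (2 * Bd + b))).
  apply: ler_sum => l _.
  have E : al k 0 l - a 0 l = (al k 0 l - y s 0 l) + t * (x0 0 l + s 0 l - a 0 l).
    by rewrite !mxE; ring.
  rewrite E; apply: le_trans (ler_normD _ _) _.
  rewrite normrM (ger0_norm (ltW t0)).
  have h1 : `|x0 0 l + s 0 l - a 0 l| <= 2 * Bd + b / 2.
    apply: le_trans (ler_normB _ _) _; have := ler_normD (x0 0 l) (s 0 l).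
    have := Abd Ax0 l; have := Abd Ai l; have := sb l; lra.
  have h2 : t * `|x0 0 l + s 0 l - a 0 l| <= t * (2 * Bd + b / 2) by rewrite ler_wpM2l// ltW.
  have h3 := hk l; have h4 := le_trans h3 hm'.
  have : 0 < t * b by rewrite mulr_gt0.
  lra.
have ftay (s : 'rV[R]_r) k : (forall k, `|s 0 k| <= b / 2) -> (forall l, `|al k 0 l - y s 0 l| <= m.+1%:R^-1) ->
    `|f (al k) - f a - \sum_(l < r) (al k 0 l - a 0 l) * w 0 l| <= C ^+ 2 * D1 * (t * Lam) ^+ 2.
  move=> sb hk; apply: le_trans (f_taylor S C0 reg a D (al k)) _.
  rewrite -/D1 expr2 (_ : C * D1 * (C * l1dist a (al k) ^+ 2) = C * C * D1 * l1dist a (al k) ^+ 2); last by ring.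
  rewrite ler_wpM2l//; first by rewrite !mulr_ge0// ltW.
  rewrite ler_pXn2r// ?nnegrE ?l1dist_ge0 ?(distA s)// mulr_ge0// ltW//.
have sumw : \sum_(l < r) (al kp 0 l - a 0 l) * w 0 l - \sum_(l < r) (al kn 0 l - a 0 l) * w 0 l >= t * b / 2 * W.
  have E : \sum_(l < r) (al kp 0 l - a 0 l) * w 0 l - \sum_(l < r) (al kn 0 l - a 0 l) * w 0 l =
     2 * t * \sum_(l < r) sg 0 l * w 0 l + (\sum_(l < r) (al kp 0 l - y sg 0 l) * w 0 l - \sum_(l < r) (al kn 0 l - y (- sg) 0 l) * w 0 l).
    rewrite mulr_sumr -!sumrB -big_split/=; apply: eq_bigr => l _.
    have yE (s : 'rV[R]_r) : y s 0 l = a 0 l + t * (x0 0 l + s 0 l - a 0 l) by rewrite !mxE.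
    have sN : (- sg) 0 l = - (sg 0 l) by rewrite mxE.
    by rewrite !yE sN; ring.
  have err (s : 'rV[R]_r) k : (forall l, `|al k 0 l - y s 0 l| <= m.+1%:R^-1) ->
      `|\sum_(l < r) (al k 0 l - y s 0 l) * w 0 l| <= t * b / 4 * W.
    move=> hk; apply: le_trans (ler_norm_sum _ _ _) _; rewrite mulr_sumr; apply: ler_sum => l _.
    by rewrite normrM ler_wpM2r// (le_trans (hk l)).
  rewrite E sgw.
  have := err _ _ hp; have := err _ _ hn.
  move: (\sum_(l < r) _) (\sum_(l < r) _) => u v.
  rewrite !ler_norml => /andP[h1 h2] /andP[h3 h4]; lra.
have fdiff : kap * D1 <= f (al kp) - f (al kn).
  have := ftay _ _ sgb hp; have := ftay _ _ sgbN hn.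
  move: sumw; move: (\sum_(l < r) (al kp 0 l - a 0 l) * w 0 l) (\sum_(l < r) (al kn 0 l - a 0 l) * w 0 l) => u v.
  rewrite !ler_norml => huv /andP[h1 h2] /andP[h3 h4].
  have h5 : 2 * (C ^+ 2 * D1 * (t * Lam) ^+ 2) <= kap * D1.
    rewrite (_ : 2 * _ = (2 * C ^+ 2 * t * Lam ^+ 2) * t * D1); last by ring.
    rewrite ler_wpM2r// /kap ler_pdivlMr ?mulr_gt0//.
    rewrite (_ : _ * (4 * r%:R) = t * (t * (8 * r%:R * C ^+ 2 * Lam ^+ 2))); last by ring.
    by rewrite -[t * b * c]mulrA ler_wpM2l// ltW.
  have h6 : 2 * (kap * D1) <= t * b / 2 * W.
    have -> : 2 * (kap * D1) = t * b / 2 * ((c * D1) / r%:R).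
      by rewrite /kap; field; rewrite gt_eqF.
    rewrite ler_wpM2l//; first by rewrite divr_ge0// mulr_ge0 ?ltW.
    by rewrite ler_pdivrMr// [W * _]mulrC.
  lra.
have D1small : C ^+ 2 * D1 <= kap / 4.
  apply: (@le_trans _ _ (C ^+ 2 * (r%:R * (kap / (4 * C ^+ 2 * r%:R))))).
    rewrite ler_wpM2l ?sqr_ge0//; apply: le_trans D1e _.
    by rewrite ler_wpM2l// ltW.
  rewrite le_eqVlt; apply/orP; left; apply/eqP; field.
  by rewrite !gt_eqF// exprn_gt0.
have final k : (k < n)%N -> k != i -> k != j -> kap / 2 * D1 <= `|f (al k)| ->
    kap / 4 * enorm D <= rho n S (fun i l => eta l (al i)) i j.
  move=> kn0 ki kj hf.
  apply: le_trans (rho_ge S (fun i l => eta l (al i)) kn0 ki kj).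
  set g := avg S _.
  have gf : `|f (al k) - g| <= C ^+ 2 * D1 * D1.
    rewrite /f /g avgB; apply: avg_le => [|l]; first by do 2! apply: mulr_ge0 => //; exact: sqr_ge0.
    rewrite -mulrBl normrM expr2.
    have -> : C * C * D1 * D1 = C * D1 ^+ 2 * C by ring.
    rewrite ler_pM ?(reg_bound (reg l))//.
    have -> : theta l - (eta l (al i) - eta l (al j)) = eta l (al j) - eta l a - \sum_(k < r) (al j 0 k - a 0 k) * 'D_(unitvec k) (eta l) a.
      rewrite /theta opprB addrC; congr (_ + _); rewrite -sumrN; apply: eq_bigr => k' _.
      by rewrite !mxE -mulNr opprB.
    by rewrite D1E l1distC; exact: (reg_taylor (reg l)).
  have gf2 : C ^+ 2 * D1 * D1 <= kap / 4 * D1 by rewrite ler_wpM2r.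

  have : `|f (al k)| <= `|f (al k) - g| + `|g|.
    by rewrite -{1}[f (al k)](subrK g); exact: ler_normD.
  have : kap / 4 * enorm D <= kap / 4 * D1 by rewrite ler_wpM2l// divr_ge0// ltW.
  move: gf gf2 hf; clear; move: (C ^+ 2 * _) => ?; lra.
(* The two values of f differ by at least kap D1, so one of them is at least half of that in
   absolute value. *)
have [hc|hc] := leP (kap / 2 * D1) `|f (al kp)|; first exact: (final kp kpn kpi kpj hc).
have [hc'|hc'] := leP (kap / 2 * D1) `|f (al kn)|; first exact: (final kn knn kni knj hc').
exfalso; move: fdiff hc hc'; clear; rewrite !ltr_norml => h0 /andP[h1 h2] /andP[h3 h4]; lra.
Qed.

End LocalBound.

(** * Asymptotic bounds in probability *)

Section Limsup.
Variable R : realType.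
Local Open Scope ereal_scope.

Lemma limn_esup_le_near (u : nat -> \bar R) (e : \bar R) :
  (\forall n \near \oo, u n <= e) -> limn_esup u <= e.
Proof.
move=> [N _ hN]; rewrite /limn_esup /limf_esup.
apply: le_trans (ereal_inf_lbound _) _; first by exists [set n | (N <= n)%N] => //; exists N.
by apply: ub_ereal_sup => _ [n Nn <-]; exact: hN.
Qed.

Lemma limn_esup_lt_near (u : nat -> \bar R) (e : \bar R) :
  limn_esup u < e -> \forall n \near \oo, u n < e.
Proof.
move=> /ereal_inf_lt[_ [A nA <-] h].
apply: filterS nA => n An; apply: le_lt_trans h.
by apply: ereal_sup_ubound; exists n.
Qed.

Lemma limn_esup_ge0 (u : nat -> \bar R) : (forall n, 0 <= u n) -> 0 <= limn_esup u.
Proof.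
move=> u0; apply: le_ereal_inf_tmp => _ [A nA <-].
have [n An] := @filter_ex _ _ _ _ nA.
by apply: le_trans (u0 n) _; apply: ereal_sup_ubound; exists n.
Qed.

Lemma cvge0_near_lt (I : Type) (F : set_system I) {FF : Filter F} (f : I -> \bar R) (e : R) :
  (0 < e)%R -> f x @[x --> F] --> 0 -> \forall x \near F, f x < e%:E.
Proof.
move=> e0 /fine_cvgP[ff /cvgrPdist_lt/(_ _ e0) h].
apply: filterS2 ff h => x fx; rewrite sub0r normrN => hx.
by rewrite -(fineK fx) lte_fin; apply: le_lt_trans hx; exact: ler_norm.
Qed.

Lemma cvge0_ge0 (I : Type) (F : set_system I) {FF : Filter F} (f : I -> \bar R) :
  (forall x, 0 <= f x) -> (forall e : R, (0 < e)%R -> \forall x \near F, f x <= e%:E) ->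
  f x @[x --> F] --> 0.
Proof.
move=> f0 h; apply/fine_cvgP; split.
  apply: filterS (h 1%R ltr01) => x hx.
  by rewrite ge0_fin_numE//; apply: le_lt_trans hx _; exact: ltry.
apply/cvgrPdist_le => e e0; apply: filterS (h e e0) => x hx.
rewrite sub0r normrN ger0_norm ?fine_ge0// -lee_fin fineK//.
by rewrite ge0_fin_numE//; apply: le_lt_trans hx _; exact: ltry.
Qed.

End Limsup.

Section LesssimP.
Context (R : realType) (d : measure_display) (T : measurableType d) (P : probability T R).

Lemma lesssimP_criterion (a b : nat -> T -> R) :
  (forall e : R, 0 < e -> exists X : R, forall x, X <= x ->
     \forall n \near \oo, (P [set w | (x * `|b n w| <= `|a n w|)%R] <= e%:E)%E) ->
  lesssimP P a b.
Proof.
move=> h; apply: cvge0_ge0 => [x|e e0].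
  by apply: limn_esup_ge0 => n; exact: measure_ge0.
have [X hX] := h e e0.
exists X; split; first exact: num_real.
by move=> x /ltW Xx; apply: limn_esup_le_near; exact: hX.
Qed.

Lemma prob_compl_cvg0 (E : nat -> set T) : (forall n, measurable (E n)) ->
  P (E n) @[n --> \oo] --> 1%E -> P (~` E n) @[n --> \oo] --> 0%E.
Proof.
move=> mE h.
under eq_cvg do rewrite probability_setC//.
have := cvgeB (isT : (1 +? - (1%E : \bar R))%E) (cvg_cst 1%E) h.
by rewrite subee// => /(_ _ _); apply.
Qed.

End LesssimP.

(** * Measurability of the pseudo-max distance, the ratios and the Gram matrices *)

Section Measurability.
Context (R : realType) (d : measure_display) (T : measurableType d).

(** Both the filter and the default may be random: the maxima and minima run over pairs with
    distinct latent values, and the minimum has a random default. *)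
Lemma measurable_bigop_if (op : R -> R -> R) (I : Type) (s : seq I) (idx : T -> R)
    (b : I -> T -> bool) (F : I -> T -> R) :
  (forall f g : T -> R, measurable_fun setT f -> measurable_fun setT g ->
     measurable_fun setT (fun w => op (f w) (g w))) ->
  measurable_fun setT idx -> (forall i, measurable_fun setT (b i)) ->
  (forall i, measurable_fun setT (F i)) ->
  measurable_fun setT (fun w => \big[op/idx w]_(i <- s | b i w) F i w).
Proof.
move=> mop midx mb mF; elim: s => [|i s ih]; first by under eq_fun do rewrite big_nil.
under eq_fun do rewrite big_cons.
by apply: measurable_fun_ifT => //; exact: mop.
Qed.

Lemma measurable_rho (n m : nat) (S : {set 'I_m}) (Y : nat -> nat -> T -> R) (i j : nat) :
  (forall i l, measurable_fun setT (Y i l)) ->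
  measurable_fun setT (fun w => rho n S (fun i l => Y i l w) i j).
Proof.
move=> mY; rewrite /rho; apply: (@measurable_bigop_if _ _ _ (fun=> 0) (fun _ _ => _)) => //.
  exact: measurable_maxr.
move=> k; apply: measurableT_comp => //; apply: measurable_funM => //.
rewrite [X in measurable_fun _ X](_ : _ = fun w => \sum_(l <- enum S) (Y i l w - Y j l w) * Y k l w).
  by apply: measurable_sum => l; apply: measurable_funM => //; exact: measurable_funB.
by apply/funext => w; rewrite big_enum.
Qed.

Variables (r : nat) (alpha : nat -> T -> 'rV[R]_r).
Hypothesis malpha : forall i k, measurable_fun setT (fun w => alpha i w 0 k).

Lemma measurable_enorm (i j : nat) : measurable_fun setT (fun w => enorm (alpha i w - alpha j w)).
Proof.
rewrite [X in measurable_fun _ X](_ : _ = fun w => (\sum_k (alpha i w 0 k - alpha j w 0 k) ^+ 2) `^ 2^-1).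
  apply: (measurableT_comp (measurable_powR _)); apply: measurable_sum => k.
  by apply: measurable_funX; exact: measurable_funB.
apply/funext => w; rewrite powR12_sqrt; last by apply: sumr_ge0 => k _; exact: sqr_ge0.
by congr Num.sqrt; apply: eq_bigr => k _; rewrite !mxE.
Qed.

Lemma enorm0 (x y : 'rV[R]_r) : (enorm (x - y) == 0) = (x == y).
Proof.
rewrite enormE sqrtr_eq0; apply/idP/eqP => [h|->].
  by apply/eqP; rewrite -subr_eq0; apply/eqP/sqn_eq0/eqP; rewrite eq_le h sqn_ge0.
by rewrite subrr /sqn big1// => k _; rewrite mxE expr0n.
Qed.

Lemma measurable_distinct (i j : nat) : measurable_fun setT (fun w => alpha i w != alpha j w).
Proof.
under eq_fun do rewrite -enorm0.
by apply: measurable_neg; apply: measurable_fun_eqr => //; exact: measurable_enorm.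
Qed.

Variables (eta : nat -> T -> 'rV[R]_r -> R).
Hypotheses (meta : forall l a, measurable_fun setT (fun w => eta l w a))
  (ceta : forall l w, continuous (eta l w)).

Lemma measurable_ratio n m (S : {set 'I_m}) i j : measurable_fun setT (fun w =>
  rho n S (fun i l => eta l w (alpha i w)) i j / enorm (alpha i w - alpha j w) `^ 1).
Proof.
have H x : (x `^ 1)^-1 = (x `^ 1) `^ (-1) :> R by rewrite powR_inv1// powR_ge0.
under eq_fun do rewrite H.
apply: measurable_funM.
  apply: (@measurable_rho n m S (fun i l w => eta l w (alpha i w))) => i0 l.
  exact: measurable_eval.
do 2! apply: (measurableT_comp (measurable_powR _)).
exact: measurable_enorm.
Qed.

Hypotheses (deta : forall l w x k, derivable (eta l w) x (unitvec k))
  (cdeta : forall l w k, continuous ('D_(unitvec k) (eta l w))).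

Lemma measurable_gram m (S : {set 'I_m}) i k k' :
  measurable_fun setT (fun w => gram S (eta ^~ w) (alpha i w) k k').
Proof.
have mD l k0 : measurable_fun setT (fun w => 'D_(unitvec k0) (eta l w) (alpha i w)).
  apply: (@measurable_eval _ _ _ _ (fun w => 'D_(unitvec k0) (eta l w))) => //.
  by move=> x; apply: measurable_derive.
under eq_fun do rewrite !mxE.
apply: measurable_funM => //; apply: measurable_sum => j.
by under eq_fun do rewrite !mxE; exact: measurable_funM.
Qed.

End Measurability.

Lemma regular_of_Cm (R : realType) (r mbar : nat) (f : 'rV[R]_r -> R) (C : R) :
  (2 <= mbar)%N -> Cm mbar f -> 0 <= C ->
  (forall (s : seq 'I_r) x, (size s <= mbar)%N -> `|pderiv s f x| <= C) -> regular_fun C f.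
Proof.
move=> m2 cm C0 bd.
have d1 y k : derivable f y (unitvec k) by have [_] := cm [::] (leq0n _); apply; exact: ltn_trans m2.
have d2 k y k' : derivable ('D_(unitvec k) f) y (unitvec k').
  by have [_] := cm [:: k] (ltnW m2); exact.
have b1 x k : `|'D_(unitvec k) f x| <= C by apply: (bd [:: k]); exact: ltnW.
split => //.
- by move=> x; exact: (bd [::]).
- by move=> x y; apply: lipschitz_partial.
- by move=> a x; apply: taylor2 => // k y k'; apply: (bd [:: k'; k]).
Qed.

(** * The matching ratios *)

Section MatchingBounds.
Context (R : realType) (d : measure_display) (T : measurableType d) (P : probability T R).
Variables (r : nat) (p : nat -> nat) (alpha : nat -> T -> 'rV[R]_r)
  (eta : nat -> T -> 'rV[R]_r -> R) (A : set 'rV[R]_r) (Rdag : forall n : nat, {set 'I_(p n)})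
  (C c : R).
Hypotheses (C0 : 0 < C) (reg : forall l w, regular_fun C (eta l w)).

Let H w i l := eta l w (alpha i w).

(** The Lipschitz bound is deterministic, so the event is empty once x exceeds it; the added 1 makes
    the inequality strict. *)
Lemma ratio_upper : lesssimP P
  (fun n w => \big[Num.max/0]_(i < n) \big[Num.max/0]_(j < n | alpha i w != alpha j w)
     (rho n (Rdag n) (H w) i j / enorm (alpha i w - alpha j w) `^ 1)) (fun _ _ => 1).
Proof.
apply: lesssimP_criterion => e e0; exists (C * (r%:R * C) + 1) => x xC.
apply: nearW => n; rewrite [X in P X](_ : _ = set0) ?measure0 ?lee_fin ?ltW//.
apply/seteqP; split => w //=; rewrite normr1 mulr1 => h.
have C0' := ltW C0; have C1 : 0 <= C * (r%:R * C) by rewrite !mulr_ge0.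
suff : `|\big[Num.max/0]_(i < n) \big[Num.max/0]_(j < n | alpha i w != alpha j w)
     (rho n (Rdag n) (H w) i j / enorm (alpha i w - alpha j w) `^ 1)| <= C * (r%:R * C).
  by move: h xC; lra.
rewrite ger0_norm; last exact: bigmax_ge_id.
apply: bigmax_le => // i _; apply: bigmax_le => // j ij.
have d0 : 0 < enorm (alpha i w - alpha j w) by rewrite lt_neqAle eq_sym enorm0 ij sqrtr_ge0.
rewrite powRr1 ?sqrtr_ge0// ler_pdivrMr//; exact: (@rho_lipschitz R r C n (p n) (Rdag n) (eta ^~ w) (alpha ^~ w) i j (ltW C0) (reg ^~ w)).
Qed.

Hypotheses (r0 : (0 < r)%N)
  (malpha : forall i k, measurable_fun setT (fun w => alpha i w 0 k))
  (cA : compact A) (vA : convex_set A)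
  (ind : indep_family P (fun i => sigma_rv (alpha i)))
  (dens : density_on P alpha A).
Hypotheses (meta : forall l a, measurable_fun setT (fun w => eta l w a))
  (ceta : forall l w, continuous (eta l w))
  (deta : forall l w x k, derivable (eta l w) x (unitvec k))
  (cdeta : forall l w k, continuous ('D_(unitvec k) (eta l w))).
Hypothesis matching : forall eps : R, 0 < eps ->
      limn_esup (fun n => P [set w | exists i j : 'I_n,
          rho n (Rdag n) (fun i0 l => eta l w (alpha i0 w)) i j < D /\
          eps < enorm (alpha i w - alpha j w)]) @[D --> 0^'+] --> 0%E.
Hypotheses (c0 : 0 < c)
  (spread : P [set w | forall i : 'I_n, c <= smin (gram (Rdag n) (eta ^~ w) (alpha i w))]
        @[n --> \oo] --> 1%E).

Let mH i l : measurable_fun setT (fun w => H w i l).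
Proof. exact: measurable_eval. Qed.

Let mrho n i j : measurable_fun setT (fun w => rho n (Rdag n) (H w) i j).
Proof. exact: (@measurable_rho _ _ _ _ _ _ (fun i l w => H w i l)). Qed.

Let far n D eps := [set w | exists i j : 'I_n,
  rho n (Rdag n) (H w) i j < D /\ eps < enorm (alpha i w - alpha j w)].

Let mfar n D eps : measurable (far n D eps).
Proof.
rewrite (_ : far n D eps = \bigcup_(ij in [set: 'I_n * 'I_n])
  ([set w | rho n (Rdag n) (H w) ij.1 ij.2 < D] `&` [set w | eps < enorm (alpha ij.1 w - alpha ij.2 w)])).
  apply: countable_bigcupT_measurable => // ij; apply: measurableI.
    by rewrite -[X in measurable X]setTI; apply: measurable_fun_ltr.
  by rewrite -[X in measurable X]setTI; apply: measurable_fun_ltr => //; exact: measurable_enorm.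
apply/seteqP; split => w /=; first by move=> [i [j ij]]; exists (i, j).
by move=> [[i j] _ ij]; exists i, j.
Qed.

Let well n := [set w | forall i : 'I_n, c <= smin (gram (Rdag n) (eta ^~ w) (alpha i w))].

Let mwell n : measurable (well n).
Proof.
rewrite (_ : well n = \bigcap_(i in [set: 'I_n]) [set w | c <= smin (gram (Rdag n) (eta ^~ w) (alpha i w))]).
  apply: fin_bigcap_measurable => // i _; apply: measurable_smin_ge => // k k'.
  exact: measurable_gram.
by apply/seteqP; split => w /= h i; [move=> _|]; exact: h.
Qed.

(** The exceptional event collects a null set off the support and four events of probability below e
    / 4: far pairs at small distance [rho], a badly conditioned Gram matrix, and the failure of two
    nets. *)
Lemma ratio_lower_event (e : R) : 0 < e -> exists2 c1 : R, 0 < c1 &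
  \forall n \near \oo, exists B : set T, [/\ measurable B, (P B <= e%:E)%E &
    forall w, ~ B w ->
     (exists i j : 'I_n, alpha i w != alpha j w) /\
     (forall i j : 'I_n, alpha i w != alpha j w ->
       c1 <= rho n (Rdag n) (H w) i j / enorm (alpha i w - alpha j w) `^ 1)].
Proof.
move=> e0.
have [N [mN PN AN]] := as_in_support malpha cA dens.
have [x0 [b [b0 Ab]]] := body_box r0 vA dens.
have [Bd hBd] := compact_coord_bounded cA.
have [m [kap [eps [kap0 [eps0 low]]]]] := local_lower r0 vA b0 Ab hBd C0 c0.
have [Bad [mBad PBad hBad]] := sample_net r0 malpha cA ind dens m.
have b4 : 0 < b / 4 by rewrite divr_gt0.
(* This second net only produces two distinct sample points, close to x0 and to x0 shifted by 3 b /
   4 in every coordinate; a mesh below b / 4 keeps them apart and inside the cube. *)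
have [m2 _ hm2] := near_infty_natSinv_lt (PosNum b4).
have {}hm2 : m2.+1%:R^-1 < b / 4 by exact: (hm2 m2 (leqnn m2)).
have [Bad2 [mBad2 PBad2 hBad2]] := sample_net r0 malpha cA ind dens m2.
have e4 : 0 < e / 4 by rewrite divr_gt0.
have [D [D0 hD]] : exists D : R, 0 < D /\ \forall n \near \oo, (P (far n D eps) < (e / 4)%:E)%E.
  have /(_ _) h := cvge0_near_lt e4 (matching eps0).
  have [D [h1 h2]] := filter_ex (filterI h (nbhs_right_gt (0 : R))).
  by exists D; split => //; exact: limn_esup_lt_near.
(* A positive bound for the diameter of the support: a pair farther apart than eps has [rho] at
   least D, hence a ratio at least D / Dm. *)
pose Dm := `|r%:R * (2 * Bd)| + 1.
have Dm0 : 0 < Dm by rewrite ltr_wpDl.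
exists (Num.min kap (D / Dm)); first by rewrite lt_min kap0 divr_gt0.
have W := prob_compl_cvg0 mwell spread.
have /(_ _) w1 := cvge0_near_lt e4 W; have /(_ _) w2 := cvge0_near_lt e4 PBad2.
have /(_ _) w3 := cvge0_near_lt e4 PBad.
apply: filterS2 (filterI w1 w2) (filterI w3 hD) => n [h1 h2] [h3 h4].
exists (N `|` (far n D eps `|` (~` well n `|` (Bad2 n `|` Bad n)))); split.
- by repeat (apply: measurableU => //); exact: measurableC.
- have mw := measurableC (mwell n).
  have s1 := @measureU2 _ _ _ P _ _ mN (measurableU _ _ (mfar n D eps) (measurableU _ _ mw (measurableU _ _ (mBad2 n) (mBad n)))).
  have s2 := @measureU2 _ _ _ P _ _ (mfar n D eps) (measurableU _ _ mw (measurableU _ _ (mBad2 n) (mBad n))).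
  have s3 := @measureU2 _ _ _ P _ _ mw (measurableU _ _ (mBad2 n) (mBad n)).
  have s4 := @measureU2 _ _ _ P _ _ (mBad2 n) (mBad n).
  apply: (le_trans s1); rewrite [X in (X + _)%E](PN : _ = 0%E) add0e; apply: (le_trans s2).
  have -> : e%:E = ((e / 4)%:E + ((e / 4)%:E + ((e / 4)%:E + (e / 4)%:E)))%E.
    by rewrite -!EFinD; congr EFin; field.
  apply: leeD; first exact: ltW.
  apply: (le_trans s3); apply: leeD; first exact: ltW.
  by apply: (le_trans s4); apply: leeD; exact: ltW.
move=> w /not_orP[wN /not_orP[wfar /not_orP[/contrapT wwell /not_orP[wBad2 wBad]]]]; split.
- have net2 := hBad2 n w wBad2.
  have [|k1 [k1n _ _ hk1]] := net2 x0 _ 0%N 0%N.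
    move=> y hy; rewrite -[y](subrKC x0); apply: Ab => k; rewrite !mxE.
    apply: le_trans (hy k) _; apply: le_trans (ltW hm2) _; lra.
  pose s : 'rV[R]_r := const_mx (3 * b / 4).
  have [|k2 [k2n _ _ hk2]] := net2 (x0 + s) _ 0%N 0%N.
    move=> y hy; rewrite -[y](subrKC x0); apply: Ab => k.
    have := hy k; rewrite !mxE; move: hm2; move: (m2.+1%:R^-1) => z hh; rewrite !ler_norml => /andP[h5 h6].
    by apply/andP; split; lra.
  exists (Ordinal k1n), (Ordinal k2n); apply/eqP => /= E.
  have := hk1 (Ordinal r0); have := hk2 (Ordinal r0); rewrite E !mxE !ler_norml.
  move=> /andP[h5 h6] /andP[h7 h8]; move: hm2 h5 h6 h7 h8 b0.
  by move: (m2.+1%:R^-1) (alpha _ _ _ _) (x0 _ _) => *; lra.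
move=> i j ij.
have d0 : 0 < enorm (alpha i w - alpha j w) by rewrite lt_neqAle eq_sym enorm0 ij sqrtr_ge0.
rewrite powRr1 ?sqrtr_ge0// ler_pdivlMr//.
have [de|de] := leP (enorm (alpha i w - alpha j w)) eps.
  apply: le_trans (low _ n (Rdag n) (eta ^~ w) (alpha ^~ w) i j (reg ^~ w) _ (AN w wN i) (wwell i) de).
    by rewrite ler_wpM2r ?sqrtr_ge0// ge_min lexx.
  exact: hBad.
have DH : D <= rho n (Rdag n) (H w) i j.
  by rewrite leNgt; apply/negP => hlt; apply: wfar; exists i, j.
apply: le_trans DH; apply: (@le_trans _ _ (D / Dm * enorm (alpha i w - alpha j w))).
  by rewrite ler_wpM2r ?sqrtr_ge0// ge_min lexx orbT.
rewrite -mulrA -[leRHS]mulr1 ler_wpM2l ?(ltW D0)// mulrC ler_pdivrMr// mul1r.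
apply: le_trans (enorm_le_l1 _ _) _; rewrite /Dm.
apply: (@le_trans _ _ (r%:R * (2 * Bd))); last by have := ler_norm (r%:R * (2 * Bd)); lra.
rewrite -sum_const_ord; apply: ler_sum => k _; apply: le_trans (ler_normB _ _) _.
by have := hBd _ (AN w wN i) k; have := hBd _ (AN w wN j) k; lra.
Qed.

(** The minimum takes the maximum mx as default, so mx must also be at least c1. Without two
    distinct latent values it would be 0, hence the existence claim in [ratio_lower_event]. *)
Lemma ratio_lower : lesssimP P (fun _ _ => 1)
  (fun n w =>
     let mx := \big[Num.max/0]_(i < n) \big[Num.max/0]_(j < n | alpha i w != alpha j w)
       (rho n (Rdag n) (H w) i j / enorm (alpha i w - alpha j w) `^ 1) in
     \big[Num.min/mx]_(i < n) \big[Num.min/mx]_(j < n | alpha i w != alpha j w)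
       (rho n (Rdag n) (H w) i j / enorm (alpha i w - alpha j w) `^ 1)).
Proof.
apply: lesssimP_criterion => e e0; have [c1 c10 hc1] := ratio_lower_event e0.
exists (2 / c1) => x xc; apply: filterS hc1 => n [B [mB PB hB]].
apply: le_trans PB; apply: le_measure; rewrite ?inE//.
  rewrite -[X in measurable X]setTI; apply: measurable_fun_ler => //.
  apply: measurable_funM => //; apply: measurableT_comp => //.
  have mmx : measurable_fun setT (fun w => \big[Num.max/0]_(i < n) \big[Num.max/0]_(j < n | alpha i w != alpha j w)
       (rho n (Rdag n) (H w) i j / enorm (alpha i w - alpha j w) `^ 1)).
    apply: (@measurable_bigop_if _ _ _ _ _ _ (fun=> 0) (fun _ _ => true)) => //; first exact: measurable_maxr.
    move=> i; apply: (@measurable_bigop_if _ _ _ _ _ _ (fun=> 0)) => //; first exact: measurable_maxr.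
      by move=> j; exact: measurable_distinct.
    by move=> j; exact: measurable_ratio.
  apply: (@measurable_bigop_if _ _ _ _ _ _ _ (fun _ _ => true)) => //; first exact: measurable_minr.
  move=> i; apply: measurable_bigop_if => //; first exact: measurable_minr.
    by move=> j; exact: measurable_distinct.
  by move=> j; exact: measurable_ratio.
move=> w /=; apply: contraPP => /hB[[i0 [j0 ij0]] h].
set mx := \big[Num.max/0]_(i < n) _; set mn := \big[Num.min/mx]_(i < n) _.
have mxc : c1 <= mx.
  apply/bigmax_geP; right; exists i0 => //; apply/bigmax_geP; right; exists j0 => //; exact: h.
have mnc : c1 <= mn by apply: le_bigmin => // i _; apply: le_bigmin => // j; exact: h.
rewrite normr1 => h1; have : x * c1 <= 1.
  apply: le_trans h1; rewrite ger0_norm ?(le_trans _ mnc) ?(ltW c10)// ler_wpM2l//.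
  by apply: le_trans xc; rewrite divr_ge0// ltW.
by move: xc; rewrite ler_pdivrMr//; lra.
Qed.

End MatchingBounds.

(** * Noise *)

Section Rates.
Variable R : realType.

(** The rate condition is raised to the power nu / 2: the exponent of N becomes 2, that of l becomes
    nu / 2 - 1, and one more factor l completes (l / p)^(nu / 2). *)
Lemma powR_nu_rate (nu N l p C1 : R) : 0 < nu -> 1 < N -> 0 < l -> 0 < p -> 0 <= C1 ->
  N `^ (4 / nu) * l `^ ((nu - 2) / nu) / p <= C1 ->
  Num.sqrt (l / p) `^ nu <= C1 `^ (nu / 2) * l / N ^+ 2.
Proof.
move=> nu0 N1 l0 p0 C10 h.
have N0 : 0 < N by lra.
have n2 : 0 <= nu / 2 by rewrite divr_ge0// ltW.
have p'0 : 0 <= p^-1 by rewrite invr_ge0 ltW.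
have nu0' : nu != 0 by rewrite gt_eqF.
have N0' := ltW N0; have l0' := ltW l0; have p0' := ltW p0.
have lp0 : 0 <= l / p by rewrite divr_ge0.
have -> : Num.sqrt (l / p) `^ nu = (l / p) `^ (nu / 2).
  by rewrite -powR12_sqrt// -powRrM [2^-1 * _]mulrC.
have := ge0_ler_powR n2 _ _ h; rewrite !nnegrE => /(_ _ _).
rewrite powRM ?mulr_ge0 ?powR_ge0// powRM ?powR_ge0// -!powRrM.
rewrite (_ : 4 / nu * (nu / 2) = 2%:R); last by field.
rewrite (_ : (nu - 2) / nu * (nu / 2) = nu / 2 - 1); last by field.
rewrite powR_mulrn// powRM// => /(_ isT C10) hh.
have -> : l `^ (nu / 2) = l `^ (nu / 2 - 1) * l.
  by rewrite -{3}[l]powRr1// -powRD ?subrK//; apply/implyP => _; rewrite gt_eqF.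
rewrite ler_pdivlMr ?exprn_gt0//.
apply: (@le_trans _ _ ((N ^+ 2 * l `^ (nu / 2 - 1) * p^-1 `^ (nu / 2)) * l)).
  by rewrite le_eqVlt; apply/orP; left; apply/eqP; ring.
by rewrite ler_wpM2r// ltW.
Qed.

(** Since lam^2 L >= c l, the condition on x pushes the exponent below -4 l, which gives N^-4. In
    the Chebyshev term the factor lam^nu supplies N^-2, and 576 is the square of the 24 in the
    threshold. *)
Lemma tail_bound_rate (nu M lam L N l p c C2 x : R) : 0 < nu -> 0 <= M -> 0 < lam -> 1 < N ->
  l = ln N -> 0 < l -> l <= N -> 0 < p -> 0 < c -> 0 <= C2 -> lam ^+ 2 * p = l -> c * p <= L ->
  lam `^ nu <= C2 * l / N ^+ 2 -> 24 * (4 / c + 2 + (C2 + 2) * M) <= x ->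
  tail_bound (2 + nu) M lam (x * lam * L / 24) L <=
  N ^- 4 + 576 * (C2 * M / c + C2 ^+ 2 * M ^+ 2) / x ^+ 2 / N ^+ 2.
Proof.
move=> nu0 M0 lam0 N1 lE l0 lN p0 c0 C20 lp cL lnu xge.
have N0 : 0 < N by lra.
have cp0 : 0 < c * p by rewrite mulr_gt0.
have L0 : 0 < L by exact: lt_le_trans cL.
have clL : c * l <= lam ^+ 2 * L by rewrite -lp mulrCA ler_wpM2l// sqr_ge0.
have lq : lam `^ (2 + nu) = lam ^+ 2 * lam `^ nu.
  by rewrite powRD ?(gt_eqF lam0) ?implybT// (powR_mulrn 2 (ltW lam0)).
have lq1 : lam `^ (2 + nu - 1) = lam * lam `^ nu.
  rewrite (_ : 2 + nu - 1 = 1 + nu); last by ring.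
  by rewrite powRD ?(gt_eqF lam0) ?implybT// (powRr1 (ltW lam0)).
have lq2 : 2 + nu - 2 = nu by ring.
set z := lam `^ nu in lnu lq lq1 *.
have z0 : 0 <= z by exact: powR_ge0.
have x0 : 0 < x.
  apply: lt_le_trans xge; apply: mulr_gt0 => //; apply: ltr_wpDr; first by rewrite mulr_ge0// addr_ge0.
  by apply: addr_gt0 => //; exact: divr_gt0.
have lN2 : l / N ^+ 2 <= 1.
  rewrite ler_pdivrMr ?exprn_gt0// mul1r; apply: le_trans lN _.
  by rewrite expr2 ler_peMl// ltW.
have zC : z <= C2 by apply: le_trans lnu _; rewrite -mulrA ler_piMr.
rewrite /tail_bound lq lq1 lq2; apply: lerD.
  have -> : N ^- 4 = expR (- (4 * l)).
    by rewrite expRN lE (expRM_natl 4) lnK ?posrE.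
  rewrite ler_expR.
  have -> : - (lam * (x * lam * L / 24)) + L * (2 * lam ^+ 2 + (lam ^+ 2 * z + 2 * lam ^+ 2) * M) =
     lam ^+ 2 * L * (2 + (z + 2) * M - x / 24) by field.
  have h1 : 2 + (z + 2) * M - x / 24 <= - (4 / c).
    have : (z + 2) * M <= (C2 + 2) * M by rewrite ler_wpM2r// lerD2r.
    by move: xge; move: (4 / c) ((C2 + 2) * M) ((z + 2) * M) => a1 a2 a3; lra.
  apply: (@le_trans _ _ (lam ^+ 2 * L * - (4 / c))).
    by rewrite ler_wpM2l// mulr_ge0 ?sqr_ge0// ltW.
  rewrite mulrN lerN2 mulrA ler_pdivlMr//; move: clL; move: (lam ^+ 2 * L) => a; lra.
have y20 : 0 < (x * lam * L / 24) ^+ 2 by rewrite exprn_gt0// divr_gt0// !mulr_gt0.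
rewrite ler_pdivrMr//.
have -> : 576 * (C2 * M / c + C2 ^+ 2 * M ^+ 2) / x ^+ 2 / N ^+ 2 * (x * lam * L / 24) ^+ 2 =
   (C2 * M / c / N ^+ 2 * (lam ^+ 2 * L)) * L + (C2 / N) ^+ 2 * lam ^+ 2 * L ^+ 2 * M ^+ 2.
  by field; rewrite !gt_eqF.
apply: lerD.
  rewrite mulrC ler_wpM2r//; first exact: ltW.
  apply: (@le_trans _ _ (C2 * M / c / N ^+ 2 * (c * l))).
    have -> : C2 * M / c / N ^+ 2 * (c * l) = C2 * l / N ^+ 2 * M by field; rewrite !gt_eqF.
    by rewrite ler_wpM2r.
  by rewrite ler_wpM2l// !divr_ge0 ?mulr_ge0 ?exprn_ge0// ltW.
have -> : L ^+ 2 * (lam * z * M) ^+ 2 = z ^+ 2 * (lam ^+ 2 * L ^+ 2 * M ^+ 2) by ring.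
have -> : (C2 / N) ^+ 2 * lam ^+ 2 * L ^+ 2 * M ^+ 2 = (C2 / N) ^+ 2 * (lam ^+ 2 * L ^+ 2 * M ^+ 2) by ring.
rewrite ler_wpM2r//.
  by apply: mulr_ge0; [apply: mulr_ge0|]; exact: sqr_ge0.
(* In the squared term lam^nu <= C2 / N is enough, which follows from l <= N. *)
have CN0 : 0 <= C2 / N by rewrite divr_ge0// ltW.
rewrite ler_pXn2r ?nnegrE//.
apply: le_trans lnu _; rewrite -mulrA ler_wpM2l// ler_pdivrMr ?exprn_gt0//.
by rewrite expr2 mulKf ?gt_eqF.
Qed.

End Rates.

Section SigmaF.
Context (R : realType) (d : measure_display) (T : measurableType d).
Variables (r : nat) (alpha : nat -> T -> 'rV[R]_r) (eta : nat -> T -> 'rV[R]_r -> R).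
Local Notation F := (sigmaF alpha eta).

Lemma sigma_algebra_sigmaF : sigma_algebra setT F.
Proof. exact: smallest_sigma_algebra. Qed.

Lemma sigmaF_measurable : (forall i k, measurable_fun setT (fun w => alpha i w 0 k)) ->
  (forall l a, measurable_fun setT (fun w => eta l w a)) -> F `<=` measurable.
Proof.
move=> ma me; apply: sub_gen => _ [[i [k [B [mB ->]]]]|[l [a [B [mB ->]]]]].
  by rewrite -[X in measurable X]setTI; exact: ma.
by rewrite -[X in measurable X]setTI; exact: me.
Qed.

Lemma mwrt_sigmaF_eval i l : (forall l w, continuous (eta l w)) ->
  mwrt F (fun w => eta l w (alpha i w)).
Proof.
move=> ceta; apply: (@measurable_eval _ (g_sigma_algebraType F)) => //.
  move=> x _ B mB; rewrite setTI; apply: sub_sigma_algebra; apply: sub_sigma_algebra.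
  by right; exists l, x, B.
move=> k _ B mB; rewrite setTI; apply: sub_sigma_algebra; apply: sub_sigma_algebra.
by left; exists i, k, B.
Qed.

End SigmaF.

(** * Uniform control of the conditional moments *)

Section MomentEvent.
Context (R : realType) (d : measure_display) (T : measurableType d) (P : probability T R).
Variables (F : set (set T)) (g : nat -> nat -> T -> \bar R) (v : nat -> nat -> T -> \bar R).
Hypotheses (sF : sigma_algebra setT F) (Fm : F `<=` measurable)
  (gv : forall i l, cexp_version P F (v i l) (g i l))
  (gfin : {ae P, forall w, exists M : R, forall i l, (g i l w <= M%:E)%E}).

Definition moment_event (K : R) : set T := [set w | forall i l, (g i l w <= K%:E)%E].

Lemma moment_event_F K : F (moment_event K).
Proof.
have <- : <<s F>> = F by exact: sigma_algebra_id.
rewrite (_ : moment_event K = \bigcap_i \bigcap_l (g i l @^-1` `]-oo, K%:E])).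
  apply: (@bigcapT_measurable _ (g_sigma_algebraType F)) => i.
  apply: (@bigcapT_measurable _ (g_sigma_algebraType F)) => l.
  by apply: sub_sigma_algebra; apply: (gv i l).1; exact: emeasurable_itv.
apply/seteqP; split => w /=; first by move=> h i _ l _; rewrite /= in_itv /=; exact: h.
by move=> h i l; have := h i I l I; rewrite /= in_itv.
Qed.

(** As K runs through the naturals the complements decrease to a null set, because almost surely one
    bound serves all entries. *)
Lemma moment_event_prob (e : R) : 0 < e -> exists K : nat, (P (~` moment_event K%:R) <= e%:E)%E.
Proof.
move=> e0.
pose G (k : nat) := ~` moment_event k%:R.
have mG k : measurable (G k) by apply: measurableC; apply: Fm; exact: moment_event_F.
have P0 : P (\bigcap_k G k) = 0%E.
  apply: (measure_negligible (bigcapT_measurable mG)); apply: negligibleS gfin => w /= h [M hM].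
  have [k hk] : exists k : nat, M <= k%:R.
    by exists (Num.truncn `|M|).+1; apply: le_trans (ler_norm M) _; apply: ltW; exact: truncnS_gt.
  apply: (h k I) => i l; apply: le_trans (hM i l) _; by rewrite lee_fin.
have nG : nonincreasing_seq G.
  move=> k k' kk'; apply/subsetPset; apply: subsetC => w h i l.
  by apply: le_trans (h i l) _; rewrite lee_fin ler_nat.
have G0 : (P (G 0%N) < +oo)%E by exact: (le_lt_trans (probability_le1 P (mG 0%N)) (ltry 1)).
have H : (P \o G) n @[n --> \oo] --> 0%E.
  have h := @nonincreasing_cvg_mu _ _ _ P G G0 mG (bigcapT_measurable mG) nG.
  have E : P (\bigcap_n G n) = 0%E := P0.
  by move: h; rewrite [X in _ --> X]E.
have /(_ _) [K _ hK] := cvge0_near_lt e0 H.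
by exists K; apply: ltW; exact: (hK K (leqnn K)).
Qed.

Lemma moment_event_bound K i l A : 0 <= K -> F A ->
  (\int[P]_(w in A `&` moment_event K) v i l w <= K%:E * P A)%E.
Proof.
move=> K0 FA; have [mg [g0 gE]] := gv i l.
have FAG : F (A `&` moment_event K).
  have gF : <<s F>> = F by exact: sigma_algebra_id.
  rewrite -gF; apply: (@measurableI _ (g_sigma_algebraType F)); rewrite [X in X _]gF => //.
  exact: moment_event_F.
have mA := Fm FA; have mAG := Fm FAG.
rewrite -gE//; apply: (@le_trans _ _ (\int[P]_(w in A `&` moment_event K) K%:E)%E).
  apply: ge0_le_integral => //.
  - by apply: (@measurable_funTS _ _ _ _ _ (g i l)) => _ B mB; rewrite setTI; apply: Fm; exact: mg.
  - by move=> w [_ /= h]; exact: h.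
by rewrite integral_cst// lee_wpmul2l ?lee_fin//; apply: le_measure; rewrite ?inE//; exact: subIsetl.
Qed.

End MomentEvent.

(** * From sums of noise to the pseudo-max distance *)

Section NoiseFree.
Variables (R : realType) (M : nat) (S : {set 'I_M}).

Definition rows : seq nat := [seq val l | l <- enum S].

Lemma rows_uniq : uniq rows.
Proof. by rewrite map_inj_uniq ?enum_uniq//; exact: val_inj. Qed.

Lemma size_rows : size rows = #|S|.
Proof. by rewrite size_map -cardE. Qed.

Lemma sum_rows (f : nat -> R) : \sum_(l <- rows) f l = \sum_(l in S) f l.
Proof. by rewrite big_map big_enum. Qed.

Hypothesis S0 : (0 < #|S|)%N.

Lemma rho_le_add (n : nat) (X Y : nat -> nat -> R) (i j : nat) (B : R) : 0 <= B ->
  (forall k, (k < n)%N -> k != i -> k != j ->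
    `|\sum_(l in S) ((X i l - X j l) * X k l - (Y i l - Y j l) * Y k l)| <= B * #|S|%:R) ->
  rho n S X i j <= rho n S Y i j + B.
Proof.
move=> B0 h; apply: rho_le => [|k kn ki kj].
  by rewrite addr_ge0//; exact: bigmax_ge_id.
have := rho_ge S Y kn ki kj.
have : `|avg S (fun l => (X i l - X j l) * X k l) - avg S (fun l => (Y i l - Y j l) * Y k l)| <= B.
  by rewrite avgB /avg normrM ger0_norm ?invr_ge0// mulrC ler_pdivrMr ?ltr0n//; exact: h.
set a := avg S _; set b := avg S _ => h1 h2.
have : `|a| <= `|a - b| + `|b| by rewrite -{1}[a](subrK b); exact: ler_normD.
by move: h1 h2; lra.
Qed.

(** Each of the columns i and j contributes three sums against column k, one of noise with noise and
    two of noise with signal; hence the 6. Excluding k = i and k = j keeps the sums of squared noise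
    out, which is why [rho_0] is 0. *)
Lemma rho_noise (n : nat) (H u : nat -> nat -> R) (i j : nat) (y : R) : (i < n)%N -> (j < n)%N ->
  0 <= y ->
  (forall i k, (i < n)%N -> (k < n)%N -> i != k -> `|\sum_(l in S) u i l * u k l| <= y) ->
  (forall i k, (i < n)%N -> (k < n)%N -> i != k -> `|\sum_(l in S) H i l * u k l| <= y) ->
  `|rho n S (fun i l => H i l + u i l) i j - rho n S H i j| <= 6 * y / #|S|%:R.
Proof.
move=> iN jN y0 uu Hu.
pose t a k := \sum_(l in S) ((H a l + u a l) * (H k l + u k l) - H a l * H k l).
have tE a k : t a k = \sum_(l in S) u a l * u k l + \sum_(l in S) H a l * u k l + \sum_(l in S) H k l * u a l.
  by rewrite -!big_split/=; apply: eq_bigr => l _; ring.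
have tb a k : (a < n)%N -> (k < n)%N -> k != a -> `|t a k| <= 3 * y.
  move=> an kn ka; have ak : a != k by rewrite eq_sym.
  rewrite tE; apply: le_trans (ler_normD _ _) _.
  have := ler_normD (\sum_(l in S) u a l * u k l) (\sum_(l in S) H a l * u k l).
  have := uu a k an kn ak; have := Hu a k an kn ak; have := Hu k a kn an ka; lra.
have B0 : 0 <= 6 * y / #|S|%:R by rewrite divr_ge0// mulr_ge0.
have SS : 6 * y / #|S|%:R * #|S|%:R = 6 * y by rewrite divfK// pnatr_eq0 -lt0n.
have key k : (k < n)%N -> k != i -> k != j -> `|t i k - t j k| <= 6 * y.
  move=> kn ki kj; apply: le_trans (ler_normB _ _) _.
  by have := tb i k iN kn ki; have := tb j k jN kn kj; lra.
rewrite ler_norml; apply/andP; split.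
  rewrite lerBrDl lerBlDr; apply: rho_le_add => // k kn ki kj.
  rewrite SS -normrN; apply: le_trans (key k kn ki kj); rewrite /t -sumrB -sumrN le_eqVlt.
  by apply/orP; left; apply/eqP; congr `|_|; apply: eq_bigr => l _; ring.
rewrite lerBlDl; apply: rho_le_add => // k kn ki kj.
rewrite SS; apply: le_trans (key k kn ki kj); rewrite /t -sumrB le_eqVlt.
by apply/orP; left; apply/eqP; congr `|_|; apply: eq_bigr => l _; ring.
Qed.

End NoiseFree.

(** * Union bound over pairs of columns *)

Section NoiseBound.
Context (R : realType) (d : measure_display) (T : measurableType d) (P : probability T R).
Variables (r : nat) (p : nat -> nat) (alpha : nat -> T -> 'rV[R]_r)
  (eta : nat -> T -> 'rV[R]_r -> R) (u : nat -> nat -> T -> R)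
  (Rdag : forall n : nat, {set 'I_(p n)}) (nu C c C1 : R) (g : nat -> nat -> T -> \bar R).
Local Notation F := (sigmaF alpha eta).
Let H w i l := eta l w (alpha i w).
Hypotheses (C0 : 0 <= C) (bH : forall i l w, `|H w i l| <= C).
Hypotheses
  (malpha : forall i k, measurable_fun setT (fun w => alpha i w 0 k))
  (meta : forall l a, measurable_fun setT (fun w => eta l w a))
  (mu : forall i l, measurable_fun setT (u i l))
  (ceta : forall l w, continuous (eta l w)).
Hypotheses (umean : forall i l, cond_mean_zero P F (u i l)) (ci : cond_indep P F u)
  (nu0 : 0 < nu)
  (gv : forall i l, cexp_version P F (fun w => (`|u i l w| `^ (2 + nu))%:E) (g i l))
  (gfin : {ae P, forall w, exists M : R, forall i l, (g i l w <= M%:E)%E}).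
Hypotheses (pn : \forall n \near \oo, (0 < p n)%N)
  (c0 : 0 < c) (cp : \forall n \near \oo, c * (p n)%:R <= #|Rdag n|%:R)
  (C10 : 0 <= C1)
  (rate : \forall n \near \oo, n%:R `^ (4 / nu) * ln (n%:R : R) `^ ((nu - 2) / nu) / (p n)%:R <= C1).

Let s n : R := Num.sqrt (ln (n%:R : R) / (p n)%:R).

Let bad (G : set T) n y (i k : nat) : set T :=
  [set w | 2 * y <= `|\sum_(l <- rows (Rdag n)) restr_noise u G (i, l) w * restr_noise u G (k, l) w|] `|`
  [set w | 2 * y <= `|\sum_(l <- rows (Rdag n)) H w i l * restr_noise u G (k, l) w|].

Let mF : F `<=` measurable. Proof. exact: sigmaF_measurable. Qed.
Let sF : sigma_algebra setT F. Proof. exact: sigma_algebra_sigmaF. Qed.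

Lemma measurable_restr_noise K k : measurable_fun setT (restr_noise u (moment_event g K) k).
Proof.
apply: measurable_funM => //; apply: measurable_indic; apply: mF.
exact: (moment_event_F sF gv).
Qed.

Lemma measurable_latent i l : measurable_fun setT (fun w => H w i l).
Proof. by apply: (mwrt_measurable mF); exact: mwrt_sigmaF_eval. Qed.

Lemma measurable_bad K n y i k : measurable (bad (moment_event g K) n y i k).
Proof.
apply: measurableU; rewrite -[X in measurable X]setTI; apply: measurable_fun_ler => //;
  apply: measurableT_comp => //; apply: measurable_sum => l; apply: measurable_funM;
  by [exact: measurable_restr_noise|exact: measurable_latent].
Qed.

Lemma bad_prob (K : R) n y i k lam : 0 <= K -> 0 < y -> 0 < lam -> i != k ->
  (P (bad (moment_event g K) n y i k) <=
   (2 * tail_bound (2 + nu) (K * K) lam y #|Rdag n|%:R +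
    2 * tail_bound (2 + nu) (K * C `^ (2 + nu)) lam y #|Rdag n|%:R)%:E)%E.
Proof.
move=> K0 y0 lam0 ik.
set G := moment_event g K.
have FG : F G by exact: (moment_event_F sF gv).
have q2 : 2 <= 2 + nu by rewrite lerDl ltW.
have umom i' l A : F A -> (\int[P]_(w in A `&` G) (`|u i' l w| `^ (2 + nu))%:E <= K%:E * P A)%E.
  exact: (moment_event_bound sF mF gv).
have q0 : 0 <= 2 + nu by lra.
apply: le_trans (measureU2 _ _ _) _.
- rewrite -[X in measurable X]setTI; apply: measurable_fun_ler => //.
  apply: measurableT_comp => //; apply: measurable_sum => l; apply: measurable_funM;
    exact: measurable_restr_noise.
- rewrite -[X in measurable X]setTI; apply: measurable_fun_ler => //.
  apply: measurableT_comp => //; apply: measurable_sum => l; apply: measurable_funM;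
    by [exact: measurable_restr_noise|exact: measurable_latent].
rewrite EFinD -(size_rows (Rdag n)); apply: leeD.
  apply: (pair_tail sF mF mu ci FG q2 K0 umean umom (k := k) (J := fun l => pred1 (i, l))
    (X := fun l => restr_noise u G (i, l))) => //.
  - by move=> l; apply: mwrt_restr_noise => //; exact: eqxx.
  - by move=> l l' ll' [a b] /eqP[_ ->] /eqP[_ E]; move: ll'; rewrite E eqxx.
  - by move=> l l'; rewrite !inE; apply/eqP => -[E _]; move: ik; rewrite E eqxx.
  - by move=> l A FA; exact: (restr_noise_moment q2 umom (i, l) FA).
  - exact: rows_uniq.
apply: (pair_tail sF mF mu ci FG q2 K0 umean umom (k := k) (J := fun l => pred0)
    (X := fun l w => H w i l)) => //.
- by move=> l; apply: mwrt_F_Fcyl; exact: mwrt_sigmaF_eval.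
- exact: powR_ge0.
- move=> l A FA; apply: (@le_trans _ _ (\int[P]_(w in A) (C `^ (2 + nu))%:E)%E).
    apply: ge0_le_integral => //; first exact: mF.

    + apply/measurable_EFinP; apply: measurable_funTS; apply: (measurableT_comp (measurable_powR _)).
      by apply: measurableT_comp => //; exact: measurable_latent.
    + by move=> w _; rewrite lee_fin ge0_ler_powR// nnegrE.
  by rewrite integral_cst//; exact: mF.
- exact: rows_uniq.
Qed.

Lemma noise_bound : lesssimP P
  (fun n w => \big[Num.max/0]_(i < n) \big[Num.max/0]_(j < n)
     `|rho n (Rdag n) (fun i l => eta l w (alpha i w) + u i l w) i j -
       rho n (Rdag n) (fun i l => eta l w (alpha i w)) i j - 0|)
  (fun n _ => Num.sqrt (ln (n%:R : R) / (p n)%:R)).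
Proof.
apply: lesssimP_criterion => e e0.
have e2 : 0 < e / 2 by rewrite divr_gt0.
have [K hK] := moment_event_prob sF mF gv gfin e2.
set G := moment_event g K%:R in hK.
have mG : measurable (~` G) by apply: measurableC; apply: mF; exact: (moment_event_F sF gv).
(* Moment constants of the products noise times noise and signal times noise. *)
pose M1 : R := K%:R * K%:R; pose M2 : R := K%:R * C `^ (2 + nu).
have M10 : 0 <= M1 by rewrite mulr_ge0.
have M20 : 0 <= M2 by rewrite mulr_ge0// powR_ge0.
pose C2 := C1 `^ (nu / 2); have C20 : 0 <= C2 by exact: powR_ge0.
pose Am (M : R) := 576 * (C2 * M / c + C2 ^+ 2 * M ^+ 2).
pose Bm (M : R) := 24 * (4 / c + 2 + (C2 + 2) * M).
have Am0 M : 0 <= M -> 0 <= Am M.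
  move=> M0; apply: (mulr_ge0 (ler0n R 576)); apply: addr_ge0.
    by apply: divr_ge0; [exact: mulr_ge0|exact: ltW].
  by apply: mulr_ge0; exact: sqr_ge0.
have Bm0 M : 0 <= M -> 0 <= Bm M.
  move=> M0; apply: (mulr_ge0 (ler0n R 24)); apply: addr_ge0.
    by apply: addr_ge0 => //; apply: divr_ge0 => //; exact: ltW.
  by apply: mulr_ge0 => //; exact: addr_ge0.
have A0 := addr_ge0 (Am0 _ M10) (Am0 _ M20).
have D0 : 0 <= 8 * (Am M1 + Am M2) / e by apply: divr_ge0; [exact: mulr_ge0|exact: ltW].
have B10 := Bm0 _ M10; have B20 := Bm0 _ M20.
(* The terms [Bm] meet the requirement of [tail_bound_rate] for both moment constants; the last
   term, with x >= 1, brings the remainder of order x^-2 below e / 4. *)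
exists (Bm M1 + Bm M2 + 1 + 8 * (Am M1 + Am M2) / e) => x xge.
have x1 : 1 <= x by lra.
have x0 : 0 < x by lra.
have xB1 : Bm M1 <= x by lra.
have xB2 : Bm M2 <= x by lra.
have xA : 2 * (Am M1 + Am M2) / x ^+ 2 <= e / 4.
  have h : 8 * (Am M1 + Am M2) <= x * e by rewrite -ler_pdivrMr//; lra.
  rewrite ler_pdivrMr ?exprn_gt0//; apply: (@le_trans _ _ (e / 4 * x)); first lra.
  by rewrite ler_wpM2l ?divr_ge0 ?(ltW e0)// expr2 -{1}[x]mulr1 ler_wpM2l// (ltW x0).
have e40 : 0 <= e / 4 by rewrite divr_ge0// ltW.
(* From here on 4 / n^2 <= e / 4, which handles the sum of the terms n^-4. *)
have [n0 hn0] : exists n0 : nat, 16 / e < n0%:R.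
  by exists (Num.truncn (16 / e)).+1; exact: truncnS_gt.
near=> n.
have hp : (0 < p n)%N by near: n.
have hc : c * (p n)%:R <= #|Rdag n|%:R by near: n.
have hr : n%:R `^ (4 / nu) * ln (n%:R : R) `^ ((nu - 2) / nu) / (p n)%:R <= C1 by near: n.
have n2 : (2 <= n)%N by near: n; exists 2%N.
have nn0 : (n0 <= n)%N by near: n; exists n0.
have N1 : 1 < n%:R :> R by rewrite ltr1n.
have N0 : 0 < n%:R :> R by lra.
have ne : 16 / e < n%:R by apply: lt_le_trans hn0 _; rewrite ler_nat.
have l0 : 0 < ln (n%:R : R) by exact: ln_gt0.
have lN : ln (n%:R : R) <= n%:R by apply: ltW; exact: ln_sublinear.
have p0 : 0 < (p n)%:R :> R by rewrite ltr0n.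
have lp0 : 0 < ln (n%:R : R) / (p n)%:R by exact: divr_gt0.
have s0 : 0 < s n by rewrite sqrtr_gt0.
have sp : s n ^+ 2 * (p n)%:R = ln (n%:R : R) by rewrite sqr_sqrtr ?ltW// divfK// gt_eqF.
have snu := powR_nu_rate nu0 N1 l0 p0 C10 hr.
have L0 : 0 < #|Rdag n|%:R :> R by apply: lt_le_trans hc; exact: mulr_gt0.
have L0' : (0 < #|Rdag n|)%N by rewrite -(ltr0n R).
(* Sums below 2 y change the distance by at most 12 y / |R| = x s / 2 in [rho_noise], strictly below
   the threshold x s. *)
pose y := x * s n * #|Rdag n|%:R / 24.
have y0 : 0 < y by apply: divr_gt0 => //; apply: mulr_gt0 => //; exact: mulr_gt0.
have tb M : 0 <= M -> Bm M <= x -> tail_bound (2 + nu) M (s n) y #|Rdag n|%:R <=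
    n%:R ^- 4 + Am M / x ^+ 2 / n%:R ^+ 2.
  by move=> M0 xB; exact: (tail_bound_rate nu0 M0 s0 N1 erefl l0 lN p0 c0 C20 sp hc snu xB).
pose E (ik : 'I_n * 'I_n) := if ik.1 != ik.2 then bad G n y ik.1 ik.2 else set0.
have mE ik : measurable (E ik) by rewrite /E; case: ifP => // _; exact: measurable_bad.
pose q0 := 2 * (n%:R ^- 4 + Am M1 / x ^+ 2 / n%:R ^+ 2) + 2 * (n%:R ^- 4 + Am M2 / x ^+ 2 / n%:R ^+ 2).
have PE ik : (P (E ik) <= q0%:E)%E.
  rewrite /E; case: ifP => [ik12|_]; last first.
    rewrite measure0 lee_fin addr_ge0// mulr_ge0// addr_ge0 ?invr_ge0 ?exprn_ge0//;
      by rewrite !divr_ge0 ?exprn_ge0 ?Am0// ltW.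
  apply: le_trans (bad_prob n (ler0n R K) y0 s0 ik12) _.
  by rewrite lee_fin lerD// ler_wpM2l// tb.
have ev : [set w | x * `|s n| <= `|\big[Num.max/0]_(i < n) \big[Num.max/0]_(j < n)
     `|rho n (Rdag n) (fun i l => eta l w (alpha i w) + u i l w) i j -
       rho n (Rdag n) (fun i l => eta l w (alpha i w)) i j - 0| |]
    `<=` ~` G `|` \big[setU/set0]_(ik : 'I_n * 'I_n) E ik.
  move=> w /=; apply: contraPP => /not_orP[/contrapT Gw nE].
  have nb i k : (i < n)%N -> (k < n)%N -> i != k -> ~ bad G n y i k w.
    move=> iN kN ik hb; apply: nE; rewrite -bigcup_seq.
    by exists (Ordinal iN, Ordinal kN); rewrite /= ?mem_index_enum// /E /= ik.
  have ru k : restr_noise u G k w = u k.1 k.2 w by rewrite /restr_noise indicE mem_set// mulr1.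
  apply/negP; rewrite -ltNge (ger0_norm (ltW s0)) ger0_norm; last exact: bigmax_ge_id.
  apply: (@le_lt_trans _ _ (x * s n / 2)); last first.
    by rewrite ltr_pdivrMr// ltr_pMr ?mulr_gt0// ltr1n.
  have h0 : 0 <= x * s n / 2 by rewrite divr_ge0// mulr_ge0// ltW.
  apply: bigmax_le => // i _; apply: bigmax_le => // j _; rewrite subr0.
  have -> : x * s n / 2 = 6 * (2 * y) / #|Rdag n|%:R by rewrite /y; field; rewrite gt_eqF.
  apply: (rho_noise L0' (H := H w) (u := fun i l => u i l w)) => //.
  - by rewrite mulr_ge0// ltW.
  - move=> i' k iN kN ik; have /not_orP[/= /negP] := nb i' k iN kN ik.
    rewrite -ltNge => h _; apply: ltW; move: h; rewrite sum_rows.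
    by rewrite (eq_bigr (fun l : 'I_(p n) => u i' l w * u k l w))// => l _; rewrite !ru.
  - move=> i' k iN kN ik; have /not_orP[_ /= /negP] := nb i' k iN kN ik.
    rewrite -ltNge => h; apply: ltW; move: h; rewrite (sum_rows _ (fun l => H w i' l * restr_noise u G (k, l) w)).
    by rewrite (eq_bigr (fun l : 'I_(p n) => H w i' l * u k l w))// => l _; rewrite ru.
apply: (@le_trans _ _ (P (~` G `|` \big[setU/set0]_(ik : 'I_n * 'I_n) E ik))).
  apply: le_measure; rewrite ?inE//; last first.
    by apply: measurableU => //; exact: bigsetU_measurable.
  rewrite -[X in measurable X]setTI; apply: measurable_fun_ler => //.
  apply: measurableT_comp => //.
  apply: (@measurable_bigop_if _ _ _ _ _ _ (fun=> 0) (fun _ _ => true)) => //; first exact: measurable_maxr.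
  move=> i; apply: (@measurable_bigop_if _ _ _ _ _ _ (fun=> 0) (fun _ _ => true)) => //; first exact: measurable_maxr.
  move=> j; apply: measurableT_comp => //; apply: measurable_funB => //; apply: measurable_funB.
    apply: (@measurable_rho _ _ _ _ _ _ (fun i l w => eta l w (alpha i w) + u i l w)) => i' l.
    by apply: measurable_funD => //; exact: measurable_latent.
  by apply: (@measurable_rho _ _ _ _ _ _ (fun i l w => eta l w (alpha i w))) => i' l; exact: measurable_latent.
apply: le_trans (measureU2 _ _ _) _ => //; first exact: bigsetU_measurable.
have -> : e%:E = ((e / 2)%:E + (e / 2)%:E)%E by rewrite -EFinD; congr EFin; field.
apply: leeD => //; apply: le_trans (measure_bigsetU_le _ _ mE) _.
apply: (@le_trans _ _ (\sum_(ik : 'I_n * 'I_n) q0%:E)%E); first by apply: lee_sum => ik _; exact: PE.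
rewrite sumEFin lee_fin sumr_const card_prod card_ord -[q0 *+ _]mulr_natl natrM.
have -> : n%:R * n%:R * q0 = 4 / n%:R ^+ 2 + 2 * (Am M1 + Am M2) / x ^+ 2.
  by rewrite /q0; field; rewrite !gt_eqF.
have : 4 / n%:R ^+ 2 <= e / 4.
  rewrite ler_pdivrMr ?exprn_gt0//; apply: (@le_trans _ _ (e / 4 * n%:R)).
    by move: ne; rewrite ltr_pdivrMr//; lra.
  by rewrite ler_wpM2l// expr2 -{1}[n%:R]mulr1 ler_wpM2l// ltW.
by move: xA; lra.
Unshelve. all: by end_near. Qed.

End NoiseBound.

Theorem mainTheorem6
  (R : realType) (d : measure_display) (T : measurableType d)
  (P : probability T R)
  (r : nat) (p : nat -> nat) (mbar : nat) (nu : R)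
  (alpha : nat -> T -> 'rV[R]_r)
  (eta : nat -> T -> 'rV[R]_r -> R)
  (u : nat -> nat -> T -> R)
  (Aset : set 'rV[R]_r)
  (Rdag : forall n : nat, {set 'I_(p n)})
  (Qb : forall n : nat, T -> 'rV[R]_r -> 'M[R]_(#|Rdag n|, r)) :
  (* dimensions; n, p -> oo *)
  (0 < r)%N ->
  (forall M : nat, \forall n \near \oo, (M <= p n)%N) ->
  (* the latent variables, latent functions and noise are random variables *)
  (forall i k, measurable_fun setT (fun w => alpha i w 0 k)) ->
  (forall l a, measurable_fun setT (fun w => eta l w a)) ->
  (forall i l, measurable_fun setT (u i l)) ->
  (* Assumption 1(a) *)
  compact Aset -> convex_set Aset ->
  indep_family P (fun i => sigma_rv (alpha i)) ->
  density_on P alpha Aset ->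
  (* Assumption 1(b) *)
  (2 <= mbar)%N ->
  (forall l w, Cm mbar (eta l w)) ->
  (exists C : R, forall l w (s : seq 'I_r) x,
      (size s <= mbar)%N -> `|pderiv s (eta l w) x| <= C) ->
  (* E[u_i | F] = 0 *)
  (forall i l, cond_mean_zero P (sigmaF alpha eta) (u i l)) ->
  (* Assumption 1(c) *)
  cond_indep P (sigmaF alpha eta) u ->
  0 < nu ->
  (exists g : nat -> nat -> T -> \bar R,
      (forall i l, cexp_version P (sigmaF alpha eta)
                     (fun w => (`|u i l w| `^ (2 + nu))%:E) (g i l)) /\
      {ae P, forall w, exists M : R, forall i l, (g i l w <= M%:E)%E}) ->
  (* row splitting: p^dagger ~ p^ddagger ~ p *)
  (exists c : R, 0 < c /\ \forall n \near \oo,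
      c * (p n)%:R <= #|Rdag n|%:R /\ c * (p n)%:R <= #|~: Rdag n|%:R) ->
  (* the fixed orthonormal bases of the tangent spaces *)
  (forall n w a, Aset a ->
      \rank (jac (Rdag n) (eta ^~ w) a) = r ->
      onb_colspace (Qb n w a) (jac (Rdag n) (eta ^~ w) a)) ->
  (* condition (i) *)
  (forall eps : R, 0 < eps ->
      limn_esup (fun n => P [set w | exists i j : 'I_n,
          rho n (Rdag n) (fun i0 l => eta l w (alpha i0 w)) i j < D /\
          eps < enorm (alpha i w - alpha j w)]) @[D --> 0^'+] --> 0%E) ->
  (* condition (ii) *)
  (exists c : R, 0 < c /\
      P [set w | forall i : 'I_n, c <= smin (gram (Rdag n) (eta ^~ w) (alpha i w))]
        @[n --> \oo] --> 1%E) ->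
  (* condition (iii) *)
  (exists c' : R, 0 < c' /\
      P [set w | forall (l : 'I_r) (i : 'I_n),
          c' <= sup [set (#|Rdag n|%:R)^-1 *
                         proj_norm2 (Qb n w (alpha i w)) l (etavec (Rdag n) (eta ^~ w) a)
                    | a in Aset]]
        @[n --> \oo] --> 1%E) ->
  (* rate condition *)
  lesssim (fun n => (n%:R `^ (4 / nu)) * ((ln (n%:R : R)) `^ ((nu - 2) / nu)) / (p n)%:R)
          (fun _ => 1) ->
  (* Conclusion: Assumption 2 with a_n = ((log n)/p)^{1/2}, rho_0 = 0,
     lower and upper exponents equal to 1 *)
  let X w := fun i l => eta l w (alpha i w) + u i l w in
  let H w := fun i l => eta l w (alpha i w) in
  [/\ lesssimP P
        (fun n w => \big[Num.max/0]_(i < n) \big[Num.max/0]_(j < n)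
             `|rho n (Rdag n) (X w) i j - rho n (Rdag n) (H w) i j - 0|)
        (fun n _ => Num.sqrt (ln (n%:R : R) / (p n)%:R)),
      lesssimP P
        (fun n w => \big[Num.max/0]_(i < n) \big[Num.max/0]_(j < n | alpha i w != alpha j w)
             (rho n (Rdag n) (H w) i j / enorm (alpha i w - alpha j w) `^ 1))
        (fun _ _ => 1)
    & lesssimP P
        (fun _ _ => 1)
        (fun n w =>
           let mx := \big[Num.max/0]_(i < n) \big[Num.max/0]_(j < n | alpha i w != alpha j w)
             (rho n (Rdag n) (H w) i j / enorm (alpha i w - alpha j w) `^ 1) in
           \big[Num.min/mx]_(i < n) \big[Num.min/mx]_(j < n | alpha i w != alpha j w)
             (rho n (Rdag n) (H w) i j / enorm (alpha i w - alpha j w) `^ 1))].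
Proof.
move=> r0 pinf malpha meta mu cA vA ind dens m2 cm [C bd] umean ci nu0 [g [gv gfin]] [c [c0 hc]] _ matching [cs [cs0 spread]] _ [C1 rate] X H.
(* The given bound may fail to be positive when r and the derivatives say nothing about its sign;
   the local estimate divides by its square. *)
pose C' := Num.max C 1.
have C0 : 0 < C' by rewrite lt_max ltr01 orbT.
have reg l w : regular_fun C' (eta l w).
  by apply: (regular_of_Cm m2 (cm l w) (ltW C0)) => s x hs; rewrite le_max bd.
have ceta l w : continuous (eta l w) by have [] := cm l w [::] (leq0n _).
have deta l w x k : derivable (eta l w) x (unitvec k).
  by have [_] := cm l w [::] (leq0n _); apply; exact: ltn_trans m2.
have cdeta l w k : continuous ('D_(unitvec k) (eta l w)) by have [] := cm l w [:: k] (ltnW m2).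
split.
- apply: (noise_bound (nu := nu) (C := C') (c := c) (C1 := `|C1|) (g := g)) => //.
  + exact: ltW.
  + by move=> i l w; exact: reg_bound (reg l w) _.
  + by apply: filterS hc => n [].
  + apply: filterS rate => n; rewrite normr1 mulr1 => h.
    by apply: le_trans (ler_norm _) _; apply: le_trans h _; exact: ler_norm.
- exact: (ratio_upper P alpha Rdag C0 reg).
- exact: (ratio_lower C0 reg r0 malpha cA vA ind dens meta ceta deta cdeta matching cs0 spread).
Qed.
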